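(* Let $(M,g)$ be an $n$-dimensional Riemannian manifold, $n\geq 3$, with $g\in C^r$, $r>2$. In conformal harmonic coordinates the Cotton tensor of the determinant normalized metric $\hat g=|g|^{-1/n}g$ satisfies $$C_{abc}(\hat g)=-\frac{1}{2(n-2)}\,\hat g^{de}\partial_d\partial_e\big(\partial_a\hat g_{bc}-\partial_b\hat g_{ac}\big)+T_2(\hat g).$$ Moreover, the Cotton tensor can be regarded as an overdetermined elliptic operator for the determinant normalized metric in conformal harmonic coordinates: there is a quasilinear third order differential operator $Q$ acting on positive definite symmetric matrix fields, whose linearization has injective principal symbol on symmetric matrices for every $\xi\in\mathbb{R}^n\setminus\{0\}$, such that $C(\hat g)=Q(\hat g)$ holds in conformal harmonic coordinates.
   Context: $|g|=\det(g_{ab})$ in the coordinates considered. $T_2(\hat g)$ denotes an unspecified polynomial in the components of $\hat g$, of $\hat g^{-1}$ and of the partial derivatives of $\hat g$ up to order $2$. The identity is understood in the sense of distributions when $\hat g$ is not three times differentiable. Schouten tensor $P_{ab}=\frac{1}{n-2}\big(R_{ab}-\frac{R}{2(n-1)}g_{ab}\big)$, where $R_{ab}$ is the Ricci tensor and $R$ the scalar curvature; Cotton tensor $C_{abc}=\nabla_aP_{bc}-\nabla_bP_{ac}$. $L_g=\Delta_g+\frac{n-2}{4(n-1)}R(g)$, where $\Delta_gu=-|g|^{-1/2}\partial_a(|g|^{1/2}g^{ab}\partial_bu)$. Conformal harmonic coordinates on an open set $\Omega$: coordinates $(Z^1,\ldots,Z^n)$ on $\Omega$ such that $Z^k=f^k/f$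 for some $C^2$ functions $f^k$ and $f>0$ on $\Omega$ with $L_gf^k=L_gf=0$. The principal symbol of a quasilinear operator is that of its linearization at $\hat g$; overdetermined elliptic means that the principal symbol is injective. *)

(* Defs.v *)
(* MathComp / MathComp-Analysis *)
From mathcomp Require Import all_boot all_order all_algebra.
From mathcomp Require Import all_classical all_reals all_analysis.
From mathcomp Require mpoly.

Set Implicit Arguments.
Unset Strict Implicit.
Unset Printing Implicit Defensive.

Import Order.TTheory GRing.Theory Num.Theory numFieldNormedType.Exports.

Local Open Scope classical_set_scope.
Local Open Scope ring_scope.

Section Regularity.
Variables (R : realType) (n : nat).
Implicit Types (U : set 'rV[R]_n) (f : 'rV[R]_n -> R).

Definition pd (i : 'I_n) f : 'rV[R]_n -> R := fun x => 'D_('e_i) f x.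

(* pds [:: i1; ...; im] f = pd i1 (... (pd im f)) *)
Definition pds (s : seq 'I_n) f : 'rV[R]_n -> R := foldr pd f s.

Definition Ck (k : nat) U f : Prop :=
  forall s : seq 'I_n, (size s <= k)%N ->
    (forall x, U x -> {for x, continuous (pds s f)}) /\
    ((size s < k)%N -> forall i x, U x -> derivable (pds s f) x 'e_i).

Definition smooth U f : Prop := forall k, Ck k U f.

(* C^r for real r >= 0: with k the integer part of r, f is C^k and, if r is not
   an integer, its derivatives of order k are locally (r - k)-Hoelder. *)
Definition Cr (r : R) U f : Prop :=
  let k := Num.truncn r in
  Ck k U f /\
  (k%:R < r ->
   forall s : seq 'I_n, size s = k -> forall x, U x ->
   exists e C : R, 0 < e /\
     forall y z, ball x e y -> ball x e z ->
       `|pds s f y - pds s f z| <= C * `|y - z| `^ (r - k%:R)).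

End Regularity.

Section Manifold.
Variables (R : realType) (n : nat) (M : topologicalType).

(* coo is meaningful on dom only, and its inverse pt on coo @` dom only. *)
Record chart := Chart {
  dom : set M;
  coo : M -> 'rV[R]_n;
  pt : 'rV[R]_n -> M }.

Definition rng (c : chart) : set 'rV[R]_n := coo c @` dom c.

Definition is_chart (c : chart) : Prop :=
  [/\ open (dom c), open (rng c),
      forall p, dom c p -> pt c (coo c p) = p,
      forall p, dom c p -> {for p, continuous (coo c)} &
      forall x, rng c x -> {for x, continuous (pt c)}].

Definition overlap (c c' : chart) : set 'rV[R]_n := coo c @` (dom c `&` dom c').

Definition transition (c c' : chart) : 'rV[R]_n -> 'rV[R]_n :=
  fun x => coo c' (pt c x).

Definition smooth_compatible (c c' : chart) : Prop :=
  forall j, smooth (overlap c c') (fun x => transition c c' x 0 j) /\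
            smooth (overlap c' c) (fun x => transition c' c x 0 j).

Definition Cr_compatible (s : R) (c c' : chart) : Prop :=
  forall j, Cr s (overlap c c') (fun x => transition c c' x 0 j) /\
            Cr s (overlap c' c) (fun x => transition c' c x 0 j).

Record smooth_manifold := SmoothManifold {
  atlas : set chart;
  manifold_hausdorff : hausdorff_space M;
  manifold_second_countable : @second_countable M;
  atlas_chart : forall c, atlas c -> is_chart c;
  atlas_cover : forall p, exists2 c, atlas c & dom c p;
  atlas_compatible :
    forall c c', atlas c -> atlas c' -> smooth_compatible c c' }.

Definition coordinates (s : R) (A : smooth_manifold) (c : chart) : Prop :=
  is_chart c /\ forall c', atlas A c' -> Cr_compatible s c c'.

End Manifold.

(* Not assuming H symmetric makes this an open condition on all matrices. *)
Definition posdef (R : realType) (n : nat) (H : 'M[R]_n) : Prop :=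
  forall y : 'rV[R]_n, y != 0 -> 0 < (y *m H *m y^T) 0 0.

Definition symmetric_mx (R : realType) (n : nat) (H : 'M[R]_n) : Prop := H^T = H.

Definition entry (R : realType) (n : nat) (h : 'rV[R]_n -> 'M[R]_n)
  (a b : 'I_n) : 'rV[R]_n -> R := fun x => h x a b.

(* A Riemannian metric of class C^r, given by its components in every
   coordinate system of class at least C^2. The metric is C^r in the charts of
   the atlas; as its components transform with the first derivatives of the
   transition maps, they are C^s in coordinates of class C^(s+1), s <= r. *)
Record metric (R : realType) (n : nat) (M : topologicalType)
    (A : smooth_manifold R n M) (r : R) := Metric {
  gcomp : chart R n M -> 'rV[R]_n -> 'M[R]_n;
  metric_Cr : forall (s : R) c, 1 <= s <= r -> coordinates (s + 1) A c ->
    forall a b, Cr s (rng c) (entry (gcomp c) a b);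
  metric_posdef : forall c, coordinates 2 A c -> forall x, rng c x ->
    symmetric_mx (gcomp c x) /\ posdef (gcomp c x);
  metric_transform : forall c c', coordinates 2 A c -> coordinates 2 A c' ->
    forall x, overlap c c' x ->
    let J : 'M[R]_n :=
      \matrix_(i, j) pd i (fun y => transition c c' y 0 j) x in
    gcomp c x = J *m gcomp c' (transition c c' x) *m J^T }.

Section Tensors.
Variables (R : realType) (n : nat) (h : 'rV[R]_n -> 'M[R]_n).

Definition ginv (a b : 'I_n) : 'rV[R]_n -> R := fun x => invmx (h x) a b.

(* Christoffel c a b is the symbol with upper index c and lower indices a, b. *)
Definition Christoffel (c a b : 'I_n) : 'rV[R]_n -> R := fun x =>
  2^-1 * \sum_d ginv c d x *
    (pd a (entry h b d) x + pd b (entry h a d) x - pd d (entry h a b) x).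

(* The sign is such that round spheres have positive curvature. *)
Definition Ricci (a b : 'I_n) : 'rV[R]_n -> R := fun x =>
  \sum_c (pd c (Christoffel c a b) x - pd b (Christoffel c a c) x) +
  \sum_c \sum_d (Christoffel c c d x * Christoffel d a b x -
                 Christoffel c b d x * Christoffel d a c x).

Definition scalar_curvature : 'rV[R]_n -> R := fun x =>
  \sum_a \sum_b ginv a b x * Ricci a b x.

Definition Schouten (a b : 'I_n) : 'rV[R]_n -> R := fun x =>
  (n%:R - 2)^-1 *
  (Ricci a b x - scalar_curvature x / (2 * (n%:R - 1)) * h x a b).

Definition Laplacian (u : 'rV[R]_n -> R) : 'rV[R]_n -> R := fun x =>
  - (Num.sqrt (\det (h x)))^-1 *
  \sum_a pd a (fun y =>
    \sum_b Num.sqrt (\det (h y)) * ginv a b y * pd b u y) x.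

Definition conformal_Laplacian (u : 'rV[R]_n -> R) : 'rV[R]_n -> R := fun x =>
  Laplacian u x +
  (n%:R - 2) / (4 * (n%:R - 1)) * scalar_curvature x * u x.

Definition det_normalized : 'rV[R]_n -> 'M[R]_n := fun x =>
  (\det (h x)) `^ (- n%:R^-1) *: h x.

Definition nabla_Schouten (a b c : 'I_n) : 'rV[R]_n -> R := fun x =>
  pd a (Schouten b c) x -
  \sum_d (Christoffel d a b x * Schouten d c x +
          Christoffel d a c x * Schouten b d x).

Definition Cotton (a b c : 'I_n) : 'rV[R]_n -> R := fun x =>
  nabla_Schouten a b c x - nabla_Schouten b a c x.

Definition third_order (a b c : 'I_n) : 'rV[R]_n -> R := fun x =>
  \sum_d \sum_e ginv d e x *
    pd d (pd e (fun y => pd a (entry h b c) y - pd b (entry h a c) y)) x.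

End Tensors.

(* Conformal harmonic coordinates on the open set dom Z. They are assumed to be
   of class C^3, so that the metric components are C^2 in them. *)
Definition conformal_harmonic (R : realType) (n : nat) (M : topologicalType)
    (A : smooth_manifold R n M) (r : R) (g : metric A r) (Z : chart R n M) :
    Prop :=
  coordinates 3 A Z /\
  exists (fk : 'I_n -> M -> R) (f : M -> R),
  [/\ (forall k, Ck 2 (rng Z) (fk k \o pt Z)) /\ Ck 2 (rng Z) (f \o pt Z),
      forall p, dom Z p -> 0 < f p,
      forall p, dom Z p -> forall k, coo Z p 0 k = fk k p / f p &
      forall x, rng Z x ->
        (forall k, conformal_Laplacian (gcomp g Z) (fk k \o pt Z) x = 0) /\
        conformal_Laplacian (gcomp g Z) (f \o pt Z) x = 0].

Section Distributions.
Variable R : realType.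

(* The integral over R^n as an iterated Lebesgue integral; it is only applied
   to continuous functions of compact support. *)
Fixpoint integral_rV (n : nat) : ('rV[R]_n -> R) -> R :=
  if n is m.+1 then
    fun F : 'rV[R]_(m.+1) -> R =>
      Rintegral (@lebesgue_measure R) setT (fun t : R =>
        integral_rV
          (fun v : 'rV[R]_m => F (row_mx (const_mx t : 'rV[R]_1) v)))
  else fun F => F 0.

Variable n : nat.
Implicit Types (U : set 'rV[R]_n) (phi F : 'rV[R]_n -> R).

Definition test_function U phi : Prop :=
  smooth setT phi /\
  exists K : set 'rV[R]_n,
    [/\ compact K, K `<=` U & forall x, ~ K x -> phi x = 0].

Definition distribution := ('rV[R]_n -> R) -> R.

Definition dfun F : distribution := fun phi => integral_rV (fun x => F x * phi x).

Definition dpd (i : 'I_n) (S : distribution) : distribution :=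
  fun phi => - S (pd i phi).

(* For S of order at most one, S also acts on the C^1 function F phi. *)
Definition dmul F (S : distribution) : distribution :=
  fun phi => S (fun x => F x * phi x).

Definition deq U (S S' : distribution) : Prop :=
  forall phi, test_function U phi -> S phi = S' phi.

Variable h : 'rV[R]_n -> 'M[R]_n.

(* For h of class C^2 the Schouten tensor is continuous, hence only the outer
   derivative has to be taken in the sense of distributions. *)
Definition dnabla_Schouten (a b c : 'I_n) : distribution := fun phi =>
  dpd a (dfun (Schouten h b c)) phi -
  dfun (fun x => \sum_d (Christoffel h d a b x * Schouten h d c x +
                         Christoffel h d a c x * Schouten h b d x)) phi.

Definition dCotton (a b c : 'I_n) : distribution := fun phi =>
  dnabla_Schouten a b c phi - dnabla_Schouten b a c phi.

Definition dthird_order (a b c : 'I_n) : distribution := fun phi =>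
  \sum_d \sum_e dmul (ginv h d e)
    (dpd d (dfun (pd e
      (fun y => pd a (entry h b c) y - pd b (entry h a c) y)))) phi.

End Distributions.

Section Jets.
Variables (R : realType) (n : nat).

(* Indices of the coordinates of the 1-jet, resp. 2-jet, of a matrix field:
   (a, b) for h_ab, (c, a, b) for d_c h_ab, (d, c, a, b) for d_d d_c h_ab. *)
Definition jet1_index : Type := ('I_n * 'I_n + 'I_n * 'I_n * 'I_n)%type.
Definition jet2_index : Type :=
  (jet1_index + 'I_n * 'I_n * 'I_n * 'I_n)%type.

(* 2-jets together with the components (a, b) of the inverse matrix. *)
Definition jet2inv_index : Type := (jet2_index + 'I_n * 'I_n)%type.

Definition jet1_val (h : 'rV[R]_n -> 'M[R]_n) (x : 'rV[R]_n)
    (j : jet1_index) : R :=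
  match j with
  | inl (a, b) => h x a b
  | inr (c, a, b) => pd c (entry h a b) x
  end.

Definition jet2_val (h : 'rV[R]_n -> 'M[R]_n) (x : 'rV[R]_n)
    (j : jet2_index) : R :=
  match j with
  | inl j1 => jet1_val h x j1
  | inr (d, c, a, b) => pd d (pd c (entry h a b)) x
  end.

Definition jet2inv_val (h : 'rV[R]_n -> 'M[R]_n) (x : 'rV[R]_n)
    (j : jet2inv_index) : R :=
  match j with
  | inl j2 => jet2_val h x j2
  | inr (a, b) => ginv h a b x
  end.

Definition jet1 h x : 'rV[R]_#|{: jet1_index}| :=
  \row_i jet1_val h x (enum_val i).
Definition jet2 h x : 'rV[R]_#|{: jet2_index}| :=
  \row_i jet2_val h x (enum_val i).

Definition jet_poly : Type := mpoly.mpoly #|{: jet2inv_index}| R.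

Definition jet_poly_at (T : jet_poly) (h : 'rV[R]_n -> 'M[R]_n) :
    'rV[R]_n -> R :=
  fun x => mpoly.meval (fun i => jet2inv_val h x (enum_val i)) T.

Definition jet1_domain : set 'rV[R]_#|{: jet1_index}| :=
  [set v | posdef (\matrix_(a, b) v 0 (enum_rank (inl (a, b) : jet1_index)))].
Definition jet2_domain : set 'rV[R]_#|{: jet2_index}| :=
  [set v | posdef (\matrix_(a, b)
     v 0 (enum_rank (inl (inl (a, b)) : jet2_index)))].

(* Q(h)_abc = lead_abc^{defpq}(h, dh) d_d d_e d_f h_pq + lower_abc(h, dh, ddh).
   The leading coefficients do not involve ddh: this is what gives a meaning to
   the product with a distributional third derivative when h is only C^2. *)
Record quasilinear3 := Quasilinear3 {
  lead : forall a b c d e f p q : 'I_n, 'rV[R]_#|{: jet1_index}| -> R;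
  lower : forall a b c : 'I_n, 'rV[R]_#|{: jet2_index}| -> R;
  lead_smooth : forall a b c d e f p q,
    smooth jet1_domain (lead a b c d e f p q);
  lower_smooth : forall a b c, smooth jet2_domain (lower a b c) }.

Variable Q : quasilinear3.

Definition qapply (h : 'rV[R]_n -> 'M[R]_n) (a b c : 'I_n) : 'rV[R]_n -> R :=
  fun x =>
  \sum_d \sum_e \sum_f \sum_p \sum_q
    lead Q a b c d e f p q (jet1 h x) * pd d (pd e (pd f (entry h p q))) x +
  lower Q a b c (jet2 h x).

Definition dqapply (h : 'rV[R]_n -> 'M[R]_n) (a b c : 'I_n) :
    distribution R n := fun phi =>
  \sum_d \sum_e \sum_f \sum_p \sum_q
    dmul (fun x => lead Q a b c d e f p q (jet1 h x))
      (dpd d (dfun (pd e (pd f (entry h p q))))) phi +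
  dfun (fun x => lower Q a b c (jet2 h x)) phi.

Definition linearization (h k : 'rV[R]_n -> 'M[R]_n) (a b c : 'I_n) :
    'rV[R]_n -> R :=
  fun x => derive1 (fun t : R => qapply (fun y => h y + t *: k y) a b c x) 0.

(* The principal symbol at (x, xi) of a linear operator L of order 3 is
   k |-> L (u^3 k) (x) / 3!, where u (y) = xi . (y - x); the usual factor i^3,
   irrelevant for injectivity, is omitted. *)
Definition principal_symbol (h : 'rV[R]_n -> 'M[R]_n) (x xi : 'rV[R]_n)
    (k : 'M[R]_n) : 'I_n -> 'I_n -> 'I_n -> R := fun a b c =>
  (3`!)%:R^-1 *
  linearization h (fun y => (((y - x) *m xi^T) 0 0) ^+ 3 *: k) a b c x.

Definition overdetermined_elliptic : Prop :=
  forall (U : set 'rV[R]_n) (h : 'rV[R]_n -> 'M[R]_n),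
  open U ->
  (forall a b, Ck 3 U (entry h a b)) ->
  (forall x, U x -> symmetric_mx (h x) /\ posdef (h x)) ->
  forall x xi, U x -> xi != 0 ->
  forall k k', symmetric_mx k -> symmetric_mx k' ->
    principal_symbol h x xi k = principal_symbol h x xi k' -> k = k'.

End Jets.

(* Main.v *)
(* Write the metric h in the given coordinates as e^(2s) g with det g = 1, let u
   be the positive harmonic function and v = (n - 2) s + 2 ln u. As L_h (x^k u)
   = L_h u = 0, comparing the two equations gives g^{cd} d_c g_{bd} = d_b v. The
   derivatives of these contractions are the only second order terms of Ric(g)
   besides -1/2 g^{de} d_d d_e g_{ab}; being second derivatives of v, they drop
   out of the antisymmetrized derivative of Ric(g). The equation L_h u = 0 itself
   is the conformal transformation law of the scalar curvature, and combined with
   the trace of the formula for Ric(g) it expresses the scalar curvature of g by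
   first derivatives of g. Hence the Schouten tensor of g is
   (n - 2)^-1 (-1/2 g^{de} d_d d_e g_{ab} + d_a d_b v) up to a polynomial in the
   1-jet, and the formula for the Cotton tensor follows; in the sense of
   distributions it follows by integration by parts.

   The symbol of the leading part of that formula annihilates xi (x) xi. Since
   det g = 1, one may add d_a d_b d_c (ln det g) in the form
   d_a (g^{pq} d_b d_c g_{pq} + ...), and the symbol becomes injective. *)

(* The metric is only [C^2], so neither its third derivatives nor the second derivatives of
   [V_b = g^{cd} d_c g_{bd}] exist as functions. Wherever their symmetry is used, it becomes an
   identity of integrals ([int_pd_exchange]): the missing derivatives are put on the test function,
   to which Schwarz applies. Since the iterated integral fixes an order of the variables,
   integration by parts is derived from invariance under translations in every direction, not from
   an exchange of integrals.

   The polynomial and the operator must be chosen before the manifold and the metric. They are built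
   by closure properties of functions of the jet, and the derivatives of the remainders are only
   known to be such functions, never written out.

   The scalar curvature [R] of [g] can be solved for because the trace of Ricci and the equation
   [L_h u = 0] contain the same second order term [g^{ab} d_a V_b], with different coefficients of
   [R]; the trace of [g^{de} d_d d_e g_{ab}] is of first order since [det g = 1].

   The added logarithmic term is symmetric in [a, b] while the Cotton symbol is antisymmetric, so
   the two can be separated again when injectivity is proved. *)
Require Import Defs.
From HB Require Import structures.
From mathcomp Require Import all_boot all_order all_algebra.
From mathcomp Require Import all_classical all_reals all_analysis.
From mathcomp Require Import perm ring lra.
From mathcomp Require mpoly.
Import Order.TTheory GRing.Theory Num.Theory numFieldNormedType.Exports.
Local Open Scope classical_set_scope.
Local Open Scope ring_scope.
Set Implicit Arguments.
Unset Strict Implicit.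
Unset Printing Implicit Defensive.

(** * Partial derivatives and the classes C^k *)

(* A sealed copy of [pd]: otherwise failing unifications unfold derivatives. *)
HB.lock Definition part (R : realType) (n : nat) (i : 'I_n)
  (f : 'rV[R]_n -> R) : 'rV[R]_n -> R := pd i f.

Section PartialDerivatives.
Variables (R : realType) (n : nat).
Implicit Types (U : set 'rV[R]_n) (f g : 'rV[R]_n -> R) (x : 'rV[R]_n).

(** Derivability and value in one statement, so that the rules below chain without separate
    derivability conditions. *)
Definition has_pd (i : 'I_n) f x (d : R) : Prop := is_derive x 'e_i f d.

Lemma has_pdP i f x : derivable f x 'e_i <-> has_pd i f x (part i f x).
Proof. by rewrite part.unlock; split => [/derivableP//|[]]. Qed.

Lemma pdE i f x d : has_pd i f x d -> part i f x = d.
Proof. by rewrite part.unlock; case. Qed.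

Lemma has_pd_derivable i f x d : has_pd i f x d -> derivable f x 'e_i.
Proof. by case. Qed.

Lemma has_pd_eq i f x d d' : has_pd i f x d -> d = d' -> has_pd i f x d'.
Proof. by move=> + <-. Qed.

Lemma open_near U (P : 'rV[R]_n -> Prop) x : open U -> U x ->
  (forall y, U y -> P y) -> \near x, P x.
Proof. by move=> oU Ux UP; apply: filterS UP _; exact: open_nbhs_nbhs. Qed.

Lemma pd_eq U i f g x : open U -> U x -> (forall y, U y -> f y = g y) ->
  part i f x = part i g x.
Proof. by rewrite part.unlock => oU Ux fg; apply: near_eq_derive; exact: (open_near oU Ux). Qed.

Lemma has_pd_cst i (c : R) x : has_pd i (fun=> c) x 0.
Proof. exact: is_derive_cst. Qed.

Lemma has_pdD i f g x df dg : has_pd i f x df -> has_pd i g x dg ->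
  has_pd i (fun y => f y + g y) x (df + dg).
Proof. exact: is_deriveD. Qed.

Lemma has_pdB i f g x df dg : has_pd i f x df -> has_pd i g x dg ->
  has_pd i (fun y => f y - g y) x (df - dg).
Proof. exact: is_deriveB. Qed.

Lemma has_pdM i f g x df dg : has_pd i f x df -> has_pd i g x dg ->
  has_pd i (fun y => f y * g y) x (df * g x + f x * dg).
Proof.
move=> hf hg; have := is_deriveM hf hg => H.
by apply: (is_derive_eq H); rewrite /GRing.scale/= addrC; congr (_ + _); rewrite mulrC.
Qed.

Lemma has_pdZ i (c : R) f x df : has_pd i f x df ->
  has_pd i (fun y => c * f y) x (c * df).
Proof. by move=> hf; apply: (has_pd_eq (has_pdM (has_pd_cst i c x) hf)); ring. Qed.

Lemma has_pd_sum (I : Type) (r : seq I) (P : pred I) i (F : I -> 'rV[R]_n -> R) x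
    (d : I -> R) : (forall j, P j -> has_pd i (F j) x (d j)) ->
  has_pd i (fun y => \sum_(j <- r | P j) F j y) x (\sum_(j <- r | P j) d j).
Proof.
move=> H; elim: r => [|j r IH].
  rewrite big_nil; rewrite (_ : (fun _ => _) = fun=> 0) ?funeqE; first exact: has_pd_cst.
  by move=> y; rewrite big_nil.
rewrite big_cons (_ : (fun y => \sum_(k <- j :: r | P k) F k y) = fun y =>
  if P j then F j y + \sum_(k <- r | P k) F k y else \sum_(k <- r | P k) F k y).
  by case: ifPn => // Pj; apply: has_pdD => //; exact: H.
by rewrite funeqE => y; rewrite big_cons.
Qed.

Lemma has_pd_coord i j x : has_pd i (fun y => y 0 j) x (i == j)%:R.
Proof.
have N : (fun h : R => h^-1 *: (((fun y : 'rV[R]_n => y 0 j) \o shift x) (h *: 'e_i) - x 0 j))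
    @ 0^' --> ((i == j)%:R : R).
  apply: cvg_near_cst; near=> t => /=.
  rewrite !mxE addrK eqxx/= eq_sym /GRing.scale/= mulrA mulVf ?mul1r//.
  by near: t; exact: nbhs_dnbhs_neq.
split; first by apply/cvg_ex; exists ((i == j)%:R).
exact: cvg_lim N.
Unshelve. all: by end_near. Qed.

(** Along the line [s |-> s *: v + x] a directional derivative is an ordinary one, which gives
    access to the chain rule and the mean value theorem in one variable. *)
Lemma line_deriveE (f : 'rV[R]_n -> R) x (v : 'rV[R]_n) (t : R) :
  'D_v f (t *: v + x) = 'D_1 (fun s : R => f (s *: v + x)) t.
Proof.
have E : (fun h : R => h^-1 *: (f (h *: v + (t *: v + x)) - f (t *: v + x))) =
    (fun h : R => h^-1 *: ((fun s : R => f (s *: v + x)) (h%:A + t) - f (t *: v + x))).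
  by rewrite funeqE => h; rewrite scalerDl addrA [h%:A]mulr1.
by rewrite /derive/= E.
Qed.

Lemma line_derive (f : 'rV[R]_n -> R) x (v : 'rV[R]_n) (t : R) :
  derivable f (t *: v + x) v ->
  is_derive t 1 (fun s => f (s *: v + x)) ('D_v f (t *: v + x)).
Proof.
have E : (fun h : R => h^-1 *: (f (h *: v + (t *: v + x)) - f (t *: v + x))) =
    (fun h : R => h^-1 *: ((fun s : R => f (s *: v + x)) (h%:A + t) - f (t *: v + x))).
  by rewrite funeqE => h; rewrite scalerDl addrA [h%:A]mulr1.
by move=> hd; split; [move: hd; rewrite /derivable /= E|rewrite -line_deriveE].
Qed.

(** Only the restriction of [f] to the line through [x] in direction ['e_i] enters, so the chain
    rule of one variable applies although [f] is merely partially derivable. *)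
Lemma has_pd_comp i (phi : R -> R) f x df dphi : has_pd i f x df ->
  is_derive (f x) 1 phi dphi -> has_pd i (fun y => phi (f y)) x (dphi * df).
Proof.
move=> hf hphi.
have df1 : derivable (fun t : R => f (t *: 'e_i + x)) 0 1.
  exact: (derivable1P f x 'e_i).1 (has_pd_derivable hf).
have fx : f (0 *: 'e_i + x) = f x by rewrite scale0r add0r.
have hphi1 : derivable phi (f (0 *: 'e_i + x)) 1 by rewrite fx; case: hphi.
have D : derivable (phi \o (fun t : R => f (t *: 'e_i + x))) 0 1.
  apply/derivable1_diffP/differentiable_comp; exact/derivable1_diffP.
have line (F : 'rV[R]_n -> R) : 'D_('e_i) F x = derive1 (fun t : R => F (t *: 'e_i + x)) 0.
  by rewrite derive1E -line_deriveE scale0r add0r.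
split; first exact: (derivable1P (fun y => phi (f y)) x 'e_i).2 D.
rewrite line [LHS](_ : _ = derive1 (phi \o (fun t : R => f (t *: 'e_i + x))) 0)//.
rewrite (derive1_comp df1 hphi1) -(line f) fx derive1E.
by congr (_ * _); [case: hphi|by case: hf].
Qed.

Lemma has_pd_exp i f x df : has_pd i f x df ->
  has_pd i (fun y => expR (f y)) x (expR (f x) * df).
Proof. by move=> hf; apply: has_pd_comp hf _; exact: is_derive_expR. Qed.

Lemma has_pd_ln i f x df : 0 < f x -> has_pd i f x df ->
  has_pd i (fun y => ln (f y)) x ((f x)^-1 * df).
Proof. by move=> f0 hf; apply: has_pd_comp hf _; exact: is_derive1_ln. Qed.

Lemma has_pd_inv i f x df : f x != 0 -> has_pd i f x df ->
  has_pd i (fun y => (f y)^-1) x (- ((f x)^-1 * (f x)^-1) * df).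
Proof.
move=> f0 hf; apply: (has_pd_comp (phi := @GRing.inv R) hf).
have h1 := @is_derive_id R R (f x) 1.
split; first by apply: derivableV.
by rewrite deriveV//= derive_id scaler1 -exprVn expr2.
Qed.

(** * Closure properties of the classes [C^k] *)

Lemma pds_rcons (s : seq 'I_n) i f : pds (rcons s i) f = pds s (part i f).
Proof. rewrite part.unlock; by elim: s => //= j s ->. Qed.

Lemma Ck0 U f : Ck 0 U f <-> forall x, U x -> {for x, continuous f}.
Proof.
split => [/(_ [::] isT)[]//|H [|//] _]; split => //.
Qed.

(** [pds] applies the last index of the list first, so splitting lists at their right end makes [Ck]
    recursive in the function. The closure properties below then follow by induction on [k]. *)
Lemma CkS k U f : Ck k.+1 U f <->
  [/\ forall x, U x -> {for x, continuous f},
      forall i x, U x -> derivable f x 'e_i &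
      forall i, Ck k U (part i f)].
Proof.
split => [H|[H1 H2 H3]].
  split; [by case: (H [::] isT)|by case: (H [::] isT) => _; exact|].
  move=> i s sk; have := H (rcons s i); rewrite size_rcons pds_rcons => /(_ sk).
  by case=> Hc Hd; split => // /Hd.
move=> s; case/lastP: s => [_|s i]; first by split => // _.
by rewrite size_rcons pds_rcons !ltnS => /H3.
Qed.

Lemma Ck_cont k U f x : Ck k U f -> U x -> {for x, continuous f}.
Proof. by case/(_ [::] isT) => H _; exact: H. Qed.

Lemma CkW k m U f : (m <= k)%N -> Ck k U f -> Ck m U f.
Proof.
move=> mk H s sm; have [H1 H2] := H s (leq_trans sm mk); split => // sm' .
exact: H2 (leq_trans sm' mk).
Qed.

Lemma Ck_sub k U V f : V `<=` U -> Ck k U f -> Ck k V f.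
Proof.
by move=> VU H s sk; have [H1 H2] := H s sk; split => [x /VU/H1//|/H2 h i x /VU]; exact: h.
Qed.

Lemma Ck_local k U f :
  (forall x, U x -> exists V, [/\ open V, V x & Ck k V f]) -> Ck k U f.
Proof.
move=> H s sk; split=> [x Ux|sk' i x Ux]; have [V [_ Vx hV]] := H x Ux.
  by case: (hV s sk) => + _; exact.
by case: (hV s sk) => _ /(_ sk'); exact.
Qed.


Lemma Ck_pd k U f i : Ck k.+1 U f -> Ck k U (part i f).
Proof. by case/CkS. Qed.

Lemma Ck_has_pd k U f i x : Ck k.+1 U f -> U x -> has_pd i f x (part i f x).
Proof. by case/CkS => _ H _ Ux; apply/has_pdP/H. Qed.

Lemma continuous_near_eq f g x : (\near x, f x = g x) ->
  {for x, continuous f} -> {for x, continuous g}.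
Proof.
move=> fg; rewrite /prop_for /continuous_at -(nbhs_singleton fg).
by move=> fc; exact: cvg_trans (near_eq_cvg fg) fc.
Qed.

Lemma Ck_eq k U f g : open U -> (forall x, U x -> f x = g x) ->
  Ck k U f -> Ck k U g.
Proof.
move=> oU; elim: k f g => [|k IH] f g fg.
  rewrite !Ck0 => H x Ux.
  exact (continuous_near_eq (open_near oU Ux fg) (H x Ux)).
case/CkS => H1 H2 H3; apply/CkS; split.
- by move=> x Ux; exact (continuous_near_eq (open_near oU Ux fg) (H1 x Ux)).
- move=> i x Ux; apply: near_eq_derivable (H2 i x Ux).
  exact (open_near oU Ux fg).
- move=> i; refine (IH _ _ _ (H3 i)) => x Ux; exact: (pd_eq i oU Ux fg).
Qed.

(** The derivatives may be given by formulas valid on [U]; when these involve the function itself,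
    as for [expR] or the inverse, the induction on [k] closes. *)
Lemma Ck_intro k U f (d : 'I_n -> 'rV[R]_n -> R) : open U ->
  (forall x, U x -> {for x, continuous f}) ->
  (forall i x, U x -> has_pd i f x (d i x)) ->
  (forall i, Ck k U (d i)) -> Ck k.+1 U f.
Proof.
move=> oU fc fd dk; apply/CkS; split => // [i x Ux|i].
  exact: has_pd_derivable (fd i x Ux).
by apply: Ck_eq (dk i) => // x Ux; rewrite (pdE (fd i x Ux)).
Qed.

Lemma Ck_cst k U (c : R) : open U -> Ck k U (fun=> c).
Proof.
elim: k c => [|k IH] c oU; first by apply/Ck0 => x _; exact: cst_continuous.
apply: (Ck_intro (d := fun _ _ => 0)) => // [x _|i x _|i]; last exact: IH.
- exact: cst_continuous.
- exact: has_pd_cst.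
Qed.

Lemma Ck_coord k U j : open U -> Ck k U (fun x => x 0 j).
Proof.
move=> oU; have cj : continuous (fun x : 'rV[R]_n => x 0 j) by exact: coord_continuous.
case: k => [|k]; first by apply/Ck0 => x _; exact: cj.
apply: (Ck_intro (d := fun i _ => (i == j)%:R)) => // [x _|i x _|i].
- exact: cj.
- exact: has_pd_coord.
- exact: Ck_cst.
Qed.

Lemma CkD k U f g : open U -> Ck k U f -> Ck k U g ->
  Ck k U (fun x => f x + g x).
Proof.
move=> oU; elim: k f g => [|k IH] f g.
  by rewrite !Ck0 => hf hg x Ux; exact (continuousD (hf _ Ux) (hg _ Ux)).
move=> hf hg.
refine (Ck_intro (d := fun i y => part i f y + part i g y) oU _ _ _) => [x Ux|i x Ux|i].
- exact (continuousD (Ck_cont hf Ux) (Ck_cont hg Ux)).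
- exact (has_pdD (Ck_has_pd i hf Ux) (Ck_has_pd i hg Ux)).
- exact (IH _ _ (Ck_pd i hf) (Ck_pd i hg)).
Qed.

Lemma CkM k U f g : open U -> Ck k U f -> Ck k U g ->
  Ck k U (fun x => f x * g x).
Proof.
move=> oU; elim: k f g => [|k IH] f g.
  by rewrite !Ck0 => hf hg x Ux; exact (continuousM (hf _ Ux) (hg _ Ux)).
move=> hf hg.
refine (Ck_intro (d := fun i y => part i f y * g y + f y * part i g y) oU _ _ _) => [x Ux|i x Ux|i].
- exact (continuousM (Ck_cont hf Ux) (Ck_cont hg Ux)).
- exact (has_pdM (Ck_has_pd i hf Ux) (Ck_has_pd i hg Ux)).
- have hf' := CkW (leqnSn k) hf; have hg' := CkW (leqnSn k) hg.
  exact (CkD oU (IH _ _ (Ck_pd i hf) hg') (IH _ _ hf' (Ck_pd i hg))).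
Qed.

Lemma CkZ k U (c : R) f : open U -> Ck k U f -> Ck k U (fun x => c * f x).
Proof. by move=> oU hf; exact (CkM oU (Ck_cst (k:=k) c oU) hf). Qed.

Lemma CkN k U f : open U -> Ck k U f -> Ck k U (fun x => - f x).
Proof.
by move=> oU hf; refine (Ck_eq oU _ (CkZ (-1) oU hf)) => x _; rewrite mulN1r.
Qed.

Lemma CkB k U f g : open U -> Ck k U f -> Ck k U g ->
  Ck k U (fun x => f x - g x).
Proof. by move=> oU hf hg; exact (CkD oU hf (CkN oU hg)). Qed.

Lemma Ck_sum k U (I : Type) (r : seq I) (P : pred I) (F : I -> 'rV[R]_n -> R) :
  open U -> (forall j, P j -> Ck k U (F j)) ->
  Ck k U (fun x => \sum_(j <- r | P j) F j x).
Proof.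
move=> oU H; elim: r => [|j r IH].
  by refine (Ck_eq oU _ (Ck_cst (k:=k) 0 oU)) => x _; rewrite big_nil.
have [Pj|Pj] := boolP (P j).
  by refine (Ck_eq oU _ (CkD oU (H _ Pj) IH)) => x _; rewrite big_cons Pj.
by refine (Ck_eq oU _ IH) => x _; rewrite big_cons (negbTE Pj).
Qed.

Lemma Ck_prod k U (I : Type) (r : seq I) (P : pred I) (F : I -> 'rV[R]_n -> R) :
  open U -> (forall j, P j -> Ck k U (F j)) ->
  Ck k U (fun x => \prod_(j <- r | P j) F j x).
Proof.
move=> oU H; elim: r => [|j r IH].
  by refine (Ck_eq oU _ (Ck_cst (k:=k) 1 oU)) => x _; rewrite big_nil.
have [Pj|Pj] := boolP (P j).
  by refine (Ck_eq oU _ (CkM oU (H _ Pj) IH)) => x _; rewrite big_cons Pj.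
by refine (Ck_eq oU _ IH) => x _; rewrite big_cons (negbTE Pj).
Qed.

Lemma Ck_exp k U f : open U -> Ck k U f -> Ck k U (fun x => expR (f x)).
Proof.
move=> oU hf.
have ec x : U x -> {for x, continuous (fun x => expR (f x))}.
  move=> Ux; apply: (@continuous_comp _ _ _ f expR); first exact: Ck_cont hf Ux.
  exact: continuous_expR.
elim: k hf => [|k IH] hf; first by apply/Ck0.
refine (Ck_intro (d := fun i y => expR (f y) * part i f y) oU ec _ _) => [i x Ux|i].
  exact: has_pd_exp (Ck_has_pd _ hf Ux).
exact (CkM oU (IH (CkW (leqnSn k) hf)) (Ck_pd i hf)).
Qed.

Lemma Ck_inv k U f : open U -> (forall x, U x -> f x != 0) ->
  Ck k U f -> Ck k U (fun x => (f x)^-1).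
Proof.
move=> oU f0 hf.
have ec x : U x -> {for x, continuous (fun x => (f x)^-1)}.
  by move=> Ux; apply: continuousV; [exact (f0 _ Ux)|exact (Ck_cont hf Ux)].
elim: k hf => [|k IH] hf; first by apply/Ck0.
refine (Ck_intro (d := fun i y => - ((f y)^-1 * (f y)^-1) * part i f y) oU ec _ _) => [i x Ux|i].
  exact: has_pd_inv (f0 _ Ux) (Ck_has_pd _ hf Ux).
have hi := IH (CkW (leqnSn k) hf).
exact (CkM oU (CkN oU (CkM oU hi hi)) (Ck_pd i hf)).
Qed.

Lemma Ck_ln k U f : open U -> (forall x, U x -> 0 < f x) ->
  Ck k U f -> Ck k U (fun x => ln (f x)).
Proof.
move=> oU f0 hf.
have ec x : U x -> {for x, continuous (fun x => ln (f x))}.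
  move=> Ux; apply: (@continuous_comp _ _ _ f (@ln R)); first exact: Ck_cont hf Ux.
  by apply: continuous_ln; exact: f0.
case: k hf => [|k] hf; first by apply/Ck0.
refine (Ck_intro (d := fun i y => (f y)^-1 * part i f y) oU ec _ _) => [i x Ux|i].
  exact: has_pd_ln (f0 _ Ux) (Ck_has_pd _ hf Ux).
have fn0 x : U x -> f x != 0 by move=> Ux; exact: lt0r_neq0 (f0 x Ux).
exact (CkM oU (Ck_inv oU fn0 (CkW (leqnSn k) hf)) (Ck_pd i hf)).
Qed.

(** * The mean value theorem and the symmetry of second derivatives *)

Lemma MVT_line f x (v : 'rV[R]_n) (t : R) : 0 < t ->
  (forall s, 0 <= s <= t -> derivable f (s *: v + x) v) ->
  exists2 s, 0 < s < t & f (t *: v + x) - f x = t * 'D_v f (s *: v + x).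
Proof.
move=> t0 H.
have [|||s] := @MVT R (fun s => f (s *: v + x)) (fun s => 'D_v f (s *: v + x)) 0 t.
- by [].
- move=> s; rewrite in_itv/= => /andP[s0 st].
  by apply: line_derive; apply: H; rewrite !ltW.
- apply: derivable_within_continuous => s; rewrite in_itv/= => st.
  by have [] := line_derive (H s st).
rewrite in_itv/= => st; rewrite scale0r add0r subr0 mulrC => E.
by exists s.
Qed.

Lemma MVT_pd f i x (t : R) : 0 < t ->
  (forall s, 0 <= s <= t -> derivable f (s *: 'e_i + x) 'e_i) ->
  exists2 s, 0 < s < t & f (t *: 'e_i + x) - f x = t * part i f (s *: 'e_i + x).
Proof. by rewrite part.unlock; exact: MVT_line. Qed.


Lemma ball_line x (e : R) (v : 'rV[R]_n) : `|v| < e -> ball x e (v + x).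
Proof. by move=> ve; rewrite -ball_normE /ball_/= opprD addrC subrK normrN. Qed.

Lemma norm_delta_le (i : 'I_n) : `|'e_i : 'rV[R]_n| <= 1.
Proof.
rewrite /Num.norm/= mx_normrE; apply: bigmax_le => // -[a b] _ /=.
by rewrite mxE; case: (_ && _); rewrite ?normr1 ?normr0.
Qed.

(** Two applications of the mean value theorem: to [f (t *: 'e_j + y) - f y] in direction [i], then
    to [part i f] in direction [j]. *)
Lemma double_difference U f x (e t : R) i j : Ck 2 U f -> 0 < t ->
  t + t < e -> ball x e `<=` U ->
  exists y, ball x e y /\
    f (t *: 'e_j + (t *: 'e_i + x)) - f (t *: 'e_i + x) - f (t *: 'e_j + x) + f x =
    t * (t * part j (part i f) y).
Proof.
move=> hf t0 te eU.
have inb (r s : R) : 0 <= r <= t -> 0 <= s <= t ->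
    ball x e (r *: 'e_i + (s *: 'e_j + x)).
  move=> /andP[r0 rt] /andP[s0 st]; rewrite addrA; apply: ball_line.
  apply: le_lt_trans (ler_normD _ _) _; rewrite !normrZ !ger0_norm//.
  apply: le_lt_trans (lerD (ler_wpM2l r0 (norm_delta_le i)) (ler_wpM2l s0 (norm_delta_le j))) _.
  lra.
pose F (y : 'rV[R]_n) := f (t *: 'e_j + y) - f y.
have dF y : ball x e (t *: 'e_j + y) -> ball x e y  ->
    has_pd i F y (part i f (t *: 'e_j + y) - part i f y).
  move=> b1 b2; apply: has_pdB; last exact: Ck_has_pd hf (eU _ b2).
  have [h1 h2] := Ck_has_pd i hf (eU _ b1).
  have E : (fun h : R => h^-1 *: (f (h *: 'e_i + (t *: 'e_j + y)) - f (t *: 'e_j + y))) =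
      fun h : R => h^-1 *: (f (t *: 'e_j + (h *: 'e_i + y)) - f (t *: 'e_j + y)).
    by rewrite funeqE => h; rewrite addrCA.
  split; last by rewrite -h2 /derive/= E.
  by move: h1; rewrite /derivable/= E.
have [|s st] := @MVT_pd F i x t t0.
  move=> s st; apply: has_pd_derivable; apply: dF.
    by rewrite addrCA; apply: inb => //; lra.
  by have := inb s 0 st; rewrite scale0r add0r; apply; lra.
rewrite (pdE (dF _ _ _)); last first.
- by have := inb s 0; rewrite scale0r add0r; apply; lra.
- by rewrite addrCA; apply: inb; lra.
set y := s *: 'e_i + x => E.
have [|r rt E2] := @MVT_pd (part i f) j y t t0.
  move=> r rt; apply: has_pd_derivable; apply: Ck_has_pd (Ck_pd i hf) _; apply: eU.
  by rewrite addrCA; apply: inb; lra.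
exists (r *: 'e_j + y); split; first by rewrite addrCA; apply: inb; lra.
rewrite -E2 -E /F -!addrA; congr (_ + (_ + _)); rewrite opprB addrC//.
Qed.

Lemma dist_half (p q r d : R) : `|p - r| < d / 2 -> `|q - r| < d / 2 ->
  `|p - q| <= d.
Proof.
rewrite !ltr_norml ler_norml => /andP[B1 B2] /andP[B3 B4].
by apply/andP; split; lra.
Qed.

(** The second difference is symmetric in [i] and [j], so the two mixed derivatives take the same
    value at points [y] and [z] as close to [x] as desired; continuity brings both to [x]. *)
Lemma schwarz U f x i j : open U -> Ck 2 U f -> U x ->
  part i (part j f) x = part j (part i f) x.
Proof.
move=> oU hf Ux.
have [e0 /= e0p e0U] : exists2 e : R, 0 < e & ball x e `<=` U.
  by have := open_nbhs_nbhs (conj oU Ux) => /nbhs_ballP[e e0 eU]; exists e.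
have cij a b : {for x, continuous (part a (part b f))}.
  by apply: (@Ck_cont 0 U) Ux; do 2 apply: Ck_pd.
apply/eqP; rewrite -subr_eq0 -normr_le0; apply/ler_addgt0Pl => d d0.
rewrite addr0.
have d2 : 0 < d / 2 by lra.
have close a b : exists2 e : R, 0 < e & forall y, ball x e y ->
    `|part a (part b f) x - part a (part b f) y| < d / 2.
  have /cvgrPdist_lt/(_ _ d2)/nbhs_ballP[e ep eb] := cij a b.
  by exists e.
have [e1 e1p H1] := close i j; have [e2 e2p H2] := close j i.
pose e := Num.min e0 (Num.min e1 e2).
have ep : 0 < e by rewrite !lt_min e0p e1p e2p.
have le0 : e <= e0 by rewrite ge_min lexx.
have le1 : e <= e1 by rewrite !ge_min lexx orbT.
have le2 : e <= e2 by rewrite !ge_min lexx !orbT.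
have [t [t0 te]] : exists t, 0 < t /\ t + t < e by exists (e / 3); lra.
have eU : ball x e `<=` U by apply: subset_trans e0U; exact: le_ball.
have [y [by_ Ey]] := double_difference i j hf t0 te eU.
have [z [bz Ez]] := double_difference j i hf t0 te eU.
have tt : t != 0 by rewrite gt_eqF.
have yz : part j (part i f) y = part i (part j f) z.
  have E : t * (t * part j (part i f) y) = t * (t * part i (part j f) z).
    rewrite (_ : t *: 'e_j + (t *: 'e_i + x) = t *: 'e_i + (t *: 'e_j + x)) in Ey;
      last exact: addrCA.
    refine (etrans (esym Ey) (etrans _ Ez)); congr (_ + _); exact: addrAC.
  by move: E => /(mulfI tt)/(mulfI tt).
have B1 := H1 z (le_ball le1 bz); have B2 := H2 y (le_ball le2 by_).
by rewrite yz in B2; exact: dist_half B1 B2.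
Qed.

End PartialDerivatives.

(** * Iterated integrals and integration by parts *)

Section Integral.
Variable R : realType.
Notation mu := (@lebesgue_measure R).

(* Unlike continuity with compact support, this class is visibly stable under
   integration of the first variable, which is what the iterated integral needs. *)
Definition unif_supp (V : normedModType R) (M : R) (F : V -> R) : Prop :=
  (forall e : R, 0 < e -> exists2 d : R, 0 < d &
     forall x y, `|x - y| < d -> `|F x - F y| < e) /\
  (forall x, M < `|x| -> F x = 0).

Definition intR (g : R -> R) : R := Rintegral mu setT g.

Section Closure.
Variables (V : normedModType R) (M : R).
Implicit Types F G : V -> R.

Lemma unif_suppW (M' : R) F : M <= M' -> unif_supp M F -> unif_supp M' F.
Proof. by move=> MM' [H1 H2]; split => // x xM; apply: H2; exact: le_lt_trans xM. Qed.

Lemma unif_suppD F G : unif_supp M F -> unif_supp M G ->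
  unif_supp M (fun x => F x + G x).
Proof.
move=> [F1 F2] [G1 G2]; split; last by move=> x xM; rewrite F2// G2// addr0.
move=> e e0; have e2 : 0 < e / 2 by rewrite divr_gt0.
have [d d0 Fd] := F1 _ e2; have [d' d'0 Gd] := G1 _ e2.
exists (Num.min d d') => [|x y]; first by rewrite lt_min d0 d'0.
rewrite lt_min => /andP[/Fd xy1 /Gd xy2].
rewrite (_ : _ - _ = (F x - F y) + (G x - G y)); last first.
  by rewrite opprD addrACA.
by rewrite (le_lt_trans (ler_normD _ _))// [e]splitr ltrD.
Qed.

Lemma unif_suppZ (c : R) F : unif_supp M F -> unif_supp M (fun x => c * F x).
Proof.
move=> [F1 F2]; split; last by move=> x xM; rewrite F2// mulr0.
move=> e e0; have c0 : 0 < `|c| + 1 by rewrite ltr_wpDl.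
have [d d0 Fd] := F1 _ (divr_gt0 e0 c0); exists d => // x y /Fd.
rewrite ltr_pdivlMr// => H; rewrite -mulrBr normrM.
apply: le_lt_trans H; rewrite mulrC; apply: ler_wpM2l => //.
by rewrite lerDl.
Qed.

End Closure.

Lemma unif_supp_continuous (V : normedModType R) M (F : V -> R) :
  unif_supp M F -> continuous F.
Proof.
move=> [F1 _] x; apply/cvgrPdist_lt => e /F1[d d0 Fd].
apply/nbhs_ballP; exists d => //= y; rewrite -ball_normE /ball_/= => xy.
exact: Fd.
Qed.

Lemma intRE (M K : R) (g : R -> R) : M <= K -> unif_supp M g -> intR g = Rintegral mu `[- K, K] g.
Proof.
move=> MK [_ g2]; rewrite /intR [RHS]Rintegral_mkcond; congr (Rintegral _ _ _).
rewrite funeqE => t; rewrite patchE; case: ifPn => //.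
rewrite notin_setE/= in_itv/= => /negP; rewrite -ler_norml -ltNge => Kt.
by rewrite g2// (le_lt_trans MK).
Qed.

Section OneDim.
Variable M : R.
Hypothesis M0 : 0 < M.
Implicit Types g : R -> R.

Lemma unif_supp_integrable (a b : R) g : continuous g ->
  mu.-integrable `[a, b] (EFin \o g).
Proof.
move=> gc; apply: (@continuous_compact_integrable R g); first exact: segment_compact.
exact: continuous_subspaceT.
Qed.

Lemma intRD g1 g2 : unif_supp M g1 -> unif_supp M g2 ->
  intR (fun t => g1 t + g2 t) = intR g1 + intR g2.
Proof.
move=> h1 h2; rewrite !(intRE (lexx M))//; last exact: unif_suppD.
by apply: RintegralD => //; apply: unif_supp_integrable;
  [exact: unif_supp_continuous h1|exact: unif_supp_continuous h2].
Qed.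

Lemma intRZ c g : unif_supp M g -> intR (fun t => c * g t) = c * intR g.
Proof.
move=> h1; rewrite !(intRE (lexx M))//; last exact: unif_suppZ.
apply: RintegralZl => //; apply: unif_supp_integrable; exact: unif_supp_continuous h1.
Qed.

Lemma intR_le (B : R) g : unif_supp M g -> (forall t, `|g t| <= B) ->
  `|intR g| <= (M + M) * B.
Proof.
move=> h1 gB; rewrite (intRE (lexx M) h1).
have ig : mu.-integrable `[- M, M] (EFin \o g).
  exact/unif_supp_integrable/unif_supp_continuous/h1.
apply: le_trans (le_normr_Rintegral _ ig) _ => //.
have -> : (M + M) * B = \int[mu]_(x in `[- M, M]) B.
  rewrite Rintegral_cst// [X in fine X](@lebesgue_measure_itv R `[- M, M]) /= lte_fin.
  by rewrite gtrN// -EFinD/= opprK mulrC.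
apply: le_Rintegral => //; last by apply: unif_supp_integrable => x; exact: cst_continuous.
exact: integrable_norm ig.
Qed.

Lemma intR_shift (s : R) g : unif_supp M g -> intR (fun t => g (t + s)) = intR g.
Proof.
move=> h1; have gc := unif_supp_continuous h1.
(* Substitution works on compact intervals: [[- K, K]] contains the support of [g (t + s)], and
   [[- K + s, K + s]] that of [g]. *)
pose K := M + `|s|.
have hs : unif_supp K (fun t => g (t + s)).
  split=> [e /h1.1[d d0 H]|x].
    by exists d => // x y xy; apply: H; rewrite opprD addrACA subrr addr0.
  rewrite /K => Kx; apply: h1.2.
  have := ler_normB (x + s) s; rewrite addrK => H.
  by rewrite -(ltrD2r `|s|); exact: lt_le_trans H.
rewrite (intRE (lexx K) hs).
have KM : M <= K by rewrite lerDl.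
rewrite /intR (_ : Rintegral mu setT g = Rintegral mu `[- K + s, K + s] g); last first.
  rewrite [RHS]Rintegral_mkcond; congr (Rintegral _ _ _).
  rewrite funeqE => t; rewrite patchE; case: ifPn => //.
  rewrite notin_setE/= in_itv/= => /negP H.
  rewrite h1.2// ltNge; apply/negP; rewrite ler_norml => /andP[t1 t2].
  have := ler_norm s; have := ler_norm (- s); rewrite normrN => s1 s2.
  by move/negP: H; apply; rewrite /K; apply/andP; split; lra.
rewrite /Rintegral; congr fine.
have Kge0 : 0 <= K by rewrite addr_ge0// ltW.
have K0 : - K <= K by rewrite (le_trans _ Kge0)// oppr_le0.
have D1 : derive1 (fun t : R => t + s) = fun=> 1.
  rewrite funeqE => t; rewrite derive1E.
  by have := @is_deriveD R R R id (cst s) t 1 1 0 (is_derive_id _ _)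
      (is_derive_cst _ _ _); case=> _; rewrite addr0.
have sc : continuous (fun t : R => t + s).
  by move=> t; apply: continuousD; [exact: cvg_id|exact: cst_continuous].
rewrite (@integration_by_substitution_increasing R (fun t : R => t + s) g (- K) K K0); first last.
- exact: continuous_subspaceT.
- split.
  + move=> x _; have := @is_deriveD R R R id (cst s) x 1 1 0
        (is_derive_id _ _) (is_derive_cst _ _ _); by case.
  + exact: (cvg_at_right_filter (sc (- K))).
  + exact: (cvg_at_left_filter (sc K)).
- by rewrite D1; apply: is_cvg_cst.
- by rewrite D1; apply: is_cvg_cst.
- by rewrite D1 => x _; exact: cst_continuous.
- by move=> x y _ _ xy; rewrite ltrD2r.
by apply: eq_integral => x _; rewrite D1 /= mulr1.
Qed.

End OneDim.

(** * Slices and the induction on the dimension *)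

Section Slices.
Variable n : nat.

(** Spelled as in [integral_rV], so that the fixpoint unfolds to integrals over slices by
    computation. *)
Definition slice (t : R) (v : 'rV[R]_n) : 'rV[R]_n.+1 :=
  row_mx (const_mx t : 'rV[R]_1) v.

Lemma entry_le_norm m (x : 'rV[R]_m) i : `|x 0 i| <= `|x|.
Proof.
rewrite [leRHS]/Num.norm/= mx_normrE.
exact: (le_bigmax _ (fun ij : 'I_1 * 'I_m => `|x ij.1 ij.2|) (0, i)).
Qed.

Lemma norm_le_entry m (x : 'rV[R]_m) c : 0 <= c -> (forall i, `|x 0 i| <= c) ->
  `|x| <= c.
Proof.
move=> c0 H; rewrite /Num.norm/= mx_normrE; apply: bigmax_le => // -[a b] _ /=.
by rewrite ord1.
Qed.

Lemma sliceE0 t v : slice t v 0 ord0 = t.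
Proof.
rewrite (_ : ord0 = lshift n (0 : 'I_1)); last exact/val_inj.
by rewrite [LHS]row_mxEl mxE.
Qed.

Lemma sliceES t v i : slice t v 0 (lift ord0 i) = v 0 i.
Proof.
rewrite (_ : lift ord0 i = rshift 1 i); last exact/val_inj.
exact: row_mxEr.
Qed.

Lemma slice_norm t v : `|t| <= `|slice t v| /\ `|v| <= `|slice t v|.
Proof.
split; first by rewrite -{1}(sliceE0 t v); exact: entry_le_norm.
by apply: norm_le_entry => // i; rewrite -(sliceES t v); exact: entry_le_norm.
Qed.

Lemma slice_normB t s v w :
  `|slice t v - slice s w| <= Num.max `|t - s| `|v - w|.
Proof.
apply: norm_le_entry => [|i]; first by rewrite le_max normr_ge0.
case: (unliftP ord0 i) => [j|] ->; rewrite [X in `|X|]mxE [X in _ + X]mxE.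
  rewrite !sliceES le_max.
  by have := entry_le_norm (v - w) j; rewrite !mxE => ->; rewrite orbT.
by rewrite !sliceE0 le_max lexx.
Qed.

Lemma unif_supp_slice M F t : unif_supp M F ->
  unif_supp M (fun v => F (slice t v)).
Proof.
move=> [F1 F2]; split=> [e /F1[d d0 H]|v Mv]; last first.
  by apply: F2; apply: lt_le_trans Mv _; case: (slice_norm t v).
exists d => // v w vw; apply: H; apply: le_lt_trans (slice_normB _ _ _ _) _.
by rewrite subrr normr0 gt_max d0 vw.
Qed.

End Slices.

(** The three facts go through the induction on the dimension together: continuity of the inner
    integral in the outer variable needs linearity and the bound one dimension lower. [(M + M) ^+ n]
    is the volume of the cube of half-width [M], the ball of the maximum norm. *)
Definition integral_rV_linear_bounded n M : Prop :=
  [/\ forall F G : 'rV[R]_n -> R, unif_supp M F -> unif_supp M G ->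
      integral_rV (fun x => F x + G x) = integral_rV F + integral_rV G,
     forall (c : R) (F : 'rV[R]_n -> R), unif_supp M F ->
       integral_rV (fun x => c * F x) = c * integral_rV F &
     forall (B : R) (F : 'rV[R]_n -> R), unif_supp M F -> (forall x, `|F x| <= B) ->
       `|integral_rV F| <= (M + M) ^+ n * B].

(** Uniform continuity makes slices at close heights uniformly close; linearity and the bound carry
    this over to their integrals. *)
Lemma unif_supp_integral_slice n M (F : 'rV[R]_n.+1 -> R) : 0 < M ->
  integral_rV_linear_bounded n M -> unif_supp M F ->
  unif_supp M (fun t => integral_rV (fun v => F (slice t v))).
Proof.
move=> M0 [IHD IHZ IHB] hF.
have MM0 : 0 < (M + M) ^+ n by rewrite exprn_gt0// addr_gt0.
split=> [e e0|t Mt].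
  have [d d0 H] := hF.1 _ (divr_gt0 (divr_gt0 e0 (ltr0n R 2)) MM0).
  exists d => // t s ts.
  have h1 := unif_supp_slice t hF; have h2 := unif_suppZ (-1) (unif_supp_slice s hF).
  have -> : integral_rV (fun v => F (slice t v)) - integral_rV (fun v => F (slice s v)) =
      integral_rV (fun v => F (slice t v) + (-1) * F (slice s v)).
    by rewrite (IHD _ _ h1 h2) (IHZ _ _ (unif_supp_slice s hF)) mulN1r.
  apply: (@le_lt_trans _ _ ((M + M) ^+ n * (e / 2 / (M + M) ^+ n))); last first.
    by rewrite mulrC divfK ?gt_eqF//; lra.
  apply: (IHB _ _ (unif_suppD h1 h2)) => v.
  rewrite mulN1r ltW//; apply: H; apply: le_lt_trans (slice_normB _ _ _ _) _.
  by rewrite subrr normr0 gt_max d0 ts.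
(* Zero is written [0 * 0] so that homogeneity applies to its integral. *)
have -> : (fun v => F (slice t v)) = fun=> 0 * 0.
  rewrite funeqE => v; rewrite mul0r; apply: hF.2.
  by apply: lt_le_trans Mt _; case: (slice_norm t v).
rewrite IHZ ?mul0r//.
by split => // e e0; exists 1 => // x y _; rewrite subrr normr0.
Qed.

Lemma integral_rV_facts n M : 0 < M -> integral_rV_linear_bounded n M.
Proof.
move=> M0; elim: n => [|n IH].
  by split => // B F _ FB; rewrite expr0 mul1r; exact: FB.
have key F hF := @unif_supp_integral_slice n M F M0 IH hF.
have [IHD IHZ IHB] := IH.
split=> [F G hF hG|c F hF|B F hF FB].
- rewrite -[RHS](intRD (key F hF) (key G hG)).
  rewrite /intR /=; congr (Rintegral _ _ _); rewrite funeqE => t.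
  exact: (IHD _ _ (unif_supp_slice t hF) (unif_supp_slice t hG)).
- rewrite -[RHS](intRZ c (key F hF)).
  rewrite /intR /=; congr (Rintegral _ _ _); rewrite funeqE => t.
  exact: (IHZ _ _ (unif_supp_slice t hF)).
- rewrite exprS -mulrA; apply: (intR_le M0 (key F hF)) => t.
  by apply: IHB => //; exact: unif_supp_slice.
Qed.

Lemma slice_shift0 n t s (v : 'rV[R]_n) :
  slice t v + s *: 'e_ord0 = slice (t + s) v.
Proof.
apply/rowP => i; case: (unliftP ord0 i) => [j|] ->; rewrite mxE.
  by rewrite !sliceES !mxE eqxx/= mulr0 addr0.
by rewrite !sliceE0 !mxE !eqxx mulr1.
Qed.

Lemma slice_shiftS n t s (v : 'rV[R]_n) k :
  slice t v + s *: 'e_(lift ord0 k) = slice t (v + s *: 'e_k).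
Proof.
apply/rowP => i; case: (unliftP ord0 i) => [j|] ->; rewrite mxE.
  by rewrite !sliceES !mxE !eqxx/= (inj_eq lift_inj).
by rewrite !sliceE0 !mxE/= mulr0 addr0.
Qed.

(** A shift in the first coordinate acts on the outer integral; any other shift acts on the inner
    one, where the induction hypothesis applies. *)
Lemma integral_rV_shift n M (F : 'rV[R]_n -> R) i s : 0 < M -> unif_supp M F ->
  integral_rV (fun x => F (x + s *: 'e_i)) = integral_rV F.
Proof.
move=> M0; elim: n F i => [|n IH] F i hF; first by case: i.
case: (unliftP ord0 i) => [j|] ->.
  congr (Rintegral _ _ _); rewrite funeqE => t.
  rewrite -[RHS](IH _ j (unif_supp_slice t hF)).
  congr integral_rV; rewrite funeqE => v; congr F; exact: slice_shiftS.
have hI := unif_supp_integral_slice M0 (integral_rV_facts n M0) hF.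
rewrite -[RHS](intR_shift M0 s hI).
rewrite /intR; congr (Rintegral _ _ _); rewrite funeqE => t.
congr integral_rV; rewrite funeqE => v; congr F; exact: slice_shift0.
Qed.

(** Heine-Cantor on the closed ball of radius [M], in the stronger form where only one of the two
    points has to lie in the ball. If both lie outside, both values vanish. *)
Lemma compact_unif_supp n M (F : 'rV[R]_n -> R) : continuous F ->
  (forall x, M < `|x| -> F x = 0) -> unif_supp M F.
Proof.
move=> Fc F0; split => // e e0.
pose K := [set x : 'rV[R]_n | `|x| <= M].
have Kc : compact K.
  apply: bounded_closed_compact.
    exists M; split; first exact: num_real.
    by move=> x Mx y Ky; apply: le_trans Ky _; exact: ltW.
  apply: (@preimage_closed _ _ (fun x : 'rV[R]_n => `|x|) [set r | r <= M]);
    last exact: closed_le.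
  by move=> x _; exact: norm_continuous.
have e2 : 0 < e / 2 by rewrite divr_gt0.
have /compact_near_coveringP/(_ R (0 : R)^'+
  (fun d x => forall y, `|x - y| < d -> `|F x - F y| < e)) H := Kc.
have [d [d0 Hd]] : exists d : R, 0 < d /\
    K `<=` (fun x => forall y, `|x - y| < d -> `|F x - F y| < e).
  have : \forall d \near (0 : R)^'+, K `<=` (fun x => forall y, `|x - y| < d -> `|F x - F y| < e).
    apply: H => x Kx.
    have /cvgrPdist_lt/(_ _ e2)/nbhs_ballP[d /= d0 Hd] := Fc x.
    have d2 : 0 < d / 2 by rewrite divr_gt0.
    exists (ball x (d / 2), [set r | r < d / 2]) => /=.
      split; first exact: nbhsx_ballx.
      exact: nbhs_right_lt.
    move=> [x' r] [/= xx' rd] y x'y.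
    rewrite -ball_normE /ball_/= in xx'.
    have h1 : `|F x - F x'| < e / 2.
      apply: Hd; rewrite -ball_normE /ball_/=; apply: lt_trans xx' _; lra.
    have h2 : `|F x - F y| < e / 2.
      apply: Hd; rewrite -ball_normE /ball_/= -(subrK x' x) -addrA.
      by apply: le_lt_trans (ler_normD _ _) _; lra.
    rewrite (_ : F x' - F y = (F x - F y) - (F x - F x'));
      last by rewrite opprB [RHS]addrC addrA subrK.
    by apply: le_lt_trans (ler_normB _ _) _; lra.
  move=> [r /= r0 Hr]; exists (r / 2); split; first by rewrite divr_gt0.
  apply: Hr; last by rewrite divr_gt0.
  by rewrite /= sub0r normrN gtr0_norm ?divr_gt0//; lra.
exists d => // x y xy.
have [Kx|Kx] := pselect (K x); first exact: Hd.
have [Ky|Ky] := pselect (K y); first by rewrite distrC; apply: Hd => //; rewrite distrC.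
move: Kx Ky; rewrite /K /= => /negP; rewrite -ltNge => Kx /negP; rewrite -ltNge => Ky.
by rewrite !F0// subrr normr0.
Qed.

Lemma norm_scale_delta n (i : 'I_n) (s : R) : 0 <= s ->
  `|s *: ('e_i : 'rV[R]_n)| <= s.
Proof.
move=> s0; have := ler_wpM2l s0 (norm_delta_le R i).
by rewrite mulr1; apply: le_trans; rewrite normrZ ger0_norm.
Qed.

(** The fundamental theorem of calculus would require integrating the [i]-th variable first;
    translation invariance treats all directions alike. *)
Lemma integral_rV_pd n M (F : 'rV[R]_n -> R) i : 0 < M -> Ck 1 setT F ->
  (forall x, M < `|x| -> F x = 0) -> integral_rV (part i F) = 0.
Proof.
move=> M0 hF F0.
have Fc : continuous F by move=> x; exact: Ck_cont hF I.
have dFc : continuous (part i F) by move=> x; exact: Ck_cont (Ck_pd i hF) I.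
have dF0 x : M < `|x| -> part i F x = 0.
  move=> Mx; rewrite -(pdE (has_pd_cst i 0 x)).
  apply: (@pd_eq _ _ [set y | M < `|y|]) => //.
  by apply: (@open_comp _ _ (fun x : 'rV[R]_n => `|x|) [set r | M < r]);
    [move=> y _; exact: norm_continuous|exact: open_gt].
(* Steps [s < 1] keep the translates of [F] supported in radius [K]. *)
pose K := M + 1; have K0 : 0 < K by rewrite addr_gt0.
have MK : M <= K by rewrite lerDl.
have hF' := compact_unif_supp Fc F0; have hd := compact_unif_supp dFc dF0.
have [ID IZ IB] := integral_rV_facts n K0.
have C0 : 0 < (K + K) ^+ n by rewrite exprn_gt0// addr_gt0.
apply/eqP; rewrite -normr_le0; apply/ler_addgt0Pl => e e0; rewrite addr0.
have [d d0 H] := hd.1 _ (divr_gt0 e0 C0).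
have [s [s0 sd s1]] : exists s : R, [/\ 0 < s, s < d & s < 1].
  exists (Num.min d 1 / 2); have m0 : 0 < Num.min d 1 by rewrite lt_min d0 ltr01.
  have := ge_min d d 1; have := ge_min 1 d 1; rewrite !lexx/= orbT => m1 m2.
  by split; [rewrite divr_gt0|apply: lt_le_trans m2; lra|apply: lt_le_trans m1; lra].
have shF : unif_supp K (fun x => F (x + s *: 'e_i)).
  split=> [r /hF'.1[d' d'0 H']|x Kx].
    by exists d' => // x y xy; apply: H'; rewrite opprD addrACA subrr addr0.
  apply: F0; have := ler_normB (x + s *: 'e_i) (s *: 'e_i); rewrite addrK => h.
  have : `|s *: ('e_i : 'rV[R]_n)| <= 1.
    by apply: le_trans (norm_scale_delta i (ltW s0)) _; exact: ltW.
  by move: h Kx; rewrite /K; lra.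
have hFK := unif_suppW MK hF'; have hdK := unif_suppW MK hd.
(* By translation invariance the difference quotients have integral 0, and they
   converge uniformly to the derivative. *)
pose D x := s^-1 * (F (x + s *: 'e_i) + (-1) * F x).
have hD : unif_supp K D by apply: unif_suppZ; apply: unif_suppD => //; exact: unif_suppZ.
have ID0 : integral_rV D = 0.
  rewrite /D IZ; last by apply: unif_suppD => //; exact: unif_suppZ.
  by rewrite ID ?IZ//;
    [rewrite (integral_rV_shift i s M0 hF') mulN1r subrr mulr0|exact: unif_suppZ].
have -> : integral_rV (part i F) = integral_rV (fun x => part i F x + (-1) * D x).
  by rewrite (ID _ _ hdK (unif_suppZ (-1) hD)) (IZ _ _ hD) ID0 mulr0 addr0.
rewrite -[e](divfK (lt0r_neq0 C0)) mulrC; apply: IB => [|x].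
  by apply: unif_suppD => //; exact: unif_suppZ.
have [r _|r /andP[r0 rs] E] := @MVT_pd R n F i x s s0.
  exact: has_pd_derivable (Ck_has_pd _ hF I).
have -> : D x = part i F (r *: 'e_i + x).
  by rewrite /D mulN1r addrC [x + _]addrC [- _ + _]addrC E mulKf// gt_eqF.
rewrite mulN1r ltW//; apply: H; rewrite opprD addrCA addrC.
rewrite subrr sub0r normrN.
by apply: le_lt_trans (norm_scale_delta i (ltW r0)) _; exact: lt_trans sd.
Qed.

(** * Integration by parts for functions with compact support in an open set *)

Section CompactSupport.
Variable n : nat.
Implicit Types (U : set 'rV[R]_n) (F G phi : 'rV[R]_n -> R).

Definition csupp U F : Prop := exists K : set 'rV[R]_n,
  [/\ compact K, K `<=` U & forall x, ~ K x -> F x = 0].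

Lemma csuppP U F : csupp U F -> exists K : set 'rV[R]_n,
  [/\ closed K, K `<=` U, forall x, ~ K x -> F x = 0 &
     exists2 M : R, 0 < M & forall x, M < `|x| -> F x = 0].
Proof.
move=> [K [Kc KU F0]]; exists K; split => //.
  exact: compact_closed Kc.
have [M [_ HM]] := compact_bounded Kc.
exists (`|M| + 1) => [|x Mx]; first by rewrite ltr_wpDl.
apply: F0 => /(HM (`|M| + 1)) H; move: Mx; rewrite ltNge => /negP; apply.
by apply: H; rewrite (le_lt_trans (ler_norm M))// ltrDl.
Qed.

Lemma csupp0 U F x : csupp U F -> ~ U x -> F x = 0.
Proof. by move=> [K [_ KU F0]] Ux; apply: F0 => /KU. Qed.

Lemma csuppM U F G : csupp U G -> csupp U (fun x => F x * G x).
Proof.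
by move=> [K [? ? G0]]; exists K; split => // x /G0 ->; rewrite mulr0.
Qed.

Lemma csuppD U F G : csupp U F -> csupp U G -> csupp U (fun x => F x + G x).
Proof.
move=> [K [Kc KU F0]] [L [Lc LU G0]]; exists (K `|` L); split.
- exact: compactU.
- by move=> x [/KU|/LU].
- by move=> x /not_orP[/F0-> /G0->]; rewrite addr0.
Qed.

Lemma csupp_sum U (I : Type) (r : seq I) (F : I -> 'rV[R]_n -> R) :
  (forall j, csupp U (F j)) -> csupp U (fun x => \sum_(j <- r) F j x).
Proof.
move=> H; elim: r => [|j r [K [Kc KU F0]]].
  exists set0; split => [||x _]; [exact: compact0|exact: sub0set|by rewrite big_nil].
have [L [Lc LU G0]] := csuppD (H j) (ex_intro _ K (And3 Kc KU F0)).
by exists L; split => // x /G0; rewrite big_cons.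
Qed.

Lemma csupp_pd U F i : csupp U F -> csupp U (part i F).
Proof.
move=> [K [Kc KU F0]]; exists K; split => // x Kx.
rewrite -(pdE (has_pd_cst i 0 x)).
apply: (@pd_eq _ _ (~` K)) => //; rewrite openC; exact: compact_closed Kc.
Qed.

(** Extension by zero: [U] and the complement of the compact set are open and cover the space, and
    [F] is regular on each. Regularity on [U] thus suffices for integrals over the whole space. *)
Lemma csupp_Ck k U F : open U -> Ck k U F -> csupp U F -> Ck k setT F.
Proof.
move=> oU hF /csuppP[K [Kc KU F0 _]]; apply: Ck_local => x _.
have [Ux|Ux] := pselect (U x); first by exists U.
exists (~` K); split; [by rewrite openC|by move=> /KU|].
have oK : open (~` K) by rewrite openC.
by refine (Ck_eq oK _ (Ck_cst (k:=k) 0 oK)) => y /F0 ->.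
Qed.

Lemma csupp_unif U F : open U -> Ck 0 U F -> csupp U F ->
  exists2 M : R, 0 < M & unif_supp M F.
Proof.
move=> oU hF sF; have [K [_ _ _ [M M0 F0]]] := csuppP sF.
exists M => //; apply: compact_unif_supp => // x.
exact: Ck_cont (csupp_Ck oU hF sF) I.
Qed.

Variable U : set 'rV[R]_n.
Hypothesis oU : open U.

Lemma int_eq F G : (forall x, U x -> F x = G x) -> csupp U F -> csupp U G ->
  integral_rV F = integral_rV G.
Proof.
move=> FG sF sG; congr integral_rV; rewrite funeqE => x.
have [/FG//|Ux] := pselect (U x).
by rewrite (csupp0 sF Ux) (csupp0 sG Ux).
Qed.

Lemma intD F G : Ck 0 U F -> csupp U F -> Ck 0 U G -> csupp U G ->
  integral_rV (fun x => F x + G x) = integral_rV F + integral_rV G.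
Proof.
move=> hF sF hG sG; have [M M0 uF] := csupp_unif oU hF sF.
have [L L0 uG] := csupp_unif oU hG sG.
have ML0 : 0 < Num.max M L by rewrite lt_max M0.
have [H _ _] := integral_rV_facts n ML0; apply: H.
  by apply: unif_suppW uF; rewrite le_max lexx.
by apply: unif_suppW uG; rewrite le_max lexx orbT.
Qed.

Lemma intZ c F : Ck 0 U F -> csupp U F ->
  integral_rV (fun x => c * F x) = c * integral_rV F.
Proof.
move=> hF sF; have [M M0 uF] := csupp_unif oU hF sF.
by have [_ H _] := integral_rV_facts n M0; apply: H.
Qed.

Lemma intN F : Ck 0 U F -> csupp U F ->
  integral_rV (fun x => - F x) = - integral_rV F.
Proof.
move=> hF sF; rewrite -mulN1r -intZ//; congr integral_rV.
by rewrite funeqE => x; rewrite mulN1r.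
Qed.

Lemma intB F G : Ck 0 U F -> csupp U F -> Ck 0 U G -> csupp U G ->
  integral_rV (fun x => F x - G x) = integral_rV F - integral_rV G.
Proof.
move=> hF sF hG sG; rewrite -(intN hG sG) -intD//.
- exact: CkN.
- by have [K [? ? G0]] := sG; exists K; split => // x /G0 ->; rewrite oppr0.
Qed.

Lemma int_sum (I : Type) (r : seq I) (F : I -> 'rV[R]_n -> R) :
  (forall j, Ck 0 U (F j)) -> (forall j, csupp U (F j)) ->
  integral_rV (fun x => \sum_(j <- r) F j x) = \sum_(j <- r) integral_rV (F j).
Proof.
move=> hF sF; elim: r => [|j r IH].
  rewrite big_nil -[RHS](mul0r (integral_rV (fun _ : 'rV[R]_n => 0))) -intZ; last 2 first.
  - exact: Ck_cst.
  - by exists set0; split => //; exact: compact0.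
  by congr integral_rV; rewrite funeqE => x; rewrite big_nil mul0r.
rewrite big_cons -IH -intD//; last 2 first.
- by apply: Ck_sum => // k _; exact: hF.
- exact: csupp_sum.
by congr integral_rV; rewrite funeqE => x; rewrite big_cons.
Qed.

Lemma int_pd F i : Ck 1 U F -> csupp U F -> integral_rV (part i F) = 0.
Proof.
move=> hF sF; have [K [_ _ _ [M M0 F0]]] := csuppP sF.
exact: integral_rV_pd M0 (csupp_Ck oU hF sF) F0.
Qed.

(** [m] is controlled on [U] only, but just its product with [chi], which is supported in [U], gets
    integrated. *)
Lemma int_by_parts m chi i : Ck 1 U m -> Ck 1 U chi -> csupp U chi ->
  integral_rV (fun x => part i m x * chi x) = - integral_rV (fun x => m x * part i chi x).
Proof.
move=> hm hc sc; apply/eqP; rewrite -addr_eq0 -intD; last 4 first.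
- exact: (CkM oU (Ck_pd i hm) (CkW (leqnSn 0) hc)).
- exact: csuppM.
- exact: (CkM oU (CkW (leqnSn 0) hm) (Ck_pd i hc)).
- exact/csuppM/csupp_pd.
apply/eqP; rewrite -[RHS](@int_pd (fun x => m x * chi x) i); last 2 first.
- exact: CkM.
- exact: csuppM.
apply: int_eq => [x Ux||].
- by rewrite (pdE (has_pdM (Ck_has_pd i hm Ux) (Ck_has_pd i hc Ux))).
- by apply: csuppD; [exact: csuppM|exact/csuppM/csupp_pd].
- exact/csupp_pd/csuppM.
Qed.

(** Integrating by parts on both sides moves the symmetry of second derivatives onto [psi]. For [m]
    of class [C^1] this is the weak form of [d_b d_a m = d_a d_b m]. *)
Lemma int_pd_exchange m psi a b : Ck 1 U m -> Ck 2 U psi -> csupp U psi ->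
  integral_rV (fun x => part a m x * part b psi x) =
  integral_rV (fun x => part b m x * part a psi x).
Proof.
move=> hm hp sp.
rewrite (int_by_parts a hm (Ck_pd b hp) (csupp_pd b sp)).
rewrite (int_by_parts b hm (Ck_pd a hp) (csupp_pd a sp)).
apply/eqP; rewrite eqr_opp; apply/eqP; apply: int_eq => [x Ux||].
- by rewrite (schwarz a b oU hp Ux).
- by apply/csuppM/csupp_pd/csupp_pd.
- by apply/csuppM/csupp_pd/csupp_pd.
Qed.

End CompactSupport.

End Integral.

(** * Matrix fields *)

(** Sealed for the same reason as [part]. *)
HB.lock Definition ginvl (R : realType) (n : nat) (h : 'rV[R]_n -> 'M[R]_n)
  (a b : 'I_n) : 'rV[R]_n -> R := ginv h a b.

Lemma ginvlE (R : realType) (n : nat) (h : 'rV[R]_n -> 'M[R]_n) a b x :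
  ginvl h a b x = invmx (h x) a b.
Proof. by rewrite ginvl.unlock. Qed.

Section MatrixCalculus.
Variables (R : realType) (n : nat).
Implicit Types (U : set 'rV[R]_n) (x : 'rV[R]_n).

Lemma Ck_det k U m (A : 'rV[R]_n -> 'M[R]_m) : open U ->
  (forall a b, Ck k U (fun x => A x a b)) -> Ck k U (fun x => \det (A x)).
Proof.
move=> oU hA; apply: Ck_sum => // s _; apply: CkZ => //.
by apply: Ck_prod => // i _; exact: hA.
Qed.

Lemma Ck_cofactor k U m (A : 'rV[R]_n -> 'M[R]_m) i j : open U ->
  (forall a b, Ck k U (fun x => A x a b)) -> Ck k U (fun x => cofactor (A x) i j).
Proof.
move=> oU hA; apply: CkZ => //.
apply: (Ck_det (A := fun x => row' i (col' j (A x)))) => // a b.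
by refine (Ck_eq oU _ (hA (lift i a) (lift j b))) => x _; rewrite /entry !mxE.
Qed.

(** Cramer's rule: the entries of the inverse are cofactors divided by the determinant. *)
Lemma Ck_invmx k U m (A : 'rV[R]_n -> 'M[R]_m) a b : open U ->
  (forall x, U x -> \det (A x) != 0) ->
  (forall a b, Ck k U (fun x => A x a b)) -> Ck k U (fun x => invmx (A x) a b).
Proof.
move=> oU d0 hh.
refine (Ck_eq oU _ (CkM oU (Ck_inv oU d0 (Ck_det oU hh)) (Ck_cofactor b a oU hh))).
by move=> x Ux; rewrite /invmx unitmxE unitfE d0// !mxE.
Qed.

Lemma Ck_ginv k U (h : 'rV[R]_n -> 'M[R]_n) a b : open U ->
  (forall x, U x -> \det (h x) != 0) ->
  (forall a b, Ck k U (entry h a b)) -> Ck k U (ginvl h a b).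
Proof.
move=> oU d0 hh; refine (Ck_eq oU _ (Ck_invmx a b oU d0 hh)) => x _.
by rewrite ginvlE.
Qed.

Lemma has_pd_prod (I : eqType) (r : seq I) i (F : I -> 'rV[R]_n -> R) x (d : I -> R) :
  uniq r -> (forall j, has_pd i (F j) x (d j)) ->
  has_pd i (fun y => \prod_(j <- r) F j y) x
    (\sum_(k <- r) d k * \prod_(j <- r | j != k) F j x).
Proof.
move=> ur H; elim: r ur => [_|k r IH /= /andP[kr ur]].
  rewrite big_nil (_ : (fun _ => _) = fun=> 1); first exact: has_pd_cst.
  by rewrite funeqE => y; rewrite big_nil.
rewrite (_ : (fun y => _) = fun y => F k y * \prod_(j <- r) F j y); last first.
  by rewrite funeqE => y; rewrite big_cons.
apply: (has_pd_eq (has_pdM (H k) (IH ur))).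
rewrite big_cons [in RHS]big_cons eqxx /=; congr (_ + _).
  congr (_ * _); rewrite [LHS]big_seq_cond [RHS]big_seq_cond.
  apply: eq_bigl => j; rewrite andbT andbC.
  by case: (boolP (j \in r)) => jr; rewrite ?andbF// andbT; apply/esym; apply: contraNneq kr => <-.
rewrite big_distrr /= big_seq [RHS]big_seq; apply: eq_bigr => l lr.
rewrite big_cons ifT 1?mulrCA//; by apply: contraNneq kr => ->.
Qed.

(** Jacobi's formula. The product rule in the Leibniz expansion differentiates one row at a time,
    and each contribution is a determinant expanded along that row. *)
Lemma has_pd_det c m (A : 'rV[R]_n -> 'M[R]_m) x (dA : 'M[R]_m) :
  (forall a b, has_pd c (fun y => A y a b) x (dA a b)) ->
  has_pd c (fun y => \det (A y)) x (\sum_i \sum_j dA i j * cofactor (A x) i j).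
Proof.
move=> H.
have := @has_pd_sum R n _ (index_enum 'S_m) xpredT c
  (fun s y => (-1) ^+ s * \prod_i A y i (s i)) x
  (fun s : 'S_m => (-1) ^+ s * \sum_i dA i (s i) * \prod_(j | j != i) A x j (s j)).
move=> /(_ _)/has_pd_eq; apply.
  move=> s _; apply: has_pdZ.
  exact: (has_pd_prod (F := fun i y => A y i (s i)) (index_enum_uniq _) (fun i => H i (s i))).
under eq_bigr do rewrite big_distrr.
rewrite exchange_big; apply: eq_bigr => i _ /=.
(* [A x] with row [i] replaced by its derivative. *)
pose B : 'M[R]_m := \matrix_(k, l) if k == i then dA i l else A x k l.
transitivity (\det B).
  apply: eq_bigr => s _; congr (_ * _).
  rewrite [RHS](bigD1 i)//= mxE eqxx; congr (_ * _).
  by apply: eq_bigr => j ji; rewrite mxE (negbTE ji).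
rewrite (expand_det_row _ i); apply: eq_bigr => j _.
rewrite mxE eqxx; congr (_ * _); rewrite /cofactor; congr (_ * \det _).
by apply/matrixP => k l; rewrite !mxE eq_sym (negbTE (neq_lift _ _)).
Qed.

End MatrixCalculus.

Section Metric.
Variables (R : realType) (n : nat) (U : set 'rV[R]_n) (g : 'rV[R]_n -> 'M[R]_n).
Local Notation G := (ginvl g).
Local Notation dg := (fun c a b => part c (entry g a b)).

Hypothesis oU : open U.
Hypothesis gdet : forall x, U x -> \det (g x) != 0.
Hypothesis gsym : forall x, U x -> (g x)^T = g x.

Lemma g_unit x : U x -> g x \in unitmx.
Proof. by move=> Ux; rewrite unitmxE unitfE gdet. Qed.

Lemma g_symE a b x : U x -> g x a b = g x b a.
Proof. by move=> Ux; rewrite -{1}(gsym Ux) mxE. Qed.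

Lemma ginv_symE a b x : U x -> G a b x = G b a x.
Proof. by move=> Ux; rewrite !ginvlE -{1}(gsym Ux) -trmx_inv mxE. Qed.

Lemma mul_g_ginv a b x : U x -> \sum_k g x a k * G k b x = (a == b)%:R.
Proof.
move=> Ux; have := mulmxV (g_unit Ux) => /matrixP/(_ a b); rewrite !mxE => <-.
by apply: eq_bigr => k _; rewrite ginvlE.
Qed.

Lemma mul_ginv_g a b x : U x -> \sum_k G a k x * g x k b = (a == b)%:R.
Proof.
move=> Ux; have := mulVmx (g_unit Ux) => /matrixP/(_ a b); rewrite !mxE => <-.
by apply: eq_bigr => k _; rewrite ginvlE.
Qed.

Lemma entry_symE a b x : U x -> entry g a b x = entry g b a x.
Proof. exact: g_symE. Qed.

Lemma dg_symE c a b x : U x -> part c (entry g a b) x = part c (entry g b a) x.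
Proof. by move=> Ux; apply: (pd_eq c oU Ux) => y Uy; exact: entry_symE. Qed.

Hypothesis gC1 : forall a b, Ck 1 U (entry g a b).

Lemma ginv_C1 a b : Ck 1 U (G a b).
Proof. exact: Ck_ginv. Qed.

(** Differentiate [G g = 1] and multiply by [G] from the right. *)
Lemma pd_ginv c a b x : U x ->
  part c (G a b) x = - \sum_p \sum_q G a p x * part c (entry g p q) x * G q b x.
Proof.
move=> Ux.
have E q : \sum_k (part c (G a k) x * g x k q + G a k x * part c (entry g k q) x) = 0.
  transitivity (part c (fun y => \sum_k G a k y * entry g k q y) x).
    apply/esym/pdE/has_pd_sum => k _.
    exact: (has_pdM (Ck_has_pd c (ginv_C1 a k) Ux) (Ck_has_pd c (gC1 k q) Ux)).
  rewrite (pd_eq (g := fun=> (a == q)%:R) c oU Ux); first exact/pdE/has_pd_cst.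
  by move=> y Uy; exact: mul_ginv_g.
apply/eqP; rewrite -addr_eq0 exchange_big /=.
have -> : part c (G a b) x = \sum_q (\sum_k part c (G a k) x * g x k q) * G q b x.
  under eq_bigr do rewrite big_distrl.
  rewrite exchange_big /= (bigD1 b)//= [X in _ = _ + X]big1 ?addr0.
    under eq_bigr do rewrite -mulrA.
    by rewrite -big_distrr/= mul_g_ginv// eqxx mulr1.
  move=> k kb; under eq_bigr do rewrite -mulrA.
  by rewrite -big_distrr/= mul_g_ginv// (negbTE kb) mulr0.
rewrite -big_split /= big1// => q _.
by rewrite -big_distrl/= -mulrDl -big_split/= E mul0r.
Qed.

End Metric.

(** * Conformal change of a unimodular metric *)

Section ConformalAlgebra.
Variables (R : comNzRingType) (n : nat).
Implicit Types (P Q : 'I_n -> 'I_n -> 'I_n -> R) (F : 'I_n -> R).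

Lemma sum_delta F a : \sum_c (c == a)%:R * F c = F a.
Proof.
rewrite (bigD1 a)//= eqxx mul1r big1 ?addr0// => c ca.
by rewrite (negbTE ca) mul0r.
Qed.

Lemma sum_deltaC F a : \sum_c (a == c)%:R * F c = F a.
Proof. by rewrite -[RHS]sum_delta; apply: eq_bigr => c _; rewrite eq_sym. Qed.

Variables (g G : 'I_n -> 'I_n -> R) (s : 'I_n -> R).

(** The algebra is pointwise: [P c a b] stands for a Christoffel symbol with upper index [c], [G]
    for the inverse metric, and [s] for the differential of the conformal exponent. *)
Definition raise F c := \sum_d G c d * F d.
Definition trace3 P d := \sum_c P c c d.
Definition contr3 P d := \sum_a \sum_b G a b * P d a b.
(** [G^{ab} P^c_{bd} Q^d_{ac}]: the polarization of the quadratic term of the scalar curvature that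
    contains no trace. *)
Definition quad3 P Q := \sum_a \sum_b G a b * \sum_c \sum_d P c b d * Q d a c.
(** The change of the Christoffel symbols when [g] is replaced by [e^(2s) g], with [s a] in the role
    of [d_a s]. *)
Definition conf3 c a b := (c == a)%:R * s b + (c == b)%:R * s a - g a b * raise s c.

Hypothesis gsym : forall a b, g a b = g b a.
Hypothesis Gsym : forall a b, G a b = G b a.
Hypothesis mulGg : forall a b, \sum_k G a k * g k b = (a == b)%:R.

Lemma lower_raise F a : \sum_c g a c * raise F c = F a.
Proof.
under eq_bigr do rewrite big_distrr.
rewrite exchange_big/= -[RHS]sum_delta; apply: eq_bigr => d _.
rewrite -mulGg big_distrl/=; apply: eq_bigr => c _.
by rewrite [G c d]Gsym [g a c]gsym mulrCA mulrA.
Qed.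

Lemma trace3D P Q d :
  trace3 (fun c a b => P c a b + Q c a b) d = trace3 P d + trace3 Q d.
Proof. exact: big_split. Qed.

Lemma contr3D P Q d :
  contr3 (fun c a b => P c a b + Q c a b) d = contr3 P d + contr3 Q d.
Proof.
rewrite /contr3 -big_split; apply: eq_bigr => a _ /=.
by rewrite -big_split; apply: eq_bigr => b _ /=; rewrite mulrDr.
Qed.

Lemma quad3Dl P P' Q :
  quad3 (fun c a b => P c a b + P' c a b) Q = quad3 P Q + quad3 P' Q.
Proof.
rewrite /quad3 -big_split; apply: eq_bigr => a _ /=.
rewrite -big_split; apply: eq_bigr => b _ /=; rewrite -mulrDr; congr (_ * _).
rewrite -big_split; apply: eq_bigr => c _ /=.
by rewrite -big_split; apply: eq_bigr => d _ /=; rewrite mulrDl.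
Qed.

Lemma quad3C P Q : quad3 P Q = quad3 Q P.
Proof.
rewrite /quad3 exchange_big; apply: eq_bigr => a _; apply: eq_bigr => b _.
rewrite Gsym; congr (_ * _); rewrite exchange_big; apply: eq_bigr => c _.
by apply: eq_bigr => d _; rewrite mulrC.
Qed.

Lemma trace3_conf d : trace3 conf3 d = n%:R * s d.
Proof.
rewrite /trace3 /conf3 sumrB big_split/=.
rewrite (eq_bigr (fun=> s d)); last by move=> c _; rewrite eqxx mul1r.
rewrite sumr_const card_ord sum_delta.
under [X in _ - X]eq_bigr do rewrite gsym.
by rewrite lower_raise addrK mulr_natl.
Qed.

Lemma contr_gG : \sum_a \sum_b G a b * g a b = n%:R.
Proof.
rewrite -[in RHS](card_ord n) -sumr_const; apply: eq_bigr => a _.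
by under eq_bigr do rewrite gsym; rewrite mulGg eqxx.
Qed.

Lemma contr3_conf d : contr3 conf3 d = (2 - n%:R) * raise s d.
Proof.
have E a b : G a b * conf3 d a b = (d == a)%:R * (G a b * s b) +
    (d == b)%:R * (G a b * s a) - G a b * g a b * raise s d.
  by rewrite /conf3; ring.
rewrite /contr3; under eq_bigr => a _ do under eq_bigr => b _ do rewrite E.
under eq_bigr => a _ do rewrite sumrB big_split/= sum_deltaC -big_distrr/= -big_distrl/=.
rewrite sumrB big_split/= sum_deltaC -big_distrl/= contr_gG mulrBl; congr (_ - _).
rewrite mulr2n mulrDl mul1r; congr (_ + _).
by apply: eq_bigr => a _; rewrite Gsym.
Qed.

(** Of the three terms of [conf3], the first gives the contraction; the other two both produce
    [trace3 P] paired with the raised [s], with opposite signs. *)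
Lemma quad3_conf P : (forall c a b, P c a b = P c b a) ->
  quad3 P conf3 = \sum_c contr3 P c * s c.
Proof.
move=> Psym.
have E a b : \sum_c \sum_d P c b d * conf3 d a c =
    \sum_c P c a b * s c + trace3 P b * s a - \sum_c g c a * \sum_d P c b d * raise s d.
  rewrite /trace3 big_distrl -big_split -sumrB; apply: eq_bigr => c _ /=.
  have E d : P c b d * conf3 d a c = (d == a)%:R * (P c b d * s c) +
      (d == c)%:R * (P c b d * s a) - g c a * (P c b d * raise s d).
    by rewrite /conf3 [g a c]gsym; ring.
  under eq_bigr do rewrite E.
  by rewrite sumrB big_split/= !sum_delta -big_distrr/= Psym [P c b c]Psym.
rewrite /quad3; under eq_bigr => a _ do under eq_bigr => b _ do rewrite E mulrBr mulrDr.
under eq_bigr => a _ do rewrite sumrB big_split/=.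
rewrite sumrB big_split/= -addrA [X in _ + X](_ : _ = 0) ?addr0.
  rewrite /contr3; under [RHS]eq_bigr do rewrite big_distrl.
  rewrite [RHS]exchange_big; apply: eq_bigr => a _ /=.
  under [RHS]eq_bigr do rewrite big_distrl.
  rewrite [RHS]exchange_big; apply: eq_bigr => b _ /=.
  by rewrite big_distrr; apply: eq_bigr => c _ /=; rewrite mulrA.
apply/eqP; rewrite subr_eq0; apply/eqP.
transitivity (\sum_d trace3 P d * raise s d).
  rewrite exchange_big; apply: eq_bigr => b _ /=; rewrite /raise big_distrr.
  by apply: eq_bigr => a _ /=; rewrite Gsym mulrCA.
rewrite [RHS]exchange_big/=.
under [RHS]eq_bigr do under eq_bigr do rewrite big_distrr.
under [RHS]eq_bigr => b _ do rewrite exchange_big/=.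
under [RHS]eq_bigr => b _ do under eq_bigr => c _ do
  under eq_bigr => a _ do rewrite Gsym [g c a]gsym mulrA.
under [RHS]eq_bigr => b _ do under eq_bigr => c _ do rewrite -big_distrl/= mulGg.
under [RHS]eq_bigr => b _ do rewrite sum_deltaC.
by rewrite [RHS]exchange_big; apply: eq_bigr => d _; rewrite /trace3 big_distrl.
Qed.

Lemma curvature_quad P :
  \sum_a \sum_b G a b *
    (\sum_c \sum_d (P c c d * P d a b - P c b d * P d a c)) =
  \sum_d trace3 P d * contr3 P d - quad3 P P.
Proof.
rewrite /quad3 /contr3.
under [X in _ = X - _]eq_bigr do rewrite big_distrr.
rewrite [X in _ = X - _]exchange_big/= -sumrB; apply: eq_bigr => a _ /=.
under [X in _ = X - _]eq_bigr do rewrite big_distrr.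
rewrite [X in _ = X - _]exchange_big/= -sumrB; apply: eq_bigr => b _ /=.
under eq_bigr do rewrite sumrB.
rewrite sumrB mulrBr; congr (_ - _).
rewrite exchange_big big_distrr/=; apply: eq_bigr => d _.
by rewrite -big_distrl/= mulrCA.
Qed.

(** Bilinear expansion around a trace-free [P]. Writing [P . s] for the contraction of [P] paired
    with [s], the products of traces give [n (P . s + (2 - n) |s|^2)], from which [quad3] removes
    [2 P . s + (2 - n) |s|^2] besides its value at [P]. *)
Lemma curvature_quad_conf P : (forall c a b, P c a b = P c b a) ->
  (forall d, trace3 P d = 0) ->
  let X := fun c a b => P c a b + conf3 c a b in
  \sum_a \sum_b G a b *
    (\sum_c \sum_d (X c c d * X d a b - X c b d * X d a c)) =
  \sum_a \sum_b G a b *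
    (\sum_c \sum_d (P c c d * P d a b - P c b d * P d a c)) +
  (n%:R - 2) * (\sum_c contr3 P c * s c) +
  (n%:R - 1) * (2 - n%:R) * (\sum_c s c * raise s c).
Proof.
move=> Psym Ptr X; rewrite !curvature_quad.
have confsym c a b : conf3 c a b = conf3 c b a by rewrite /conf3 gsym; ring.
have -> : quad3 X X = quad3 P P + 2 * (\sum_c contr3 P c * s c) +
    (2 - n%:R) * (\sum_c s c * raise s c).
  have XQ Q : quad3 X Q = quad3 P Q + quad3 conf3 Q by exact: quad3Dl.
  rewrite XQ quad3C XQ [quad3 conf3 X]quad3C XQ [quad3 conf3 P]quad3C.
  rewrite !(quad3_conf Psym) (quad3_conf confsym).
  rewrite [X in _ + (_ + X)](_ : _ = (2 - n%:R) * (\sum_c s c * raise s c)); first by ring.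
  by rewrite big_distrr; apply: eq_bigr => c _ /=; rewrite contr3_conf; ring.
have -> : \sum_d trace3 P d * contr3 P d = 0.
  by rewrite big1// => d _; rewrite Ptr mul0r.
have -> : \sum_d trace3 X d * contr3 X d = n%:R * (\sum_c contr3 P c * s c) +
    n%:R * (2 - n%:R) * (\sum_c s c * raise s c).
  rewrite !big_distrr -big_split; apply: eq_bigr => d _ /=.
  by rewrite trace3D contr3D Ptr trace3_conf contr3_conf; ring.
ring.
Qed.

End ConformalAlgebra.

(** * Rewriting rules for the sealed derivatives and the curvature formulas *)

Section PdRules.
Variables (R : realType) (n : nat) (U : set 'rV[R]_n).
Implicit Types (f g : 'rV[R]_n -> R) (x : 'rV[R]_n).

Lemma pd_add i f g x : Ck 1 U f -> Ck 1 U g -> U x ->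
  part i (fun y => f y + g y) x = part i f x + part i g x.
Proof. by move=> hf hg Ux; exact: pdE (has_pdD (Ck_has_pd i hf Ux) (Ck_has_pd i hg Ux)). Qed.

Lemma pd_sub i f g x : Ck 1 U f -> Ck 1 U g -> U x ->
  part i (fun y => f y - g y) x = part i f x - part i g x.
Proof. by move=> hf hg Ux; exact: pdE (has_pdB (Ck_has_pd i hf Ux) (Ck_has_pd i hg Ux)). Qed.

Lemma pd_mul i f g x : Ck 1 U f -> Ck 1 U g -> U x ->
  part i (fun y => f y * g y) x = part i f x * g x + f x * part i g x.
Proof. by move=> hf hg Ux; exact: pdE (has_pdM (Ck_has_pd i hf Ux) (Ck_has_pd i hg Ux)). Qed.

Lemma pd_scale i c f x : Ck 1 U f -> U x ->
  part i (fun y => c * f y) x = c * part i f x.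
Proof. by move=> hf Ux; exact: pdE (has_pdZ c (Ck_has_pd i hf Ux)). Qed.

Lemma pd_sum (I : Type) (r : seq I) i (F : I -> 'rV[R]_n -> R) x :
  (forall j, Ck 1 U (F j)) -> U x ->
  part i (fun y => \sum_(j <- r) F j y) x = \sum_(j <- r) part i (F j) x.
Proof. by move=> hF Ux; apply/pdE/has_pd_sum => j _; exact: Ck_has_pd (hF j) Ux. Qed.

Lemma pd_cst i (c : R) x : part i (fun=> c) x = 0.
Proof. exact/pdE/has_pd_cst. Qed.

End PdRules.

HB.lock Definition chris (R : realType) (n : nat) (h : 'rV[R]_n -> 'M[R]_n)
  (c a b : 'I_n) : 'rV[R]_n -> R := Christoffel h c a b.

Section Unfolding.
Variables (R : realType) (n : nat) (h : 'rV[R]_n -> 'M[R]_n).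
Implicit Types (x : 'rV[R]_n).

Lemma entryE a b x : entry h a b x = h x a b. Proof. by []. Qed.

Lemma chrisE c a b x : chris h c a b x =
  2^-1 * \sum_d ginvl h c d x *
    (part a (entry h b d) x + part b (entry h a d) x - part d (entry h a b) x).
Proof. by rewrite chris.unlock part.unlock ginvl.unlock. Qed.

Lemma RicciE a b x : Ricci h a b x =
  \sum_c (part c (chris h c a b) x - part b (chris h c a c) x) +
  \sum_c \sum_d (chris h c c d x * chris h d a b x -
                 chris h c b d x * chris h d a c x).
Proof. by rewrite chris.unlock part.unlock. Qed.

Lemma scalar_curvatureE x :
  scalar_curvature h x = \sum_a \sum_b ginvl h a b x * Ricci h a b x.
Proof. by rewrite ginvl.unlock. Qed.

Lemma LaplacianE u x : Laplacian h u x = - (Num.sqrt (\det (h x)))^-1 *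
  \sum_a part a (fun y =>
    \sum_b Num.sqrt (\det (h y)) * ginvl h a b y * part b u y) x.
Proof. by rewrite ginvl.unlock part.unlock. Qed.

End Unfolding.

(** * Curvature of a metric of determinant one *)

Section UnimodularMetric.
Variables (R : realType) (n : nat) (U : set 'rV[R]_n) (g : 'rV[R]_n -> 'M[R]_n).
Local Notation G := (ginvl g).
Local Notation Gam := (chris g).

Hypothesis oU : open U.
Hypothesis gdet1 : forall x, U x -> \det (g x) = 1.
Hypothesis gsym : forall x, U x -> (g x)^T = g x.
Hypothesis gC2 : forall a b, Ck 2 U (entry g a b).

Lemma unimodular_det x : U x -> \det (g x) != 0.
Proof. by move=> Ux; rewrite gdet1// oner_eq0. Qed.
Local Notation gdet := unimodular_det.

Lemma gC1 a b : Ck 1 U (entry g a b).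
Proof. exact: CkW (gC2 a b). Qed.

Lemma GC2 a b : Ck 2 U (G a b).
Proof. exact: Ck_ginv oU gdet gC2. Qed.

Lemma GC1 a b : Ck 1 U (G a b).
Proof. exact: CkW (GC2 a b). Qed.

Lemma dgC1 c a b : Ck 1 U (part c (entry g a b)).
Proof. exact: Ck_pd. Qed.

(** Jacobi's formula applied to [det g = 1], where the cofactors are the entries of the inverse.
    Most simplifications special to determinant one come from here. *)
Lemma trace_dg c x : U x -> \sum_a \sum_b G a b x * part c (entry g a b) x = 0.
Proof.
move=> Ux.
rewrite -[RHS](pd_cst c 1 x) -(pd_eq (f := fun y => \det (g y)) c oU Ux gdet1).
rewrite (pdE (@has_pd_det R n c n g x (\matrix_(a, b) part c (entry g a b) x) _)); last first.
  by move=> a b; rewrite mxE; exact: Ck_has_pd (gC1 a b) Ux.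
apply: eq_bigr => a _; apply: eq_bigr => b _.
rewrite mxE mulrC (ginv_symE gsym a b Ux); congr (_ * _).
by rewrite ginvlE /invmx (g_unit gdet Ux) gdet1// invr1 scale1r mxE.
Qed.

(** For determinant one this is the contracted Christoffel symbol with its index lowered
    ([contr_Christoffel]) and, after raising and up to sign, the divergence of the inverse metric
    ([div_ginv]). *)
Definition contr_dg b x := \sum_c \sum_d G c d x * part c (entry g b d) x.
Local Notation V := contr_dg.

Lemma contr_dg_C1 b : Ck 1 U (V b).
Proof.
by apply: Ck_sum => // c _; apply: Ck_sum => // d _; exact (CkM oU (GC1 c d) (dgC1 c b d)).
Qed.

Lemma div_ginv k x : U x -> \sum_a part a (G a k) x = - \sum_q V q x * G q k x.
Proof.
move=> Ux; rewrite -sumrN.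
under eq_bigr do rewrite (pd_ginv oU gdet gC1 _ _ _ Ux).
rewrite sumrN -sumrN.
under eq_bigr do rewrite exchange_big/= -sumrN.
rewrite exchange_big; apply: eq_bigr => q _ /=.
rewrite sumrN big_distrl/=; congr (- _); apply: eq_bigr => a _.
rewrite big_distrl/=; apply: eq_bigr => p _.
by rewrite (dg_symE oU gsym a p q Ux).
Qed.

Lemma Christoffel_sym c a b x : U x -> Gam c a b x = Gam c b a x.
Proof.
move=> Ux; rewrite !chrisE; congr (_ * _); apply: eq_bigr => d _.
by rewrite [part a _ x + _]addrC (dg_symE oU gsym d a b Ux).
Qed.

Lemma Christoffel_C1 c a b : Ck 1 U (Gam c a b).
Proof.
refine (Ck_eq oU (fun x _ => esym (chrisE g c a b x)) _).
apply: (CkZ _ oU); apply: Ck_sum => // d _.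
exact (CkM oU (GC1 c d) (CkB oU (CkD oU (dgC1 a b d) (dgC1 b a d)) (dgC1 d a b))).
Qed.

(** In general this trace is [d_a ln (sqrt (det g))]. *)
Lemma trace_Christoffel a x : U x -> \sum_c Gam c c a x = 0.
Proof.
move=> Ux; under eq_bigr do rewrite chrisE.
rewrite -big_distrr/=.
have E c d : G c d x * (part c (entry g a d) x + part a (entry g c d) x - part d (entry g c a) x)
    = G c d x * part c (entry g a d) x - G c d x * part d (entry g c a) x +
      G c d x * part a (entry g c d) x by ring.
under eq_bigr => c _ do under eq_bigr => d _ do rewrite E.
under eq_bigr do rewrite big_split sumrB/=.
rewrite big_split sumrB/= trace_dg// addr0.
rewrite [X in _ - X]exchange_big/=.
rewrite (eq_bigr (fun c => \sum_d G d c x * part c (entry g d a) x)) ?subrr ?mulr0//.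
move=> c _; apply: eq_bigr => d _.
by rewrite (ginv_symE gsym c d Ux) (dg_symE oU gsym c a d Ux).
Qed.

Lemma trace_Christoffel' a x : U x -> \sum_c Gam c a c x = 0.
Proof.
move=> Ux; rewrite -[RHS](trace_Christoffel a Ux); apply: eq_bigr => c _.
exact: Christoffel_sym.
Qed.

Lemma contr_Christoffel c x : U x ->
  \sum_a \sum_b G a b x * Gam c a b x = \sum_d G c d x * V d x.
Proof.
move=> Ux.
have E a b : G a b x * Gam c a b x = \sum_d G c d x * (2^-1 *
   (G a b x * part a (entry g b d) x + G a b x * part b (entry g a d) x -
    G a b x * part d (entry g a b) x)).
  rewrite chrisE mulrCA big_distrr big_distrr/=; apply: eq_bigr => d _; ring.
under eq_bigr do under eq_bigr do rewrite E.
under eq_bigr do rewrite exchange_big/=.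
rewrite exchange_big; apply: eq_bigr => d _ /=.
under eq_bigr do rewrite -big_distrr/=.
rewrite -big_distrr/=; congr (_ * _).
under eq_bigr do rewrite -big_distrr/=.
rewrite -big_distrr/=.
under eq_bigr do rewrite sumrB big_split/=.
rewrite sumrB big_split/= trace_dg// subr0.
have -> : \sum_a \sum_b G a b x * part a (entry g b d) x = V d x.
  apply: eq_bigr => a _; apply: eq_bigr => b _.
  by rewrite (dg_symE oU gsym a b d Ux).
have -> : \sum_a \sum_b G a b x * part b (entry g a d) x = V d x.
  rewrite exchange_big; apply: eq_bigr => a _; apply: eq_bigr => b _.
  by rewrite (dg_symE oU gsym a b d Ux) (ginv_symE gsym b a Ux).
by field.
Qed.

(** Two of the four terms of the Ricci tensor contain a trace of the Christoffel symbols and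
    vanish. *)
Lemma Ricci_unimodular a b x : U x ->
  Ricci g a b x = \sum_c part c (Gam c a b) x -
    \sum_c \sum_d Gam c b d x * Gam d a c x.
Proof.
move=> Ux; rewrite RicciE sumrB.
have -> : \sum_c part b (Gam c a c) x = 0.
  transitivity (part b (fun y => \sum_c Gam c a c y) x).
    exact/esym/(pd_sum _ b (fun c => Christoffel_C1 c a c) Ux).
  rewrite (pd_eq b oU Ux (g := fun=> 0)) ?pd_cst//.
  by move=> y Uy; exact: trace_Christoffel'.
rewrite subr0; congr (_ + _); under eq_bigr do rewrite sumrB.
rewrite sumrB exchange_big/= big1 ?sub0r// => d _.
by rewrite -big_distrl/= trace_Christoffel// mul0r.
Qed.

(** * Curvature and Laplacian of the conformal multiple [e^(2s) g] *)

Section Conformal.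
Variables (h : 'rV[R]_n -> 'M[R]_n) (s : 'rV[R]_n -> R).
Hypothesis sC2 : Ck 2 U s.
Hypothesis hE : forall x, U x -> h x = expR (2 * s x) *: g x.
Local Notation ds := (fun x d => part d s x).
Local Notation gat := (fun x a b => g x a b).
Local Notation Gat := (fun x a b => G a b x).
Local Notation up := (fun x => raise (Gat x) (ds x)).

Lemma dsC1 a : Ck 1 U (part a s).
Proof. exact: Ck_pd. Qed.

Lemma ginv_conf a b x : U x -> ginvl h a b x = expR (- (2 * s x)) * G a b x.
Proof.
move=> Ux; rewrite !ginvlE hE// invmxZ ?mxE ?expRN// unitmxZ ?(g_unit gdet Ux)//.
by rewrite unitfE gt_eqF// expR_gt0.
Qed.

Lemma pd_conf c a b x : U x ->
  part c (entry h a b) x =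
  expR (2 * s x) * (2 * part c s x * g x a b + part c (entry g a b) x).
Proof.
move=> Ux.
rewrite (pd_eq (g := fun y => expR (2 * s y) * entry g a b y) c oU Ux); last first.
  by move=> y Uy; rewrite !entryE hE// mxE.
have hs : Ck 1 U s := CkW (leqnSn 1) sC2.
have he := has_pd_exp (has_pdZ 2 (Ck_has_pd c hs Ux)).
by rewrite (pdE (has_pdM he (Ck_has_pd c (gC1 a b) Ux))) entryE; ring.
Qed.

Lemma Christoffel_conf c a b x : U x ->
  chris h c a b x = Gam c a b x + conf3 (gat x) (Gat x) (ds x) c a b.
Proof.
move=> Ux.
have E d : ginvl h c d x *
    (part a (entry h b d) x + part b (entry h a d) x - part d (entry h a b) x)
   = G c d x * (part a (entry g b d) x + part b (entry g a d) x - part d (entry g a b) x) +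
     2 * (part a s x * (G c d x * g x d b) + part b s x * (G c d x * g x d a)
       - g x a b * (G c d x * part d s x)).
  rewrite ginv_conf// !pd_conf// [g x b d](g_symE gsym b d Ux) [g x a d](g_symE gsym a d Ux).
  have X : expR (- (2 * s x)) * expR (2 * s x) = 1 by rewrite -expRD addNr expR0.
  rewrite -!mulrDr -mulrBr mulrACA X mul1r.
  ring.
rewrite !chrisE; under eq_bigr do rewrite E.
rewrite big_split/= mulrDr; congr (_ + _).
rewrite -big_distrr/= mulKf ?pnatr_eq0// sumrB big_split/= -!big_distrr/=.
rewrite !(mul_ginv_g gdet _ _ Ux) /conf3 /raise.
ring.
Qed.

Lemma up_C1 c : Ck 1 U (fun x => up x c).
Proof. by apply: Ck_sum => // d _; exact (CkM oU (GC1 c d) (dsC1 d)). Qed.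

(** The classical law [e^(2s) R(h) = R(g) - 2 (n - 1) div grad s - (n - 1) (n - 2) |ds|^2]. For
    determinant one, [div grad s] is the coordinate divergence of the raised differential. *)
Lemma scalar_curvature_conf x : U x ->
  expR (2 * s x) * scalar_curvature h x = scalar_curvature g x -
  2 * (n%:R - 1) * (\sum_a \sum_b G a b x * part a (part b s) x -
    \sum_a V a x * up x a) -
  (n%:R - 1) * (n%:R - 2) * \sum_a part a s x * up x a.
Proof.
move=> Ux.
(* The trace of the new Christoffel symbols is [n ds]; its derivative contributes [- n d_b d_a s] to
   the Ricci tensor. *)
have trX y b : U y -> \sum_c chris h c b c y = n%:R * part b s y.
  move=> Uy; under eq_bigr do rewrite Christoffel_conf//.
  rewrite big_split/= trace_Christoffel'// add0r.
  rewrite -(trace3_conf (G := Gat y) (ds y)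
    (fun a b => g_symE gsym a b Uy) (fun a b => ginv_symE gsym a b Uy)
    (fun a b => mul_ginv_g gdet a b Uy)).
  by apply: eq_bigr => c _; rewrite /conf3 [g y b c](g_symE gsym b c Uy); ring.
have XC1 c a b : Ck 1 U (chris h c a b).
  pose F y := Gam c a b y +
    ((c == a)%:R * part b s y + (c == b)%:R * part a s y - entry g a b y * up y c).
  have FC : Ck 1 U F.
    exact (CkD oU (Christoffel_C1 c a b) (CkB oU (CkD oU (CkZ (c == a)%:R oU (dsC1 b))
      (CkZ (c == b)%:R oU (dsC1 a))) (CkM oU (gC1 a b) (up_C1 c)))).
  refine (Ck_eq oU _ FC) => y Uy; rewrite /F entryE Christoffel_conf//.
have dX c a b : part c (chris h c a b) x = part c (Gam c a b) x +
    ((c == a)%:R * part c (part b s) x + (c == b)%:R * part c (part a s) x -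
     (part c (entry g a b) x * up x c + g x a b * part c (fun y => up y c) x)).
  transitivity (part c (fun y => Gam c a b y + ((c == a)%:R * part b s y +
     (c == b)%:R * part a s y - entry g a b y * up y c)) x).
    by apply: (pd_eq c oU Ux) => y Uy; rewrite entryE Christoffel_conf.
  have h1 := CkZ (c == a)%:R oU (dsC1 b); have h2 := CkZ (c == b)%:R oU (dsC1 a).
  have h3 := CkM oU (gC1 a b) (up_C1 c).
  rewrite (pd_add c (Christoffel_C1 c a b) (CkB oU (CkD oU h1 h2) h3) Ux).
  rewrite (pd_sub c (CkD oU h1 h2) h3 Ux) (pd_add c h1 h2 Ux).
  rewrite (pd_scale c _ (dsC1 b) Ux) (pd_scale c _ (dsC1 a) Ux).
  by rewrite (pd_mul c (gC1 a b) (up_C1 c) Ux) entryE.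
pose divs := \sum_c part c (fun y => up y c) x.
pose quadX a b := \sum_c \sum_d (chris h c c d x * chris h d a b x -
                 chris h c b d x * chris h d a c x).
pose quadG a b := \sum_c \sum_d (Gam c c d x * Gam d a b x - Gam c b d x * Gam d a c x).
have RX a b : Ricci h a b x = \sum_c part c (Gam c a b) x + 
    (part a (part b s) x + part b (part a s) x - \sum_c part c (entry g a b) x * up x c
      - g x a b * divs) - n%:R * part b (part a s) x + quadX a b.
  rewrite RicciE -/(quadX a b); congr (_ + _); rewrite sumrB; congr (_ - _).
    under eq_bigr do rewrite dX.
    rewrite big_split; congr (_ + _).
    by rewrite /= sumrB !big_split/= !sum_delta -big_distrr/= opprD addrA.
  transitivity (part b (fun y => \sum_c chris h c a c y) x).
    exact/esym/(pd_sum _ b (fun c => XC1 c a c) Ux).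
  rewrite (pd_eq b oU Ux (g := fun y => n%:R * part a s y)).
    exact: pd_scale (dsC1 a) Ux.
  by move=> y Uy; exact: trX.
have RG a b : Ricci g a b x = \sum_c part c (Gam c a b) x + quadG a b.
  rewrite (Ricci_unimodular a b Ux); congr (_ + _).
  rewrite /quadG; under [RHS]eq_bigr do rewrite sumrB.
  rewrite sumrB [X in _ = X - _]exchange_big/= [X in _ = X - _]big1 ?sub0r// => d _.
  by rewrite -big_distrl/= trace_Christoffel// mul0r.
have Q : \sum_a \sum_b G a b x * quadX a b = \sum_a \sum_b G a b x * quadG a b +
    (n%:R - 2) * (\sum_a V a x * up x a) +
    (n%:R - 1) * (2 - n%:R) * \sum_a part a s x * up x a.
  have := curvature_quad_conf (g := gat x) (G := Gat x) (ds x)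
    (fun a b => g_symE gsym a b Ux) (fun a b => ginv_symE gsym a b Ux)
    (fun a b => mul_ginv_g gdet a b Ux) (P := fun c a b => Gam c a b x)
    (fun c a b => Christoffel_sym c a b Ux) (fun d => trace_Christoffel d Ux).
  move=> /= H.
  transitivity (\sum_a \sum_b G a b x * (\sum_c \sum_d
    ((Gam c c d x + conf3 (gat x) (Gat x) (ds x) c c d) *
     (Gam d a b x + conf3 (gat x) (Gat x) (ds x) d a b) -
     (Gam c b d x + conf3 (gat x) (Gat x) (ds x) c b d) *
     (Gam d a c x + conf3 (gat x) (Gat x) (ds x) d a c)))).
    apply: eq_bigr => a _; apply: eq_bigr => b _; congr (_ * _).
    by apply: eq_bigr => c _; apply: eq_bigr => d _; rewrite !Christoffel_conf.
  rewrite H; congr (_ + _ * _ + _).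
  rewrite /contr3; under eq_bigr do rewrite (contr_Christoffel _ Ux) big_distrl/=.
  rewrite exchange_big; apply: eq_bigr => d _ /=.
  rewrite /raise big_distrr/=; apply: eq_bigr => c _.
  by rewrite (ginv_symE gsym c d Ux); ring.
have D : divs = \sum_a \sum_b G a b x * part a (part b s) x - \sum_a V a x * up x a.
  have -> : divs = \sum_c \sum_d (part c (G c d) x * part d s x + G c d x * part c (part d s) x).
    apply: eq_bigr => c _; rewrite /raise.
    rewrite (pd_sum _ c (fun d => CkM oU (GC1 c d) (dsC1 d)) Ux).
    by apply: eq_bigr => d _; rewrite (pd_mul c (GC1 c d) (dsC1 d) Ux).
  under eq_bigr do rewrite big_split/=.
  rewrite big_split/= addrC; congr (_ + _).
  rewrite exchange_big/=; under eq_bigr do rewrite -big_distrl/= div_ginv// mulNr big_distrl/=.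
  rewrite sumrN exchange_big; congr (- _); apply: eq_bigr => q _ /=.
  by rewrite /raise big_distrr/=; apply: eq_bigr => d _; rewrite mulrA.
have -> : expR (2 * s x) * scalar_curvature h x = \sum_a \sum_b G a b x * Ricci h a b x.
  rewrite !scalar_curvatureE big_distrr; apply: eq_bigr => a _ /=.
  rewrite big_distrr; apply: eq_bigr => b _ /=.
  by rewrite ginv_conf// !mulrA -expRD addrN expR0 mul1r.
rewrite !scalar_curvatureE.
(* The derivative [part b (part a s)] is paired with [G b a], so that renaming the summation indices
   brings it to the other order. *)
have E a b : G a b x * Ricci h a b x = G a b x * Ricci g a b x +
    (G a b x * part a (part b s) x) + (1 - n%:R) * (G b a x * part b (part a s) x) -
    G a b x * (\sum_c part c (entry g a b) x * up x c) - (G a b x * g x a b) * divs +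
    G a b x * quadX a b - G a b x * quadG a b.
  by rewrite RX RG (ginv_symE gsym b a Ux); ring.
under eq_bigr => a _ do under eq_bigr => b _ do rewrite E.
under eq_bigr => a _ do rewrite !(sumrB, big_split)/= -big_distrr -big_distrl/=.
rewrite !(sumrB, big_split)/= -big_distrr -big_distrl/=.
have -> : \sum_a \sum_b G a b x * (\sum_c part c (entry g a b) x * up x c) = 0.
  under eq_bigr => a _ do under eq_bigr => b _ do rewrite big_distrr/=.
  under eq_bigr => a _ do rewrite exchange_big/=.
  rewrite exchange_big/= big1// => c _.
  under eq_bigr => a _ do under eq_bigr => b _ do rewrite mulrA.
  by under eq_bigr => a _ do rewrite -big_distrl/=; rewrite -big_distrl/= trace_dg// mul0r.
rewrite (contr_gG (fun a b => g_symE gsym a b Ux) (fun a b => mul_ginv_g gdet a b Ux)).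
rewrite [X in (1 - n%:R) * X]exchange_big/= Q D.
ring.
Qed.

(** The first order coefficients of the Laplacian of [h] once the factor [- e^(- 2 s)] is split
    off. *)
Definition drift b x := \sum_a G a b x * ((n%:R - 2) * part a s x - V a x).

Lemma Laplacian_conf w x : Ck 2 U w -> U x ->
  Laplacian h w x = - expR (- (2 * s x)) *
    (\sum_b drift b x * part b w x + \sum_a \sum_b G a b x * part a (part b w) x).
Proof.
move=> wC2 Ux.
have sq y : U y -> Num.sqrt (\det (h y)) = expR (n%:R * s y).
  move=> Uy; rewrite hE// detZ gdet1// mulr1 expRM_natl expRM_natl -exprM mulnC exprM.
  by rewrite sqrtr_sqr ger0_norm// exprn_ge0// expR_ge0.
(* The weight [sqrt (det h) h^{ab}] equals [mu G^{ab}]: [e^(n s)] comes from the volume and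
   [e^(- 2 s)] from the inverse metric. *)
pose mu y := expR ((n%:R - 2) * s y).
have muE y : expR (n%:R * s y) * expR (- (2 * s y)) = mu y.
  by rewrite -expRD; congr expR; ring.
have muC1 : Ck 1 U mu := Ck_exp oU (CkZ (n%:R - 2) oU (CkW (leqnSn 1) sC2)).
have GwC1 a b : Ck 1 U (fun y => G a b y * part b w y) := CkM oU (GC1 a b) (Ck_pd b wC2).
have dmu a : part a mu x = mu x * ((n%:R - 2) * part a s x).
  exact/pdE/has_pd_exp/has_pdZ/(Ck_has_pd a (CkW (leqnSn 1) sC2) Ux).
have dF a : part a (fun y => \sum_b Num.sqrt (\det (h y)) * ginvl h a b y * part b w y) x =
    mu x * (\sum_b ((n%:R - 2) * part a s x * G a b x + part a (G a b) x) * part b w x +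
      \sum_b G a b x * part a (part b w) x).
  rewrite (pd_eq (g := fun y => \sum_b mu y * (G a b y * part b w y)) a oU Ux); last first.
    move=> y Uy; apply: eq_bigr => b _.
    by rewrite (sq y Uy) (ginv_conf a b Uy) -muE !mulrA.
  rewrite (pd_sum _ a (fun b => CkM oU muC1 (GwC1 a b)) Ux) -big_split big_distrr.
  apply: eq_bigr => b _ /=.
  rewrite (pd_mul a muC1 (GwC1 a b) Ux) (pd_mul a (GC1 a b) (Ck_pd b wC2) Ux) dmu.
  ring.
rewrite LaplacianE sq//; under eq_bigr do rewrite dF.
rewrite -big_distrr/= mulrA mulNr -expRN; congr (_ * _).
  by rewrite -expRD; congr (- expR _); ring.
rewrite big_split/=; congr (_ + _).
rewrite exchange_big; apply: eq_bigr => b _ /=; rewrite -big_distrl/= /drift; congr (_ * _).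
rewrite big_split/= div_ginv// -sumrN -big_split; apply: eq_bigr => a _ /=.
by rewrite mulrBr [G a b x * V a x]mulrC [G a b x * _]mulrC.
Qed.

(** * Consequences of the equations for [u] and [x^k u] *)

Section Harmonic.
Variable u : 'rV[R]_n -> R.
Hypothesis uC2 : Ck 2 U u.
Hypothesis u_gt0 : forall x, U x -> 0 < u x.
Hypothesis u_harm : forall x, U x -> conformal_Laplacian h u x = 0.
Hypothesis xu_harm : forall k x, U x ->
  conformal_Laplacian h (fun y => y 0 k * u y) x = 0.
Hypothesis n_ge2 : (2 <= n)%N.

Definition potential x := (n%:R - 2) * s x + 2 * ln (u x).

Lemma ln_u_C2 : Ck 2 U (fun x => ln (u x)).
Proof. exact: Ck_ln. Qed.

Lemma potential_C2 : Ck 2 U potential.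
Proof. exact (CkD oU (CkZ (n%:R - 2) oU sC2) (CkZ 2 oU ln_u_C2)). Qed.

Lemma pd_potential a x : U x -> part a potential x =
  (n%:R - 2) * part a s x + 2 * part a (fun y => ln (u y)) x.
Proof.
move=> Ux; have s1 := CkW (leqnSn 1) sC2; have l1 := CkW (leqnSn 1) ln_u_C2.
rewrite (pd_add a (CkZ (n%:R - 2) oU s1) (CkZ 2 oU l1) Ux).
by rewrite (pd_scale a _ s1 Ux) (pd_scale a _ l1 Ux).
Qed.

Lemma pd_u a x : U x -> part a u x = u x * part a (fun y => ln (u y)) x.
Proof.
move=> Ux; have u1 := CkW (leqnSn 1) uC2.
rewrite (pdE (has_pd_ln (u_gt0 Ux) (Ck_has_pd a u1 Ux))) mulrA mulfV ?mul1r//.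
by rewrite gt_eqF// u_gt0.
Qed.

(** The curvature terms of [L_h (x^k u)] and [x^k L_h u] coincide, so the Laplacians agree. This
    leaves [drift_k u + 2 G^{kb} d_b u = 0], and division by [u] turns it into the raised form of
    [dv - V = 0]. *)
Lemma contr_dg_potential a x : U x -> V a x = part a potential x.
Proof.
move=> Ux; have u1 := CkW (leqnSn 1) uC2.
have xC k l : Ck l U (fun y => y 0 k) by exact: Ck_coord.
have d1 k b y : U y -> part b (fun y => y 0 k * u y) y = (b == k)%:R * u y + y 0 k * part b u y.
  by move=> Uy; exact: pdE (has_pdM (has_pd_coord b k y) (Ck_has_pd b u1 Uy)).
have d2 k b c : part c (part b (fun y => y 0 k * u y)) x =
    (b == k)%:R * part c u x + (c == k)%:R * part b u x + x 0 k * part c (part b u) x.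
  rewrite (pd_eq c oU Ux (d1 k b)).
  have h1 := CkZ (b == k)%:R oU u1; have h2 := CkM oU (xC k 1%N) (Ck_pd b uC2).
  rewrite (pd_add c h1 h2 Ux) (pd_scale c _ u1 Ux) -addrA; congr (_ + _).
  exact: pdE (has_pdM (has_pd_coord c k x) (Ck_has_pd c (Ck_pd b uC2) Ux)).
have K k : Laplacian h (fun y => y 0 k * u y) x = x 0 k * Laplacian h u x.
  have := xu_harm k Ux; have := u_harm Ux; rewrite /conformal_Laplacian.
  move=> /eqP; rewrite addr_eq0 => /eqP -> /eqP; rewrite addr_eq0 => /eqP ->.
  by ring.
have Z k : raise (Gat x) (fun a => part a potential x - V a x) k = 0.
  have := K k; rewrite (Laplacian_conf (CkM oU (xC k 2%N) uC2) Ux) (Laplacian_conf uC2 Ux).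
  rewrite mulrCA => /mulfI-/(_ _)/wrap[]; first by rewrite oppr_eq0 gt_eqF// expR_gt0.
  (* Sort the Laplacian of [x^k u] by where the derivatives fall. The terms in which none falls on
     [x^k] will cancel against [x^k] times the Laplacian of [u]. *)
  under eq_bigr do rewrite d1// mulrDr mulrCA.
  under [X in _ + X = _]eq_bigr => c _ do under eq_bigr => b _ do rewrite d2 !mulrDr mulrCA.
  under [X in _ + X = _]eq_bigr => c _ do rewrite !big_split/= sum_delta.
  rewrite !big_split/= sum_delta.
  under [X in _ + (_ + X + _) = _]eq_bigr => c _ do under eq_bigr => b _ do rewrite mulrCA.
  under [X in _ + (_ + X + _) = _]eq_bigr => c _ do rewrite -big_distrr/=.
  rewrite sum_delta.
  under [X in _ + X + _ = _]eq_bigr do rewrite mulrCA.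
  rewrite -[X in _ + X + _ = _]big_distrr/=.
  under [X in _ + (_ + X) = _]eq_bigr => c _ do under eq_bigr => b _ do rewrite mulrCA.
  under [X in _ + (_ + X) = _]eq_bigr => c _ do rewrite -big_distrr/=.
  rewrite -[X in _ + (_ + X) = _]big_distrr/= => H.
  have {}H : drift k x * u x + 2 * \sum_b G k b x * part b u x = 0.
    have e1 : \sum_b G b k x * part b u x = \sum_b G k b x * part b u x.
      by apply: eq_bigr => b _; rewrite (ginv_symE gsym b k Ux).
    move: H; rewrite e1.
    rewrite mulrDr; move: (\sum_i _) (\sum_i _) (\sum_i _) (drift k x * u x) => p q r d.
    by move=> /(congr1 (fun z => z - x 0 k * q - x 0 k * r)); lra.
  apply: (mulfI (lt0r_neq0 (u_gt0 Ux))); rewrite mulr0 -H /raise /drift.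
  rewrite big_distrl !big_distrr -big_split; apply: eq_bigr => b _ /=.
  by rewrite pd_potential// (pd_u b Ux) (ginv_symE gsym b k Ux); ring.
apply/eqP; rewrite eq_sym -subr_eq0; apply/eqP.
rewrite -(lower_raise (fun a b => g_symE gsym a b Ux) (fun a b => ginv_symE gsym a b Ux)
  (fun a b => mul_ginv_g gdet a b Ux) (fun a => part a potential x - V a x) a).
by rewrite big1// => c _; rewrite Z mulr0.
Qed.

(** With [p = ln u], the equation [L_h u = 0] divided by [u] expresses the curvature of [h] by
    derivatives of [s] and [p]. After the conformal law has replaced that curvature by the one of
    [g], only the combination [(n - 2) s + 2 p] survives. *)
Lemma scalar_curvature_potential x : U x ->
  (n%:R - 2) / (2 * (n%:R - 1)) * scalar_curvature g x =
  \sum_a \sum_b G a b x * part a (part b potential) x -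
  2^-1 * \sum_a \sum_b G a b x * (V a x * V b x).
Proof.
move=> Ux.
pose p := fun y => ln (u y).
have pC1 b : Ck 1 U (part b p) := Ck_pd b ln_u_C2.
have u1 := CkW (leqnSn 1) uC2.
pose ip (y z : 'I_n -> R) := \sum_a \sum_b G a b x * (y a * z b).
have ipC y z : ip y z = ip z y.
  rewrite /ip exchange_big; apply: eq_bigr => a _; apply: eq_bigr => b _.
  by rewrite (ginv_symE gsym b a Ux) [y b * _]mulrC.
have ipD c d y z w : ip (fun a => c * y a + d * z a) w = c * ip y w + d * ip z w.
  rewrite /ip !big_distrr -big_split; apply: eq_bigr => a _ /=.
  by rewrite !big_distrr -big_split; apply: eq_bigr => b _ /=; ring.
have ip_raise y z : \sum_a y a * raise (Gat x) z a = ip y z.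
  rewrite /ip; apply: eq_bigr => a _; rewrite /raise big_distrr.
  by apply: eq_bigr => b _ /=; rewrite mulrCA.
pose S a := part a s x; pose P a := part a p x.
pose TS := \sum_a \sum_b G a b x * part a (part b s) x.
pose TP := \sum_a \sum_b G a b x * part a (part b p) x.
have VE : (fun a => V a x) = fun a => (n%:R - 2) * S a + 2 * P a.
  by rewrite funeqE => a; rewrite contr_dg_potential// pd_potential.
have TV : \sum_a \sum_b G a b x * part a (part b potential) x = (n%:R - 2) * TS + 2 * TP.
  rewrite !big_distrr -big_split; apply: eq_bigr => a _ /=.
  rewrite !big_distrr -big_split; apply: eq_bigr => b _ /=.
  rewrite (pd_eq a oU Ux (pd_potential b)).
  rewrite (pd_add a (CkZ (n%:R - 2) oU (dsC1 b)) (CkZ 2 oU (pC1 b)) Ux).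
  by rewrite (pd_scale a _ (dsC1 b) Ux) (pd_scale a _ (pC1 b) Ux); ring.
have n1 : n%:R - 1 != 0 :> R by rewrite subr_eq0 pnatr_eq1; case: n n_ge2 => [|[]].
have e0 : expR (2 * s x) != 0 by rewrite gt_eqF// expR_gt0.
have H : (n%:R - 2) / (4 * (n%:R - 1)) * (expR (2 * s x) * scalar_curvature h x) =
    ip (fun a => (n%:R - 2) * S a + (-1) * V a x) P + (ip P P + TP).
  have := u_harm Ux; rewrite /conformal_Laplacian (Laplacian_conf uC2 Ux) expRN.
  have -> : \sum_b drift b x * part b u x = u x * ip (fun a => (n%:R - 2) * S a + (-1) * V a x) P.
    rewrite /ip exchange_big big_distrr; apply: eq_bigr => b _ /=.
    rewrite (pd_u b Ux) /drift big_distrl big_distrr; apply: eq_bigr => a _ /=.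
    by rewrite /S /P /p; ring.
  have -> : \sum_a \sum_b G a b x * part a (part b u) x = u x * (ip P P + TP).
    rewrite /ip -big_split big_distrr; apply: eq_bigr => a _ /=.
    rewrite -big_split big_distrr; apply: eq_bigr => b _ /=.
    rewrite (pd_eq a oU Ux (pd_u b)) (pd_mul a u1 (pC1 b) Ux) (pd_u a Ux) /P /p.
    ring.
  rewrite -mulrDr => /eqP; rewrite mulNr addrC subr_eq0 => /eqP H.
  have u0 : u x != 0 by rewrite gt_eqF// u_gt0.
  apply: (mulfI u0); rewrite -[RHS](mulVKf e0) -H; ring.
move: H; rewrite scalar_curvature_conf// TV !ip_raise -/TS.
rewrite -/(ip (fun a => V a x) (fun a => V a x)).
(* Everything is expanded in the inner products of [ds] and [dp]; what is left is an identity with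
   coefficients rational in [n]. *)
rewrite (ipD _ _ _ _ P) !VE !ipD !(ipC _ (fun a => _ * S a + _)) !ipD (ipC P S).
move: (ip S S) (ip S P) (ip P P) (scalar_curvature g x) => SS SP PP Rg H.
have -> : (n%:R - 2) / (2 * (n%:R - 1)) * Rg = 2 * ((n%:R - 2) / (4 * (n%:R - 1)) * Rg).
  by field.
have {H} -> : (n%:R - 2) / (4 * (n%:R - 1)) * Rg = (n%:R - 2) / (4 * (n%:R - 1)) *
   (2 * (n%:R - 1) * (TS - ((n%:R - 2) * SS + 2 * SP)) + (n%:R - 1) * (n%:R - 2) * SS) +
    ((n%:R - 2) * SP + -1 * ((n%:R - 2) * SP + 2 * PP) + (PP + TP)).
  by rewrite -H; ring.
by field.
Qed.

End Harmonic.
End Conformal.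
End UnimodularMetric.

(** * Polynomial functions of jets *)

Import (canonicals) mpoly.

Section JetFunctions.
Variables (R : realType) (n : nat).
Implicit Types (F : ('rV[R]_n -> 'M[R]_n) -> 'rV[R]_n -> R).

Lemma CkX k m (U : set 'rV[R]_m) (f : 'rV[R]_m -> R) p : open U -> Ck k U f ->
  Ck k U (fun x => f x ^+ p).
Proof.
move=> oU hf; elim: p => [|p IH].
  by refine (Ck_eq oU _ (Ck_cst (k:=k) 1 oU)) => x _; rewrite expr0.
by refine (Ck_eq oU _ (CkM oU hf IH)) => x _; rewrite exprS.
Qed.

Lemma Ck_meval k m N (U : set 'rV[R]_m) (f : 'I_N -> 'rV[R]_m -> R)
    (T : mpoly.mpoly N R) : open U -> (forall i, Ck k U (f i)) ->
  Ck k U (fun x => mpoly.meval (fun i => f i x) T).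
Proof.
move=> oU hf.
refine (Ck_eq oU (fun x _ => esym (mpoly.mevalE _ _)) _).
apply: Ck_sum => // mon _; apply: CkZ => //.
by apply: Ck_prod => // i _; exact: CkX.
Qed.

(** One polynomial serves all [h] and [x], even where [h x] is singular and [invmx] takes its
    default value: the entries of the inverse are variables of their own. *)
Definition jet2_poly F : Prop := exists T : jet_poly R n,
  forall h x, jet_poly_at T h x = F h x.

Lemma jet2_ext F F' : (forall h x, F h x = F' h x) -> jet2_poly F -> jet2_poly F'.
Proof. by move=> FF' [T HT]; exists T => h x; rewrite HT. Qed.

Lemma jet2_cst (c : R) : jet2_poly (fun _ _ => c).
Proof. by exists (mpoly.mpolyC _ c) => h x; rewrite /jet_poly_at mpoly.mevalC. Qed.

Lemma jet2D F F' : jet2_poly F -> jet2_poly F' -> jet2_poly (fun h x => F h x + F' h x).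
Proof.
move=> [T HT] [T' HT']; exists ((T : mpoly.mpoly _ R) + T') => h x.
by rewrite -HT -HT' /jet_poly_at mpoly.mevalD.
Qed.

Lemma jet2M F F' : jet2_poly F -> jet2_poly F' -> jet2_poly (fun h x => F h x * F' h x).
Proof.
move=> [T HT] [T' HT']; exists ((T : mpoly.mpoly _ R) * T') => h x.
by rewrite -HT -HT' /jet_poly_at mpoly.mevalM.
Qed.

Lemma jet2Z (c : R) F : jet2_poly F -> jet2_poly (fun h x => c * F h x).
Proof. by move=> hF; exact: jet2M (jet2_cst c) hF. Qed.

Lemma jet2N F : jet2_poly F -> jet2_poly (fun h x => - F h x).
Proof. by move=> hF; apply: (jet2_ext _ (jet2Z (-1) hF)) => h x; rewrite mulN1r. Qed.

Lemma jet2B F F' : jet2_poly F -> jet2_poly F' -> jet2_poly (fun h x => F h x - F' h x).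
Proof. by move=> hF hF'; exact: jet2D hF (jet2N hF'). Qed.

Lemma jet2_sum (I : Type) (r : seq I) (F : I -> ('rV[R]_n -> 'M[R]_n) -> 'rV[R]_n -> R) :
  (forall i, jet2_poly (F i)) -> jet2_poly (fun h x => \sum_(i <- r) F i h x).
Proof.
move=> hF; elim: r => [|i r IH].
  by apply: (jet2_ext _ (jet2_cst 0)) => h x; rewrite big_nil.
by apply: (jet2_ext _ (jet2D (hF i) IH)) => h x; rewrite big_cons.
Qed.

Lemma jet2_var (j : jet2inv_index n) : jet2_poly (fun h x => jet2inv_val h x j).
Proof.
exists (mpoly.mpolyX R (mpoly.mnm1 (enum_rank j))) => h x.
by rewrite /jet_poly_at mpoly.mevalXU enum_rankK.
Qed.

Lemma jet2_entry a b : jet2_poly (fun h x => entry h a b x).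
Proof. exact: (jet2_var (inl (inl (inl (a, b))))). Qed.

Lemma jet2_part c a b : jet2_poly (fun h x => part c (entry h a b) x).
Proof. by rewrite part.unlock; exact: (jet2_var (inl (inl (inr (c, a, b))))). Qed.

Lemma jet2_part2 d c a b : jet2_poly (fun h x => part d (part c (entry h a b)) x).
Proof. by rewrite part.unlock; exact: (jet2_var (inl (inr (d, c, a, b)))). Qed.

Lemma jet2_ginv a b : jet2_poly (fun h x => ginvl h a b x).
Proof. by rewrite ginvl.unlock; exact: (jet2_var (inr (a, b))). Qed.

Definition nondegenerate_C2 (U : set 'rV[R]_n) (h : 'rV[R]_n -> 'M[R]_n) : Prop := [/\ open U,
  forall x, U x -> \det (h x) != 0 & forall a b, Ck 2 U (entry h a b)].

Lemma jet2_C0 F U h : jet2_poly F -> nondegenerate_C2 U h -> Ck 0 U (F h).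
Proof.
move=> [T HT] [oU d0 hC].
refine (Ck_eq oU (fun x _ => HT h x) _); apply: Ck_meval => // i.
have hC1 a b : Ck 1 U (entry h a b) by exact: CkW (hC a b).
case: (enum_val i) => [[[[a b]|[[c a] b]]|[[[d c] a] b]]|[a b]] /=.
- exact: CkW (hC a b).
- by have := Ck_pd c (hC1 a b); rewrite part.unlock.
- by have := Ck_pd d (Ck_pd c (hC a b)); rewrite part.unlock.
- have := @Ck_ginv R n 0 U h a b oU d0 (fun a b => CkW (leq0n 2) (hC a b)).
  by rewrite ginvl.unlock.
Qed.

(* The derivative of such a function of the 1-jet is again polynomial, so it need
   not be written down. *)
Definition jet1_poly F : Prop := jet2_poly F /\
  forall c, exists2 D, jet2_poly D &
    forall U h x, nondegenerate_C2 U h -> U x -> has_pd c (F h) x (D h x).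

Lemma jet1_jet2 F : jet1_poly F -> jet2_poly F.
Proof. by case. Qed.

Lemma jet1_C1 F U h : jet1_poly F -> nondegenerate_C2 U h -> Ck 1 U (F h).
Proof.
move=> [hF hD] hh; have [oU _ _] := hh.
have [D HD] := choice (fun c => let: ex_intro2 D h1 h2 := hD c in
  ex_intro (fun D => jet2_poly D /\ _) D (conj h1 h2)).
apply: (Ck_intro (d := fun c => D c h)) => // [x Ux|c x Ux|c].
- exact: Ck_cont (jet2_C0 hF hh) Ux.
- by case: (HD c) => _ H; exact: H hh Ux.
- by case: (HD c) => H _; exact: jet2_C0 H hh.
Qed.

(** Choice fixes the derivatives of a whole family as functions of the jet before any metric is
    given. *)
Lemma jet1_family (F : 'I_n -> 'I_n -> ('rV[R]_n -> 'M[R]_n) -> 'rV[R]_n -> R) :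
  (forall b c, jet1_poly (F b c)) ->
  exists dF : 'I_n -> 'I_n -> 'I_n -> ('rV[R]_n -> 'M[R]_n) -> 'rV[R]_n -> R,
    forall a b c, jet2_poly (dF a b c) /\
      forall U h x, nondegenerate_C2 U h -> U x -> has_pd a (F b c h) x (dF a b c h x).
Proof.
move=> hF.
have H (p : 'I_n * 'I_n * 'I_n) : exists D, jet2_poly D /\
    forall U h x, nondegenerate_C2 U h -> U x -> has_pd p.1.1 (F p.1.2 p.2 h) x (D h x).
  by have [_ /(_ p.1.1)[D hD HD]] := hF p.1.2 p.2; exists D.
have [D HD] := choice H.
by exists (fun a b c => D (a, b, c)) => a b c; exact: HD (a, b, c).
Qed.

Lemma jet1_ext F F' : (forall h x, F h x = F' h x) -> jet1_poly F -> jet1_poly F'.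
Proof.
move=> FF'; suff -> : F = F' by [].
by rewrite funeqE => h; rewrite funeqE => x.
Qed.

Lemma jet1_cst (c : R) : jet1_poly (fun _ _ => c).
Proof.
split=> [|a]; first exact: jet2_cst.
by exists (fun _ _ => 0) => [|U h x _ _]; [exact: jet2_cst|exact: has_pd_cst].
Qed.

Lemma jet1D F F' : jet1_poly F -> jet1_poly F' -> jet1_poly (fun h x => F h x + F' h x).
Proof.
move=> [hF dF] [hF' dF']; split=> [|c]; first exact: jet2D.
have [D hD HD] := dF c; have [D' hD' HD'] := dF' c.
exists (fun h x => D h x + D' h x) => [|U h x hh Ux]; first exact: jet2D.
exact: has_pdD (HD U h x hh Ux) (HD' U h x hh Ux).
Qed.

Lemma jet1M F F' : jet1_poly F -> jet1_poly F' -> jet1_poly (fun h x => F h x * F' h x).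
Proof.
move=> [hF dF] [hF' dF']; split=> [|c]; first exact: jet2M.
have [D hD HD] := dF c; have [D' hD' HD'] := dF' c.
exists (fun h x => D h x * F' h x + F h x * D' h x) => [|U h x hh Ux].
  by apply: jet2D; exact: jet2M.
exact: has_pdM (HD U h x hh Ux) (HD' U h x hh Ux).
Qed.

Lemma jet1Z (c : R) F : jet1_poly F -> jet1_poly (fun h x => c * F h x).
Proof. by move=> hF; exact: jet1M (jet1_cst c) hF. Qed.

Lemma jet1N F : jet1_poly F -> jet1_poly (fun h x => - F h x).
Proof. by move=> hF; apply: (jet1_ext _ (jet1Z (-1) hF)) => h x; rewrite mulN1r. Qed.

Lemma jet1B F F' : jet1_poly F -> jet1_poly F' -> jet1_poly (fun h x => F h x - F' h x).
Proof. by move=> hF hF'; exact: jet1D hF (jet1N hF'). Qed.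

Lemma jet1_sum (I : Type) (r : seq I) (F : I -> ('rV[R]_n -> 'M[R]_n) -> 'rV[R]_n -> R) :
  (forall i, jet1_poly (F i)) -> jet1_poly (fun h x => \sum_(i <- r) F i h x).
Proof.
move=> hF; elim: r => [|i r IH].
  by apply: (jet1_ext _ (jet1_cst 0)) => h x; rewrite big_nil.
by apply: (jet1_ext _ (jet1D (hF i) IH)) => h x; rewrite big_cons.
Qed.

Lemma jet1_entry a b : jet1_poly (fun h x => entry h a b x).
Proof.
split=> [|c]; first exact: jet2_entry.
exists (fun h x => part c (entry h a b) x) => [|U h x [_ _ hC] Ux]; first exact: jet2_part.
exact: Ck_has_pd (CkW (leqnSn 1) (hC a b)) Ux.
Qed.

Lemma jet1_part d a b : jet1_poly (fun h x => part d (entry h a b) x).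
Proof.
split=> [|c]; first exact: jet2_part.
exists (fun h x => part c (part d (entry h a b)) x) => [|U h x [_ _ hC] Ux].
  exact: jet2_part2.
exact: Ck_has_pd (Ck_pd d (hC a b)) Ux.
Qed.

(** The derivative of the inverse metric is not among the variables; this polynomial in them equals
    it wherever [pd_ginv] applies. *)
Definition pd_ginv_jet c a b (h : 'rV[R]_n -> 'M[R]_n) x :=
  - \sum_p \sum_q ginvl h a p x * part c (entry h p q) x * ginvl h q b x.

Lemma jet1_ginv a b : jet1_poly (fun h x => ginvl h a b x).
Proof.
split=> [|c]; first exact: jet2_ginv.
exists (pd_ginv_jet c a b) => [|U h x [oU d0 hC] Ux].
  apply: jet2N; apply: jet2_sum => p; apply: jet2_sum => q.
  exact: jet2M (jet2M (jet2_ginv _ _) (jet2_part _ _ _)) (jet2_ginv _ _).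
have hC1 a' b' : Ck 1 U (entry h a' b') := CkW (leqnSn 1) (hC a' b').
rewrite /pd_ginv_jet -(pd_ginv oU d0 hC1 c a b Ux).
exact: Ck_has_pd (Ck_ginv a b oU d0 hC1) Ux.
Qed.

Lemma jet1_pd_ginv c a b : jet1_poly (pd_ginv_jet c a b).
Proof.
apply: jet1N; apply: jet1_sum => p; apply: jet1_sum => q.
exact: jet1M (jet1M (jet1_ginv _ _) (jet1_part _ _ _)) (jet1_ginv _ _).
Qed.

Lemma jet1_chris c a b : jet1_poly (fun h x => chris h c a b x).
Proof.
apply: (jet1_ext (fun h x => esym (chrisE h c a b x))).
apply: jet1Z; apply: jet1_sum => d; apply: jet1M; first exact: jet1_ginv.
by apply: jet1B; [apply: jet1D|]; exact: jet1_part.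
Qed.

Lemma posdef_det m (H : 'M[R]_m) : posdef H -> \det H != 0.
Proof.
move=> pH; apply/negP => /det0P[v v0 vH].
by have := pH v v0; rewrite vH mul0mx mxE ltxx.
Qed.

Definition jet1_matrix (v : 'rV[R]_#|{: jet1_index n}|) : 'M[R]_n :=
  \matrix_(a, b) v 0 (enum_rank (inl (a, b) : jet1_index n)).

Definition jet2_matrix (v : 'rV[R]_#|{: jet2_index n}|) : 'M[R]_n :=
  \matrix_(a, b) v 0 (enum_rank (inl (inl (a, b)) : jet2_index n)).

Lemma jet1_matrixE h x : jet1_matrix (jet1 h x) = h x.
Proof. by apply/matrixP => a b; rewrite !mxE enum_rankK. Qed.

Lemma jet2_matrixE h x : jet2_matrix (jet2 h x) = h x.
Proof. by apply/matrixP => a b; rewrite !mxE enum_rankK. Qed.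

Lemma det_neq0_open N (A : 'rV[R]_N -> 'M[R]_n) :
  (forall a b, Ck 0 setT (fun v => A v a b)) -> open [set v | \det (A v) != 0].
Proof.
move=> hA; apply: (@open_comp _ _ (fun v => \det (A v)) [set r | r != 0]).
  by move=> v _; apply: (@Ck_cont _ _ 0 setT) => //; apply: Ck_det => //; exact: openT.
exact: open_neq.
Qed.

Lemma smooth_sub N (U V : set 'rV[R]_N) f : V `<=` U -> smooth U f -> smooth V f.
Proof. by move=> VU hf k; exact: Ck_sub (hf k). Qed.

Lemma Ck_jet1_matrix k (U : set 'rV[R]_#|{: jet1_index n}|) a b : open U ->
  Ck k U (fun v => jet1_matrix v a b).
Proof.
move=> oU; refine (Ck_eq oU (fun v _ => esym _) (Ck_coord (k:=k) _ oU)).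
by rewrite mxE.
Qed.

Lemma jet1_det_open :
  open [set v : 'rV[R]_#|{: jet1_index n}| | \det (jet1_matrix v) != 0].
Proof. exact: det_neq0_open (fun a b => Ck_jet1_matrix (k:=0) a b openT). Qed.

Lemma Ck_jet1_ginv k a b :
  Ck k [set v : 'rV[R]_#|{: jet1_index n}| | \det (jet1_matrix v) != 0]
    (fun v => invmx (jet1_matrix v) a b).
Proof.
by apply: (Ck_invmx _ _ jet1_det_open) => // i j; exact: Ck_jet1_matrix jet1_det_open.
Qed.

(** Substitute [invmx] for the inverse variables. Smoothness is proved on the larger set where the
    determinant does not vanish, which is open as a preimage. *)
Lemma jet2_poly_smooth F : jet2_poly F ->
  exists2 L : 'rV[R]_#|{: jet2_index n}| -> R,
    smooth (@jet2_domain R n) L & forall h x, L (jet2 h x) = F h x.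
Proof.
move=> [T HT].
pose f (i : 'I_#|{: jet2inv_index n}|) (v : 'rV[R]_#|{: jet2_index n}|) :=
  match enum_val i with
  | inl j => v 0 (enum_rank j)
  | inr (a, b) => invmx (jet2_matrix v) a b
  end.
exists (fun v => mpoly.meval (fun i => f i v) T) => [|h x]; last first.
  rewrite -HT /jet_poly_at; apply: mpoly.meval_eq => i; rewrite /f.
  case: (enum_val i) => [j|[a b]] /=; first by rewrite mxE enum_rankK.
  by rewrite jet2_matrixE.
have mC k U a' b' : open U -> Ck k U (fun v => jet2_matrix v a' b').
  move=> oU; refine (Ck_eq oU (fun v _ => esym _) (Ck_coord (k:=k) _ oU)).
  by rewrite mxE.
apply: (@smooth_sub _ [set v | \det (jet2_matrix v) != 0]) => [v|k].
  exact: posdef_det.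
have oW := det_neq0_open (fun a b => mC 0%N setT a b openT).
apply: Ck_meval => // i; rewrite /f; case: (enum_val i) => [j|[a b]].
  exact: Ck_coord.
by apply: Ck_invmx => //= a' b'; exact: mC.
Qed.

End JetFunctions.

(** * The Cotton tensor *)

Section Formulas.
Variables (R : realType) (n : nat).
Implicit Types (a b c : 'I_n).

Definition box a b (h : 'rV[R]_n -> 'M[R]_n) x :=
  \sum_d \sum_e ginvl h d e x * part d (part e (entry h a b)) x.

(** What remains of the Ricci tensor besides [- 1/2 box] and [d_a V_b]: derivatives of the inverse
    metric in the divergence of the Christoffel symbols, corrections for pulling [d_a] and [d_b] out
    of the contractions, and the quadratic term. *)
Definition ricci_rest a b (h : 'rV[R]_n -> 'M[R]_n) x :=
  2^-1 * (\sum_c \sum_d pd_ginv_jet c c d h x *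
     (part a (entry h b d) x + part b (entry h a d) x - part d (entry h a b) x))
  - 2^-1 * (\sum_c \sum_d pd_ginv_jet a c d h x * part c (entry h b d) x)
  - 2^-1 * (\sum_c \sum_d pd_ginv_jet b c d h x * part c (entry h a d) x)
  - \sum_c \sum_d chris h c b d x * chris h d a c x.

(** The trace of [- 1/2 box + ricci_rest], the trace of [box] being rewritten by [contr_box]. *)
Definition scalar_rest (h : 'rV[R]_n -> 'M[R]_n) x :=
  2^-1 * (\sum_c \sum_d ginvl h c d x *
     \sum_a \sum_b pd_ginv_jet c a b h x * part d (entry h a b) x) +
  \sum_a \sum_b ginvl h a b x * ricci_rest a b h x.

(** The solution [R] of [R = T + scalar_rest] and [(n - 2) / (2 (n - 1)) R = T - 1/2 |V|^2]; the
    factor inverts [1 - (n - 2) / (2 (n - 1)) = n / (2 (n - 1))]. *)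
Definition scalar_jet (h : 'rV[R]_n -> 'M[R]_n) x :=
  2 * (n%:R - 1) / n%:R * (scalar_rest h x +
    2^-1 * \sum_a \sum_b ginvl h a b x * (contr_dg h a x * contr_dg h b x)).

Definition schouten_rest b c (h : 'rV[R]_n -> 'M[R]_n) x :=
  ricci_rest b c h x - (2 * (n%:R - 1))^-1 * scalar_jet h x * entry h b c x.

Definition pd_contr_jet b c (h : 'rV[R]_n -> 'M[R]_n) x :=
  \sum_d \sum_e (pd_ginv_jet b d e h x * part d (entry h c e) x +
                 ginvl h d e x * part b (part d (entry h c e)) x).

Definition schouten_jet b c (h : 'rV[R]_n -> 'M[R]_n) x :=
  (n%:R - 2)^-1 * (- 2^-1 * box b c h x + pd_contr_jet b c h x + schouten_rest b c h x).

Definition connection_jet a b c (h : 'rV[R]_n -> 'M[R]_n) x :=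
  \sum_d (chris h d a b x * schouten_jet d c h x + chris h d a c x * schouten_jet b d h x).

Lemma jet1_contr_dg a : jet1_poly (fun h x => contr_dg h a x : R).
Proof.
apply: jet1_sum => c; apply: jet1_sum => d.
exact: jet1M (jet1_ginv _ _ _) (jet1_part _ _ _ _).
Qed.

Lemma jet1_ricci_rest a b : jet1_poly (ricci_rest a b).
Proof.
apply: jet1B; last first.
  by apply: jet1_sum => c; apply: jet1_sum => d; apply: jet1M; exact: jet1_chris.
apply: jet1B; [apply: jet1B|]; apply: jet1Z; apply: jet1_sum => c;
  apply: jet1_sum => d; apply: jet1M; try exact: jet1_pd_ginv; try exact: jet1_part.
by apply: jet1B; [apply: jet1D|]; exact: jet1_part.
Qed.

Lemma jet1_scalar_jet : jet1_poly scalar_jet.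
Proof.
apply: jet1Z; apply: jet1D; [apply: jet1D; [apply: jet1Z|]|apply: jet1Z].
- apply: jet1_sum => c; apply: jet1_sum => d; apply: jet1M; first exact: jet1_ginv.
  apply: jet1_sum => a; apply: jet1_sum => b.
  by apply: jet1M; [exact: jet1_pd_ginv|exact: jet1_part].
- apply: jet1_sum => a; apply: jet1_sum => b.
  by apply: jet1M; [exact: jet1_ginv|exact: jet1_ricci_rest].
- apply: jet1_sum => a; apply: jet1_sum => b; apply: jet1M; first exact: jet1_ginv.
  by apply: jet1M; exact: jet1_contr_dg.
Qed.

Lemma jet1_schouten_rest b c : jet1_poly (schouten_rest b c).
Proof.
apply: jet1B; first exact: jet1_ricci_rest.
apply: jet1M; last exact: jet1_entry.
by apply: jet1Z; exact: jet1_scalar_jet.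
Qed.

Lemma jet2_box a b : jet2_poly (box a b).
Proof.
apply: jet2_sum => d; apply: jet2_sum => e.
by apply: jet2M; [exact: jet2_ginv|exact: jet2_part2].
Qed.

Lemma jet2_schouten_jet b c : jet2_poly (schouten_jet b c).
Proof.
apply: jet2Z; apply: jet2D; last exact: jet1_jet2 (jet1_schouten_rest b c).
apply: jet2D; first by apply: jet2Z; exact: jet2_box.
apply: jet2_sum => d; apply: jet2_sum => e; apply: jet2D; apply: jet2M.
- exact: jet1_jet2 (jet1_pd_ginv _ _ _ _).
- exact: jet2_part.
- exact: jet2_ginv.
- exact: jet2_part2.
Qed.

Lemma jet2_connection_jet a b c : jet2_poly (connection_jet a b c).
Proof.
apply: jet2_sum => d; apply: jet2D; apply: jet2M; try exact: jet2_schouten_jet;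
  exact: jet1_jet2 (jet1_chris _ _ _ _).
Qed.

Variable dN : 'I_n -> 'I_n -> 'I_n -> ('rV[R]_n -> 'M[R]_n) -> 'rV[R]_n -> R.

Definition pd_box_rest a b c (h : 'rV[R]_n -> 'M[R]_n) x :=
  \sum_d \sum_e pd_ginv_jet a d e h x * part d (part e (entry h b c)) x.

(** [dN] stands for the derivatives of [schouten_rest]. The term [d_a d_b V_c] is absent because it
    is symmetric in [a] and [b]. *)
Definition cotton_rest a b c (h : 'rV[R]_n -> 'M[R]_n) x :=
  (n%:R - 2)^-1 * (- 2^-1 * (pd_box_rest a b c h x - pd_box_rest b a c h x) +
    (dN a b c h x - dN b a c h x)) -
  connection_jet a b c h x + connection_jet b a c h x.

Lemma jet2_pd_box_rest a b c : jet2_poly (pd_box_rest a b c).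
Proof.
apply: jet2_sum => d; apply: jet2_sum => e.
by apply: jet2M; [exact: jet1_jet2 (jet1_pd_ginv _ _ _ _)|exact: jet2_part2].
Qed.

Lemma jet2_cotton_rest a b c : (forall a b c, jet2_poly (dN a b c)) ->
  jet2_poly (cotton_rest a b c).
Proof.
move=> hN; apply: jet2D; last exact: jet2_connection_jet.
apply: jet2B; last exact: jet2_connection_jet.
apply: jet2Z; apply: jet2D; last by apply: jet2B.
by apply: jet2Z; apply: jet2B; exact: jet2_pd_box_rest.
Qed.

Lemma nabla_SchoutenE a b c (h : 'rV[R]_n -> 'M[R]_n) x : nabla_Schouten h a b c x =
  part a (Schouten h b c) x -
  \sum_d (chris h d a b x * Schouten h d c x + chris h d a c x * Schouten h b d x).
Proof. by rewrite chris.unlock part.unlock. Qed.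

Lemma third_orderE a b c (h : 'rV[R]_n -> 'M[R]_n) x : third_order h a b c x =
  \sum_d \sum_e ginvl h d e x *
    part d (part e (fun y => part a (entry h b c) y - part b (entry h a c) y)) x.
Proof. by rewrite ginvl.unlock part.unlock. Qed.

Lemma dnabla_SchoutenE a b c (h : 'rV[R]_n -> 'M[R]_n) phi : dnabla_Schouten h a b c phi =
  - integral_rV (fun x => Schouten h b c x * part a phi x) -
  integral_rV (fun x => (\sum_d (chris h d a b x * Schouten h d c x +
     chris h d a c x * Schouten h b d x)) * phi x).
Proof. by rewrite chris.unlock part.unlock. Qed.

Lemma dthird_orderE a b c (h : 'rV[R]_n -> 'M[R]_n) phi : dthird_order h a b c phi =
  \sum_d \sum_e - integral_rV (fun x =>
    part e (fun y => part a (entry h b c) y - part b (entry h a c) y) x *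
    part d (fun y => ginvl h d e y * phi y) x).
Proof. by rewrite ginvl.unlock part.unlock. Qed.

End Formulas.

(** * Integrals of continuous functions with compact support *)

Section ContinuousCompactSupport.
Variables (R : realType) (n : nat) (U : set 'rV[R]_n).
Hypothesis oU : open U.
Implicit Types F G : 'rV[R]_n -> R.

Definition Cc F : Prop := Ck 0 U F /\ csupp U F.

Lemma CcM F phi : Ck 0 U F -> Cc phi -> Cc (fun x => F x * phi x).
Proof. by move=> hF [hp sp]; split; [exact: CkM|exact: csuppM]. Qed.

Lemma CcZ c F : Cc F -> Cc (fun x => c * F x).
Proof. by move=> hF; apply: CcM => //; exact: Ck_cst. Qed.

Lemma CcN F : Cc F -> Cc (fun x => - F x).
Proof.
move=> hF; have -> : (fun x => - F x) = fun x => -1 * F x.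
  by rewrite funeqE => x; rewrite mulN1r.
exact: CcZ.
Qed.

Lemma CcD F G : Cc F -> Cc G -> Cc (fun x => F x + G x).
Proof. by move=> [hF sF] [hG sG]; split; [exact: CkD|exact: csuppD]. Qed.

Lemma CcB F G : Cc F -> Cc G -> Cc (fun x => F x - G x).
Proof. by move=> hF hG; exact: CcD hF (CcN hG). Qed.

Lemma Cc_sum (I : Type) (r : seq I) (F : I -> 'rV[R]_n -> R) :
  (forall j, Cc (F j)) -> Cc (fun x => \sum_(j <- r) F j x).
Proof.
move=> hF; split; first by apply: Ck_sum => // j _; case: (hF j).
by apply: csupp_sum => j; case: (hF j).
Qed.

Lemma Cc_intD F G : Cc F -> Cc G ->
  integral_rV (fun x => F x + G x) = integral_rV F + integral_rV G.
Proof. by move=> [hF sF] [hG sG]; exact: (intD oU). Qed.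

Lemma Cc_intB F G : Cc F -> Cc G ->
  integral_rV (fun x => F x - G x) = integral_rV F - integral_rV G.
Proof. by move=> [hF sF] [hG sG]; exact: (intB oU). Qed.

Lemma Cc_intZ c F : Cc F ->
  integral_rV (fun x => c * F x) = c * integral_rV F.
Proof. by move=> [hF sF]; exact: (intZ oU). Qed.

Lemma Cc_int_sum2 (I J : finType) (F : I -> J -> 'rV[R]_n -> R) :
  (forall i j, Cc (F i j)) ->
  integral_rV (fun x => \sum_i \sum_j F i j x) = \sum_i \sum_j integral_rV (F i j).
Proof.
move=> hF; rewrite (int_sum oU) => [|i|i]; last 2 first.
- by have [] := Cc_sum (index_enum J) (hF i).
- by have [] := Cc_sum (index_enum J) (hF i).
apply: eq_bigr => i _; rewrite (int_sum oU) => // j; by case: (hF i j).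
Qed.

Lemma Cc_int_eq F G : (forall x, U x -> F x = G x) -> csupp U F -> csupp U G ->
  integral_rV F = integral_rV G.
Proof. exact: int_eq. Qed.

Lemma test_function_Ck k phi : test_function U phi -> Ck k U phi.
Proof. by move=> [sm _]; apply: Ck_sub (sm k). Qed.

Lemma test_function_csupp phi : test_function U phi -> csupp U phi.
Proof. by case. Qed.

End ContinuousCompactSupport.

(** * Ricci, Schouten and Cotton tensors of the normalized metric *)

Section Normalized.
Variables (R : realType) (n : nat) (U : set 'rV[R]_n) (g : 'rV[R]_n -> 'M[R]_n).
Local Notation G := (ginvl g).
Local Notation V := (contr_dg g).

Hypothesis n_ge3 : (3 <= n)%N.
Hypothesis oU : open U.
Hypothesis gdet1 : forall x, U x -> \det (g x) = 1.
Hypothesis gsym : forall x, U x -> (g x)^T = g x.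
Hypothesis gC2 : forall a b, Ck 2 U (entry g a b).
(** Closedness of [V] and the formula for the scalar curvature are all that the argument retains of
    conformal harmonic coordinates. *)
Hypothesis V_closed : forall a b x, U x -> part a (V b) x = part b (V a) x.
Hypothesis scalarE : forall x, U x ->
  (n%:R - 2) / (2 * (n%:R - 1)) * scalar_curvature g x =
  \sum_a \sum_b G a b x * part a (V b) x -
  2^-1 * \sum_a \sum_b G a b x * (V a x * V b x).

Let gdet := unimodular_det gdet1.
Let gC1 a b : Ck 1 U (entry g a b) := CkW (leqnSn 1) (gC2 a b).
Let GC1 a b : Ck 1 U (G a b) := Ck_ginv a b oU gdet gC1.
Let dgC1 c a b : Ck 1 U (part c (entry g a b)) := Ck_pd c (gC2 a b).

Lemma nondegenerate_normalized : nondegenerate_C2 U g.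
Proof. by split. Qed.

Lemma pd_ginv_jetE c a b x : U x -> part c (G a b) x = pd_ginv_jet c a b g x.
Proof. exact: pd_ginv. Qed.

Lemma pd_contr_jetE b c x : U x -> part b (V c) x = pd_contr_jet b c g x.
Proof.
move=> Ux; rewrite /contr_dg.
rewrite (pd_sum _ b (fun d => Ck_sum _ oU (fun e _ => CkM oU (GC1 d e) (dgC1 d c e))) Ux).
apply: eq_bigr => d _; rewrite (pd_sum _ b (fun e => CkM oU (GC1 d e) (dgC1 d c e)) Ux).
by apply: eq_bigr => e _; rewrite (pd_mul b (GC1 d e) (dgC1 d c e) Ux) pd_ginv_jetE.
Qed.

(** Up to derivatives of the inverse metric, the divergence of the Christoffel symbols contains
    [1/2 (d_a V_b + d_b V_a)]; closedness of [V] merges the two halves. *)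
Lemma Ricci_normalized a b x : U x ->
  Ricci g a b x = - 2^-1 * box a b g x + part a (V b) x + ricci_rest a b g x.
Proof.
move=> Ux; rewrite (Ricci_unimodular oU gdet1 gsym gC2 a b Ux) /ricci_rest.
rewrite [RHS]addrA; congr (_ - _).
have E c : part c (chris g c a b) x = 2^-1 * \sum_d (pd_ginv_jet c c d g x *
     (part a (entry g b d) x + part b (entry g a d) x - part d (entry g a b) x) +
    (G c d x * part a (part c (entry g b d)) x + G c d x * part b (part c (entry g a d)) x
     - G c d x * part c (part d (entry g a b)) x)).
  rewrite (pd_eq c oU Ux (fun y _ => chrisE g c a b y)).
  have hF d : Ck 1 U (fun y => part a (entry g b d) y + part b (entry g a d) y -
     part d (entry g a b) y) by exact (CkB oU (CkD oU (dgC1 a b d) (dgC1 b a d)) (dgC1 d a b)).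
  rewrite (pd_scale c _ (Ck_sum _ oU (fun d _ => CkM oU (GC1 c d) (hF d))) Ux).
  rewrite (pd_sum _ c (fun d => CkM oU (GC1 c d) (hF d)) Ux); congr (_ * _).
  apply: eq_bigr => d _; rewrite (pd_mul c (GC1 c d) (hF d) Ux) pd_ginv_jetE//.
  rewrite (pd_sub c (CkD oU (dgC1 a b d) (dgC1 b a d)) (dgC1 d a b) Ux).
  rewrite (pd_add c (dgC1 a b d) (dgC1 b a d) Ux).
  rewrite (schwarz c a oU (gC2 b d) Ux) (schwarz c b oU (gC2 a d) Ux).
  by congr (_ + _); rewrite mulrBr mulrDr.
under eq_bigr do rewrite E.
rewrite -big_distrr/=; under eq_bigr => c _ do rewrite big_split sumrB big_split/=.
rewrite big_split sumrB big_split/=.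
(* Schwarz has put the derivative [e] outermost, so it can be pulled out of the contraction. *)
have P e f : \sum_c \sum_d G c d x * part e (part c (entry g f d)) x =
    part e (V f) x - \sum_c \sum_d pd_ginv_jet e c d g x * part c (entry g f d) x.
  rewrite (pd_contr_jetE e f Ux) -sumrB; apply: eq_bigr => c _.
  by rewrite -sumrB; apply: eq_bigr => d _; rewrite addrC addKr.
rewrite !P [part b (V a) x](V_closed b a Ux) /box.
by field.
Qed.

(** Differentiate the identity of [trace_dg]: traces of second derivatives of the metric are of
    first order. *)
Lemma contr_part2 c d x : U x ->
  \sum_a \sum_b G a b x * part c (part d (entry g a b)) x =
  - \sum_a \sum_b pd_ginv_jet c a b g x * part d (entry g a b) x.
Proof.
move=> Ux.
apply/eqP; rewrite -addr_eq0 -big_split; apply/eqP => /=.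
transitivity (part c (fun y => \sum_a \sum_b G a b y * part d (entry g a b) y) x).
  rewrite (pd_sum _ c (fun a => Ck_sum _ oU (fun b _ => CkM oU (GC1 a b) (dgC1 d a b))) Ux).
  apply: eq_bigr => a _; rewrite -big_split.
  rewrite (pd_sum _ c (fun b => CkM oU (GC1 a b) (dgC1 d a b)) Ux).
  apply: eq_bigr => b _ /=; rewrite (pd_mul c (GC1 a b) (dgC1 d a b) Ux) pd_ginv_jetE//.
  by rewrite addrC.
rewrite (pd_eq (g := fun=> 0) c oU Ux) ?pd_cst// => y Uy.
exact: (trace_dg oU gdet1 gsym gC2).
Qed.

Lemma contr_box x : U x -> \sum_a \sum_b G a b x * box a b g x =
  - \sum_c \sum_d G c d x * \sum_a \sum_b pd_ginv_jet c a b g x * part d (entry g a b) x.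
Proof.
move=> Ux.
transitivity (\sum_c \sum_d G c d x * \sum_a \sum_b G a b x * part c (part d (entry g a b)) x).
  rewrite /box.
  under eq_bigr => a _ do under eq_bigr => b _ do rewrite big_distrr/=.
  under eq_bigr => a _ do under eq_bigr => b _ do under eq_bigr => c _ do rewrite big_distrr/=.
  under eq_bigr => a _ do rewrite exchange_big/=.
  rewrite exchange_big; apply: eq_bigr => c _ /=.
  under eq_bigr => a _ do rewrite exchange_big/=.
  rewrite exchange_big; apply: eq_bigr => d _ /=.
  rewrite big_distrr; apply: eq_bigr => a _ /=.
  by rewrite big_distrr; apply: eq_bigr => b _ /=; rewrite mulrCA.
rewrite -sumrN; apply: eq_bigr => c _; rewrite -sumrN; apply: eq_bigr => d _.
by rewrite contr_part2// mulrN.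
Qed.

Lemma scalar_normalized x : U x -> scalar_curvature g x = scalar_jet g x.
Proof.
move=> Ux.
have E : scalar_curvature g x = \sum_a \sum_b G a b x * part a (V b) x + scalar_rest g x.
  rewrite scalar_curvatureE.
  have E a b : G a b x * Ricci g a b x = - 2^-1 * (G a b x * box a b g x) +
     G a b x * part a (V b) x + G a b x * ricci_rest a b g x.
    by rewrite Ricci_normalized//; ring.
  under eq_bigr => a _ do under eq_bigr => b _ do rewrite E.
  under eq_bigr => a _ do rewrite !big_split/= -big_distrr/=.
  rewrite !big_split/= -big_distrr/= contr_box// /scalar_rest.
  ring.
have := scalarE Ux; rewrite /scalar_jet.
move: E; move: (scalar_curvature g x) (scalar_rest g x) => Rg rest.
move: (\sum_a _) (\sum_a _) => VV TV -> H.
have n0 : n%:R != 0 :> R by rewrite pnatr_eq0; case: n n_ge3.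
have n1 : n%:R - 1 != 0 :> R by rewrite subr_eq0 pnatr_eq1; case: n n_ge3 => [|[]].
have n12 : 2 * (n%:R - 1) != 0 :> R by rewrite mulf_neq0// pnatr_eq0.
(* Subtracting this from [2 (n - 1)] times the trace formula eliminates [TV] and leaves [n] times
   the curvature. *)
have {H} : (n%:R - 2) * (TV + rest) = 2 * (n%:R - 1) * (TV - 2^-1 * VV).
  by rewrite -H; field.
move=> H; apply: (mulfI n0).
have -> : n%:R * (2 * (n%:R - 1) / n%:R * (rest + 2^-1 * VV)) =
  2 * (n%:R - 1) * (rest + 2^-1 * VV) by field.
have -> : n%:R * (TV + rest) = 2 * (n%:R - 1) * (TV + rest) - (n%:R - 2) * (TV + rest) by ring.
rewrite H; ring.
Qed.

Lemma Schouten_normalized b c x : U x ->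
  Schouten g b c x = (n%:R - 2)^-1 *
    (- 2^-1 * box b c g x + part b (V c) x + schouten_rest b c g x).
Proof.
move=> Ux; rewrite /Schouten Ricci_normalized// scalar_normalized// /schouten_rest entryE.
ring.
Qed.

Lemma Schouten_jetE b c x : U x -> Schouten g b c x = schouten_jet b c g x.
Proof. by move=> Ux; rewrite Schouten_normalized// pd_contr_jetE. Qed.

Section CottonFormula.
Variable dN : 'I_n -> 'I_n -> 'I_n -> ('rV[R]_n -> 'M[R]_n) -> 'rV[R]_n -> R.
Hypothesis dN_jet2 : forall a b c, jet2_poly (dN a b c).
Hypothesis dNE : forall a b c U h x, nondegenerate_C2 U h -> U x ->
  has_pd a (schouten_rest b c h) x (dN a b c h x).

Let nd := nondegenerate_normalized.

Lemma schouten_rest_C1 b c : Ck 1 U (schouten_rest b c g).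
Proof. exact: jet1_C1 (jet1_schouten_rest R b c) nd. Qed.

Lemma connectionE a b c x : U x ->
  \sum_d (chris g d a b x * Schouten g d c x + chris g d a c x * Schouten g b d x) =
  connection_jet a b c g x.
Proof. by move=> Ux; apply: eq_bigr => d _; rewrite !Schouten_jetE. Qed.

Lemma pd3C a d e b c x : (forall p q, Ck 3 U (entry g p q)) -> U x ->
  part a (part d (part e (entry g b c))) x = part d (part e (part a (entry g b c))) x.
Proof.
move=> gC3 Ux; rewrite (schwarz a d oU (Ck_pd e (gC3 b c)) Ux).
by apply: (pd_eq d oU Ux) => y Uy; exact: schwarz a e oU (gC2 b c) Uy.
Qed.

Lemma pd_Schouten a b c x : (forall p q, Ck 3 U (entry g p q)) -> U x ->
  part a (Schouten g b c) x = (n%:R - 2)^-1 *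
    (- 2^-1 * (pd_box_rest a b c g x +
        \sum_d \sum_e G d e x * part d (part e (part a (entry g b c))) x) +
     part a (part b (V c)) x + dN a b c g x).
Proof.
move=> gC3 Ux.
have ddC1 d e : Ck 1 U (part d (part e (entry g b c))) := Ck_pd d (Ck_pd e (gC3 b c)).
have tC1 d e : Ck 1 U (fun y => G d e y * part d (part e (entry g b c)) y).
  exact (CkM oU (GC1 d e) (ddC1 d e)).
have bC1 : Ck 1 U (box b c g) := Ck_sum _ oU (fun d _ => Ck_sum _ oU (fun e _ => tC1 d e)).
have VC2 : Ck 2 U (V c).
  apply: Ck_sum => // d _; apply: Ck_sum => // e _.
  exact (CkM oU (Ck_ginv d e oU gdet gC2) (Ck_pd d (gC3 c e))).
have dbox : part a (box b c g) x = pd_box_rest a b c g x +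
    \sum_d \sum_e G d e x * part d (part e (part a (entry g b c))) x.
  rewrite (pd_sum _ a (fun d => Ck_sum _ oU (fun e _ => tC1 d e)) Ux) -big_split.
  apply: eq_bigr => d _; rewrite (pd_sum _ a (fun e => tC1 d e) Ux) -big_split.
  apply: eq_bigr => e _ /=.
  by rewrite (pd_mul a (GC1 d e) (ddC1 d e) Ux) pd_ginv_jetE// (pd3C a d e b c gC3 Ux).
rewrite (pd_eq a oU Ux (Schouten_normalized b c)).
have h1 : Ck 1 U (fun y => - 2^-1 * box b c g y) := CkZ (- 2^-1) oU bC1.
have h2 := Ck_pd b VC2; have h3 := schouten_rest_C1 b c.
rewrite (pd_scale a _ (CkD oU (CkD oU h1 h2) h3) Ux).
rewrite (pd_add a (CkD oU h1 h2) h3 Ux) (pd_add a h1 h2 Ux) (pd_scale a _ bC1 Ux) dbox.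
by rewrite (pdE (dNE a b c nd Ux)).
Qed.

Lemma third_order_C3 a b c x : (forall p q, Ck 3 U (entry g p q)) -> U x ->
  third_order g a b c x =
  \sum_d \sum_e (G d e x * part d (part e (part a (entry g b c))) x -
                 G d e x * part d (part e (part b (entry g a c))) x).
Proof.
move=> gC3 Ux; rewrite third_orderE.
apply: eq_bigr => d _; apply: eq_bigr => e _.
rewrite -mulrBr; congr (_ * _).
have k1 := Ck_pd e (Ck_pd a (gC3 b c)); have k2 := Ck_pd e (Ck_pd b (gC3 a c)).
rewrite -(pd_sub d k1 k2 Ux); apply: (pd_eq d oU Ux) => y Uy.
exact: pd_sub (dgC1 a b c) (dgC1 b a c) Uy.
Qed.

(** For [g] of class [C^3] the contraction [V c] is [C^2], so Schwarz removes [d_a d_b V_c]. *)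
Lemma Cotton_pointwise a b c x : (forall p q, Ck 3 U (entry g p q)) -> U x ->
  Cotton g a b c x = - (2 * (n%:R - 2))^-1 * third_order g a b c x +
    cotton_rest dN a b c g x.
Proof.
move=> gC3 Ux.
have VC2 : Ck 2 U (V c).
  apply: Ck_sum => // d _; apply: Ck_sum => // e _.
  exact (CkM oU (Ck_ginv d e oU gdet gC2) (Ck_pd d (gC3 c e))).
rewrite /Cotton !nabla_SchoutenE !connectionE// !pd_Schouten//.
rewrite (schwarz b a oU VC2 Ux) third_order_C3// /cotton_rest.
under [X in _ = _ * X + _]eq_bigr do rewrite sumrB.
rewrite sumrB.
have -> : (2 * (n%:R - 2))^-1 = 2^-1 * (n%:R - 2)^-1 :> R by rewrite invfM.
ring.
Qed.

Section Distribution.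
Variable phi : 'rV[R]_n -> R.
Hypothesis tphi : test_function U phi.

Let phiC2 : Ck 2 U phi := test_function_Ck (k:=2) tphi.
Let phiC1 : Ck 1 U phi := CkW (leqnSn 1) phiC2.
Let sphi : csupp U phi := test_function_csupp tphi.
Let CcF F : Ck 0 U F -> Cc U (fun x => F x * phi x).
Proof. by move=> hF; apply: CcM => //; split => //; exact: CkW phiC1. Qed.
Let CcdF F a : Ck 0 U F -> Cc U (fun x => F x * part a phi x).
Proof. by move=> hF; apply: CcM => //; split; [exact: Ck_pd|exact: csupp_pd]. Qed.
Let jetC0 F : jet2_poly F -> Ck 0 U (F g).
Proof. by move=> hF; exact: jet2_C0 hF nd. Qed.

(** Minus the value at [phi] of the distribution [G^{de} d_d d_e d_a g_{bc}]. *)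
Definition third_pairing a b c :=
  \sum_d \sum_e integral_rV (fun x => part e (part a (entry g b c)) x *
    part d (fun y => G d e y * phi y) x).

(** Absorb [G] into the test function, at the price of the term with [d_a G]. Then [int_pd_exchange]
    swaps [a] with [d], and Schwarz for [g] swaps [a] with [e]. *)
Lemma box_pairing a b c :
  integral_rV (fun x => box b c g x * part a phi x) =
  third_pairing a b c - integral_rV (fun x => pd_box_rest a b c g x * phi x).
Proof.
have GpC2 d e : Ck 2 U (fun y => G d e y * phi y).
  exact (CkM oU (Ck_ginv d e oU gdet gC2) phiC2).
have ddC0 d e : Ck 0 U (part d (part e (entry g b c))) := Ck_pd d (Ck_pd e (gC2 b c)).
have tC0 d e : Ck 0 U (fun x => G d e x * part d (part e (entry g b c)) x).
  exact (CkM oU (CkW (leq0n 1) (GC1 d e)) (ddC0 d e)).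
have rC0 d e : Ck 0 U (fun x => pd_ginv_jet a d e g x * part d (part e (entry g b c)) x).
  exact (CkM oU (jetC0 (jet1_jet2 (jet1_pd_ginv _ _ _ _))) (ddC0 d e)).
have -> : integral_rV (fun x => box b c g x * part a phi x) = \sum_d \sum_e
    integral_rV (fun x => G d e x * part d (part e (entry g b c)) x * part a phi x).
  rewrite -(Cc_int_sum2 oU (fun d e => CcdF a (tC0 d e))).
  congr integral_rV; rewrite funeqE => x; rewrite big_distrl.
  by apply: eq_bigr => d _ /=; rewrite big_distrl.
have -> : integral_rV (fun x => pd_box_rest a b c g x * phi x) = \sum_d \sum_e
    integral_rV (fun x => pd_ginv_jet a d e g x * part d (part e (entry g b c)) x * phi x).
  rewrite -(Cc_int_sum2 oU (fun d e => CcF (rC0 d e))).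
  congr integral_rV; rewrite funeqE => x; rewrite big_distrl.
  by apply: eq_bigr => d _ /=; rewrite big_distrl.
rewrite /third_pairing -sumrB; apply: eq_bigr => d _; rewrite -sumrB; apply: eq_bigr => e _.
have sGp : csupp U (fun y => G d e y * phi y) by exact: csuppM.
have -> : integral_rV (fun x =>
    part e (part a (entry g b c)) x * part d (fun y => G d e y * phi y) x) =
    integral_rV (fun x => part d (part e (entry g b c)) x * part a (fun y => G d e y * phi y) x).
  rewrite (int_pd_exchange oU d a (Ck_pd e (gC2 b c)) (GpC2 d e) sGp).
  apply: (Cc_int_eq (U := U)) => [x Ux||]; last 2 first.
  - exact/csuppM/csupp_pd.
  - exact/csuppM/csupp_pd.
  by rewrite (schwarz e a oU (gC2 b c) Ux).
rewrite -(Cc_intB oU); last 2 first.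
- split; first exact (CkM oU (ddC0 d e) (CkW (leq0n 1) (Ck_pd a (GpC2 d e)))).
  exact/csuppM/csupp_pd.
- exact: CcF (rC0 d e).
apply: (Cc_int_eq (U := U)) => [x Ux||].
- by rewrite (pd_mul a (GC1 d e) phiC1 Ux) pd_ginv_jetE//; ring.
- exact/csuppM/csupp_pd.
- apply: csuppD; first exact/csuppM/csupp_pd.
  by have [] := CcN oU (CcF (rC0 d e)).
Qed.

Lemma Schouten_pairing a b c :
  integral_rV (fun x => Schouten g b c x * part a phi x) = (n%:R - 2)^-1 *
    (- 2^-1 * (third_pairing a b c - integral_rV (fun x => pd_box_rest a b c g x * phi x)) +
     integral_rV (fun x => part b (V c) x * part a phi x) -
     integral_rV (fun x => dN a b c g x * phi x)).
Proof.
have VC1 : Ck 1 U (V c) := contr_dg_C1 oU gdet1 gC2 c.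
have c1 := CcdF a (jetC0 (jet2_box R b c)).
have c2 := CcdF a (Ck_pd b VC1).
have c3 := CcdF a (CkW (leq0n 1) (schouten_rest_C1 b c)).
have -> : - integral_rV (fun x => dN a b c g x * phi x) =
    integral_rV (fun x => schouten_rest b c g x * part a phi x).
  apply/eqP; rewrite eqr_oppLR -(int_by_parts oU a (schouten_rest_C1 b c) phiC1 sphi).
  apply/eqP/(Cc_int_eq (U := U)) => [x Ux||].
  - by rewrite (pdE (dNE a b c nd Ux)).
  - exact: csuppM.
  - exact: csuppM.
rewrite -box_pairing -(Cc_intZ oU _ c1) -(Cc_intD oU (CcZ oU _ c1) c2).
rewrite -(Cc_intD oU (CcD oU (CcZ oU _ c1) c2) c3).
rewrite -(Cc_intZ oU _ (CcD oU (CcD oU (CcZ oU _ c1) c2) c3)).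
apply: (Cc_int_eq (U := U)) => [x Ux||].
- by rewrite Schouten_normalized//; ring.
- exact/csuppM/csupp_pd.
- by have [] := CcZ oU (n%:R - 2)^-1 (CcD oU (CcD oU (CcZ oU (- 2^-1) c1) c2) c3).
Qed.

Lemma dthird_orderP a b c :
  dthird_order g a b c phi = - (third_pairing a b c - third_pairing b a c).
Proof.
rewrite dthird_orderE /third_pairing -sumrB -sumrN; apply: eq_bigr => d _.
rewrite -sumrB -sumrN; apply: eq_bigr => e _; congr (- _).
have GpC1 : Ck 1 U (fun y => G d e y * phi y) := CkM oU (GC1 d e) phiC1.
have sGp : csupp U (fun y => G d e y * phi y) by exact: csuppM.
have cc : Cc U (part d (fun y => G d e y * phi y)).
  by split; [exact: Ck_pd|exact: csupp_pd].
have k1 := CcM oU (Ck_pd e (dgC1 a b c)) cc; have k2 := CcM oU (Ck_pd e (dgC1 b a c)) cc.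
rewrite -(Cc_intB oU k1 k2).
apply: (Cc_int_eq (U := U)) => [x Ux||].
- by rewrite (pd_sub e (dgC1 a b c) (dgC1 b a c) Ux) mulrBl.
- by case: cc => _ sc; exact: csuppM.
- by have [] := CcB oU k1 k2.
Qed.

Lemma Cotton_distribution a b c :
  dCotton g a b c phi = - (2 * (n%:R - 2))^-1 * dthird_order g a b c phi +
    dfun (cotton_rest dN a b c g) phi.
Proof.
have conn a' b' : integral_rV (fun x => (\sum_d (chris g d a' b' x * Schouten g d c x +
    chris g d a' c x * Schouten g b' d x)) * phi x) =
    integral_rV (fun x => connection_jet a' b' c g x * phi x).
  apply: (Cc_int_eq (U := U)) => [x Ux||]; [by rewrite connectionE|exact: csuppM|exact: csuppM].
have rest : dfun (cotton_rest dN a b c g) phi = (n%:R - 2)^-1 * (- 2^-1 *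
     (integral_rV (fun x => pd_box_rest a b c g x * phi x) -
      integral_rV (fun x => pd_box_rest b a c g x * phi x)) +
     (integral_rV (fun x => dN a b c g x * phi x) -
      integral_rV (fun x => dN b a c g x * phi x))) -
    integral_rV (fun x => connection_jet a b c g x * phi x) +
    integral_rV (fun x => connection_jet b a c g x * phi x).
  have p1 := CcF (jetC0 (jet2_pd_box_rest R a b c)).
  have p2 := CcF (jetC0 (jet2_pd_box_rest R b a c)).
  have q1 := CcF (jetC0 (dN_jet2 a b c)); have q2 := CcF (jetC0 (dN_jet2 b a c)).
  have r1 := CcF (jetC0 (jet2_connection_jet R a b c)).
  have r2 := CcF (jetC0 (jet2_connection_jet R b a c)).
  have p := CcZ oU (- 2^-1) (CcB oU p1 p2); have q := CcB oU q1 q2.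
  have pq := CcZ oU (n%:R - 2)^-1 (CcD oU p q).
  rewrite -(Cc_intB oU p1 p2) -(Cc_intB oU q1 q2) -(Cc_intZ oU _ (CcB oU p1 p2)).
  rewrite -(Cc_intD oU p q) -(Cc_intZ oU _ (CcD oU p q)) -(Cc_intB oU pq r1).
  rewrite -(Cc_intD oU (CcB oU pq r1) r2) /dfun.
  by congr integral_rV; rewrite funeqE => x; rewrite /cotton_rest; ring.
have VC1 : Ck 1 U (V c) := contr_dg_C1 oU gdet1 gC2 c.
(* [V c] is only [C^1] here; this is the weak form of [d_a d_b V_c = d_b d_a V_c]. *)
have ex := int_pd_exchange oU a b VC1 phiC2 sphi.
rewrite /dCotton !dnabla_SchoutenE !conn !Schouten_pairing dthird_orderP rest ex.
have -> : (2 * (n%:R - 2))^-1 = 2^-1 * (n%:R - 2)^-1 :> R by rewrite invfM.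
ring.
Qed.

End Distribution.
End CottonFormula.
End Normalized.

(** * The quasilinear operator *)

Section LogDet.
Variables (R : realType) (n : nat).
Implicit Types (a b c : 'I_n).

(** The lower order part of [d_b d_c (ln (det h)) = d_b (h^{pq} d_c h_{pq})]. *)
Definition hessian_rest b c (h : 'rV[R]_n -> 'M[R]_n) x :=
  \sum_p \sum_q pd_ginv_jet b p q h x * part c (entry h p q) x.

Lemma jet1_hessian_rest b c : jet1_poly (hessian_rest b c).
Proof.
apply: jet1_sum => p; apply: jet1_sum => q.
by apply: jet1M; [exact: jet1_pd_ginv|exact: jet1_part].
Qed.

Variable dM : 'I_n -> 'I_n -> 'I_n -> ('rV[R]_n -> 'M[R]_n) -> 'rV[R]_n -> R.

Definition trace_rest a b c (h : 'rV[R]_n -> 'M[R]_n) x :=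
  \sum_p \sum_q pd_ginv_jet a p q h x * part b (part c (entry h p q)) x.

(** The lower order part of [d_a d_b d_c (ln (det h))], with [dM] the derivative of
    [hessian_rest]. *)
Definition logdet_rest a b c (h : 'rV[R]_n -> 'M[R]_n) x :=
  trace_rest a b c h x + dM a b c h x.

Lemma jet2_trace_rest a b c : jet2_poly (trace_rest a b c).
Proof.
apply: jet2_sum => p; apply: jet2_sum => q.
by apply: jet2M; [exact: jet1_jet2 (jet1_pd_ginv _ _ _ _)|exact: jet2_part2].
Qed.

Variables (U : set 'rV[R]_n) (g : 'rV[R]_n -> 'M[R]_n).
Local Notation G := (ginvl g).
Hypothesis oU : open U.
Hypothesis gdet1 : forall x, U x -> \det (g x) = 1.
Hypothesis gsym : forall x, U x -> (g x)^T = g x.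
Hypothesis gC2 : forall a b, Ck 2 U (entry g a b).
Hypothesis dM_jet2 : forall a b c, jet2_poly (dM a b c).
Hypothesis dME : forall a b c U h x, nondegenerate_C2 U h -> U x ->
  has_pd a (hessian_rest b c h) x (dM a b c h x).

Let gdet := unimodular_det gdet1.
Let nd := nondegenerate_normalized oU gdet1 gC2.
Let gC1 a b : Ck 1 U (entry g a b) := CkW (leqnSn 1) (gC2 a b).
Let GC1 a b : Ck 1 U (G a b) := Ck_ginv a b oU gdet gC1.

Lemma hessian_logdet b c x : U x ->
  \sum_p \sum_q G p q x * part b (part c (entry g p q)) x + hessian_rest b c g x = 0.
Proof.
by move=> Ux; rewrite (contr_part2 oU gdet1 gsym gC2 b c Ux) addrC subrr.
Qed.

Lemma logdet_pointwise a b c x : (forall p q, Ck 3 U (entry g p q)) -> U x ->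
  \sum_p \sum_q G p q x * part a (part b (part c (entry g p q))) x +
  logdet_rest a b c g x = 0.
Proof.
move=> gC3 Ux.
have ddC1 p q : Ck 1 U (part b (part c (entry g p q))) := Ck_pd b (Ck_pd c (gC3 p q)).
have tC1 p q : Ck 1 U (fun y => G p q y * part b (part c (entry g p q)) y).
  exact (CkM oU (GC1 p q) (ddC1 p q)).
have sC1 : Ck 1 U (fun y => \sum_p \sum_q G p q y * part b (part c (entry g p q)) y).
  exact (Ck_sum _ oU (fun p _ => Ck_sum _ oU (fun q _ => tC1 p q))).
have mC1 : Ck 1 U (hessian_rest b c g) := jet1_C1 (jet1_hessian_rest b c) nd.
transitivity (part a (fun y => \sum_p \sum_q G p q y * part b (part c (entry g p q)) y +
  hessian_rest b c g y) x); last by rewrite (pd_eq a oU Ux (hessian_logdet b c)) pd_cst.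
rewrite (pd_add a sC1 mC1 Ux) (pdE (dME a b c nd Ux)).
rewrite (pd_sum _ a (fun p => Ck_sum _ oU (fun q _ => tC1 p q)) Ux).
rewrite /logdet_rest /trace_rest addrA; congr (_ + _); rewrite -big_split.
apply: eq_bigr => p _; rewrite (pd_sum _ a (fun q => tC1 p q) Ux) -big_split.
apply: eq_bigr => q _ /=.
by rewrite (pd_mul a (GC1 p q) (ddC1 p q) Ux) (pd_ginv_jetE oU gdet1 gC2)// addrC.
Qed.

(** Only [d_a] is moved to the test function: [hessian_logdet] holds pointwise for metrics of class
    [C^2] and is paired with [d_a phi]. *)
Lemma logdet_distribution a b c phi : test_function U phi ->
  \sum_p \sum_q - integral_rV (fun x => part b (part c (entry g p q)) x *
    part a (fun y => G p q y * phi y) x) +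
  dfun (logdet_rest a b c g) phi = 0.
Proof.
move=> tphi; have phiC2 : Ck 2 U phi := test_function_Ck (k:=2) tphi.
have phiC1 : Ck 1 U phi := CkW (leqnSn 1) phiC2.
have sphi := test_function_csupp tphi.
have CcF F : Ck 0 U F -> Cc U (fun x => F x * phi x).
  by move=> hF; apply: CcM => //; split => //; exact: CkW phiC1.
have ccd : Cc U (part a phi) by split; [exact: (@Ck_pd _ _ 0)|exact: csupp_pd].
have GpC1 p q : Ck 1 U (fun y => G p q y * phi y) := CkM oU (GC1 p q) phiC1.
have sGp p q : csupp U (fun y => G p q y * phi y) by exact: csuppM.
have cc p q : Cc U (part a (fun y => G p q y * phi y)).
  by split; [exact: (@Ck_pd _ _ 0)|exact: csupp_pd].
have ddC0 p q : Ck 0 U (part b (part c (entry g p q))) := Ck_pd b (Ck_pd c (gC2 p q)).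
have tc p q := CcM oU (ddC0 p q) (cc p q).
have c1 := CcF _ (jet2_C0 (jet2_trace_rest a b c) nd).
have c2 := CcF _ (jet2_C0 (dM_jet2 a b c) nd).
have mC1 : Ck 1 U (hessian_rest b c g) := jet1_C1 (jet1_hessian_rest b c) nd.
have c3 := CcM oU (CkW (leq0n 1) mC1) ccd.
have -> : dfun (logdet_rest a b c g) phi =
    integral_rV (fun x => trace_rest a b c g x * phi x) +
    integral_rV (fun x => dM a b c g x * phi x).
  rewrite -(Cc_intD oU c1 c2) /dfun; congr integral_rV; rewrite funeqE => x.
  by rewrite /logdet_rest mulrDl.
have -> : integral_rV (fun x => dM a b c g x * phi x) =
    - integral_rV (fun x => hessian_rest b c g x * part a phi x).
  rewrite -(int_by_parts oU a mC1 phiC1 sphi).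
  apply: (Cc_int_eq (U := U)) => [x Ux||]; [|exact: csuppM|exact: csuppM].
  by rewrite (pdE (dME a b c nd Ux)).
under eq_bigr do rewrite sumrN.
rewrite sumrN -(Cc_int_sum2 oU tc) -(Cc_intB oU c1 c3) addrC; apply/eqP.
rewrite subr_eq0; apply/eqP; apply: (Cc_int_eq (U := U)) => [x Ux||].
- have -> : hessian_rest b c g x = - \sum_p \sum_q G p q x * part b (part c (entry g p q)) x.
    by apply/eqP; rewrite -addr_eq0 addrC hessian_logdet.
  rewrite mulNr opprK !big_distrl -big_split; apply: eq_bigr => p _ /=.
  rewrite !big_distrl -big_split; apply: eq_bigr => q _ /=.
  rewrite (pd_mul a (GC1 p q) phiC1 Ux) (pd_ginv_jetE oU gdet1 gC2)//; ring.
- by have [] := CcB oU c1 c3.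
- apply: csupp_sum => p; apply: csupp_sum => q; by case: (tc p q).
Qed.

End LogDet.

(** * Leading coefficients of the operator *)

Section Operator.
Variables (R : realType) (n : nat).
Implicit Types (a b c d e f p q : 'I_n).

(** The coefficients of the third order terms in the formula for the Cotton tensor, plus those of
    [d_a d_b d_c (ln (det h))]. The latter expression vanishes on normalized metrics, but its
    linearization in general directions does not. *)
Definition lead_cotton a b c d e f p q (G : 'I_n -> 'I_n -> R) : R :=
  - (2 * (n%:R - 2))^-1 * ((f == a)%:R * (p == b)%:R * (q == c)%:R -
    (f == b)%:R * (p == a)%:R * (q == c)%:R) * G d e +
  (d == a)%:R * (e == b)%:R * (f == c)%:R * G p q.

(** [X] and [Y] stay abstract because the same sum occurs with derivatives, with integrals against a
    test function, and with the cubic form of the symbol. *)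
Lemma sum_lead a b c (X Y : 'I_n -> 'I_n -> 'I_n -> 'I_n -> 'I_n -> R) :
  \sum_d \sum_e \sum_f \sum_p \sum_q
    (- (2 * (n%:R - 2))^-1 * ((f == a)%:R * (p == b)%:R * (q == c)%:R -
      (f == b)%:R * (p == a)%:R * (q == c)%:R) * X d e f p q +
     (d == a)%:R * (e == b)%:R * (f == c)%:R * Y d e f p q) =
  - (2 * (n%:R - 2))^-1 * (\sum_d \sum_e (X d e a b c - X d e b a c)) +
  \sum_p \sum_q Y a b c p q.
Proof.
set k := - _^-1.
have EX d e f p q : k * ((f == a)%:R * (p == b)%:R * (q == c)%:R -
      (f == b)%:R * (p == a)%:R * (q == c)%:R) * X d e f p q +
     (d == a)%:R * (e == b)%:R * (f == c)%:R * Y d e f p q =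
    (f == a)%:R * ((p == b)%:R * ((q == c)%:R * (k * X d e f p q))) -
    (f == b)%:R * ((p == a)%:R * ((q == c)%:R * (k * X d e f p q))) +
    (d == a)%:R * ((e == b)%:R * ((f == c)%:R * Y d e f p q)) by ring.
under eq_bigr => d _ do under eq_bigr => e _ do under eq_bigr => f _ do
  under eq_bigr => p _ do under eq_bigr => q _ do rewrite EX.
have S d e : \sum_f \sum_p \sum_q
    ((f == a)%:R * ((p == b)%:R * ((q == c)%:R * (k * X d e f p q))) -
    (f == b)%:R * ((p == a)%:R * ((q == c)%:R * (k * X d e f p q))) +
    (d == a)%:R * ((e == b)%:R * ((f == c)%:R * Y d e f p q))) =
    k * (X d e a b c - X d e b a c) +
    (d == a)%:R * ((e == b)%:R * \sum_p \sum_q Y d e c p q).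
  under eq_bigr => f _ do under eq_bigr => p _ do
    rewrite big_split sumrB/= -!big_distrr/= !sum_delta.
  under eq_bigr => f _ do rewrite big_split sumrB/= -!big_distrr/= !sum_delta.
  by rewrite big_split sumrB/= -!big_distrr/= !sum_delta mulrBr.
under eq_bigr => d _ do under eq_bigr => e _ do rewrite S.
under eq_bigr => d _ do rewrite big_split/= -!big_distrr/= sum_delta.
by rewrite big_split/= -big_distrr/= sum_delta.
Qed.

Lemma quasilinear_exists (F : 'I_n -> 'I_n -> 'I_n -> ('rV[R]_n -> 'M[R]_n) -> 'rV[R]_n -> R) :
  (forall a b c, jet2_poly (F a b c)) ->
  exists Q : quasilinear3 R n,
    (forall a b c d e f p q h x, lead Q a b c d e f p q (jet1 h x) =
       lead_cotton a b c d e f p q (fun i j => ginvl h i j x)) /\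
    (forall a b c h x, lower Q a b c (jet2 h x) = F a b c h x).
Proof.
move=> hF.
have H (t : 'I_n * 'I_n * 'I_n) : exists L : 'rV[R]_#|{: jet2_index n}| -> R,
    smooth (@jet2_domain R n) L /\ forall h x, L (jet2 h x) = F t.1.1 t.1.2 t.2 h x.
  by have [L h1 h2] := jet2_poly_smooth (hF t.1.1 t.1.2 t.2); exists L.
have [L HL] := choice H.
pose ld a b c d e f p q (v : 'rV[R]_#|{: jet1_index n}|) :=
  lead_cotton a b c d e f p q (fun i j => invmx (jet1_matrix v) i j).
have ld_smooth a b c d e f p q : smooth (@jet1_domain R n) (ld a b c d e f p q).
  apply: (@smooth_sub _ _ [set v | \det (jet1_matrix v) != 0]) => [v|k].
    exact: posdef_det.
  have oW := @jet1_det_open R n.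
  exact (CkD oW (CkZ _ oW (Ck_jet1_ginv R _ _)) (CkZ _ oW (Ck_jet1_ginv R _ _))).
exists (@Quasilinear3 R n ld (fun a b c => L (a, b, c)) ld_smooth
  (fun a b c => (HL (a, b, c)).1)); split=> [a b c d e f p q h x|a b c h x] /=.
  rewrite /ld; congr lead_cotton; rewrite funeqE => i; rewrite funeqE => j.
  by rewrite jet1_matrixE ginvlE.
exact: (HL (a, b, c)).2.
Qed.

Lemma qapplyE (Q : quasilinear3 R n) a b c h x : qapply Q h a b c x =
  \sum_d \sum_e \sum_f \sum_p \sum_q
    lead Q a b c d e f p q (jet1 h x) * part d (part e (part f (entry h p q))) x +
  lower Q a b c (jet2 h x).
Proof. by rewrite part.unlock. Qed.

Lemma dqapplyE (Q : quasilinear3 R n) a b c h phi : dqapply Q h a b c phi =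
  \sum_d \sum_e \sum_f \sum_p \sum_q
    - integral_rV (fun x => part e (part f (entry h p q)) x *
        part d (fun y => lead Q a b c d e f p q (jet1 h y) * phi y) x) +
  integral_rV (fun x => lower Q a b c (jet2 h x) * phi x).
Proof. by rewrite part.unlock. Qed.

End Operator.

Section CottonOperator.
Variables (R : realType) (n : nat) (Q : quasilinear3 R n).
Variables dN dM : 'I_n -> 'I_n -> 'I_n -> ('rV[R]_n -> 'M[R]_n) -> 'rV[R]_n -> R.
Hypothesis leadE : forall a b c d e f p q h x, lead Q a b c d e f p q (jet1 h x) =
  lead_cotton a b c d e f p q (fun i j => ginvl h i j x).

Section Agreement.
Variables (U : set 'rV[R]_n) (g : 'rV[R]_n -> 'M[R]_n).
Local Notation G := (ginvl g).
Local Notation V := (contr_dg g).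
Hypothesis n_ge3 : (3 <= n)%N.
Hypothesis oU : open U.
Hypothesis gdet1 : forall x, U x -> \det (g x) = 1.
Hypothesis gsym : forall x, U x -> (g x)^T = g x.
Hypothesis gC2 : forall a b, Ck 2 U (entry g a b).
Hypothesis V_closed : forall a b x, U x -> part a (V b) x = part b (V a) x.
Hypothesis scalarE : forall x, U x ->
  (n%:R - 2) / (2 * (n%:R - 1)) * scalar_curvature g x =
  \sum_a \sum_b G a b x * part a (V b) x -
  2^-1 * \sum_a \sum_b G a b x * (V a x * V b x).
Hypothesis dN_jet2 : forall a b c, jet2_poly (dN a b c).
Hypothesis dNE : forall a b c U h x, nondegenerate_C2 U h -> U x ->
  has_pd a (schouten_rest b c h) x (dN a b c h x).
Hypothesis dM_jet2 : forall a b c, jet2_poly (dM a b c).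
Hypothesis dME : forall a b c U h x, nondegenerate_C2 U h -> U x ->
  has_pd a (hessian_rest b c h) x (dM a b c h x).
Hypothesis lowerE : forall a b c h x, lower Q a b c (jet2 h x) =
  cotton_rest dN a b c h x + logdet_rest dM a b c h x.

Let gdet := unimodular_det gdet1.
Let nd := nondegenerate_normalized oU gdet1 gC2.
Let gC1 a b : Ck 1 U (entry g a b) := CkW (leqnSn 1) (gC2 a b).
Let GC1 a b : Ck 1 U (G a b) := Ck_ginv a b oU gdet gC1.

Lemma Cotton_qapply a b c x : (forall p q, Ck 3 U (entry g p q)) -> U x ->
  Cotton g a b c x = qapply Q g a b c x.
Proof.
move=> gC3 Ux; rewrite qapplyE lowerE.
rewrite (Cotton_pointwise n_ge3 oU gdet1 gsym gC2 V_closed scalarE dNE a b c gC3 Ux).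
rewrite (third_order_C3 oU gC2 a b c gC3 Ux).
have E d e f p q : lead Q a b c d e f p q (jet1 g x) * part d (part e (part f (entry g p q))) x =
    - (2 * (n%:R - 2))^-1 * ((f == a)%:R * (p == b)%:R * (q == c)%:R -
      (f == b)%:R * (p == a)%:R * (q == c)%:R) *
        (G d e x * part d (part e (part f (entry g p q))) x) +
     (d == a)%:R * (e == b)%:R * (f == c)%:R *
        (G p q x * part d (part e (part f (entry g p q))) x).
  by rewrite leadE /lead_cotton mulrDl !mulrA.
under [X in _ = X + _]eq_bigr => d _ do under eq_bigr => e _ do under eq_bigr => f _ do
  under eq_bigr => p _ do under eq_bigr => q _ do rewrite E.
rewrite (sum_lead a b c (fun d e f p q => G d e x * part d (part e (part f (entry g p q))) x)
  (fun d e f p q => G p q x * part d (part e (part f (entry g p q))) x)).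
have := logdet_pointwise oU gdet1 gsym gC2 dME a b c gC3 Ux.
by move=> H; rewrite addrACA H addr0.
Qed.

Lemma Cotton_dqapply a b c : deq U (dCotton g a b c) (dqapply Q g a b c).
Proof.
move=> phi tphi; rewrite dqapplyE.
have phiC1 : Ck 1 U phi := test_function_Ck (k:=1) tphi.
have sphi := test_function_csupp tphi.
rewrite (Cotton_distribution n_ge3 oU gdet1 gsym gC2 V_closed scalarE dN_jet2 dNE tphi a b c).
have GpC1 p q : Ck 1 U (fun y => G p q y * phi y) := CkM oU (GC1 p q) phiC1.
have sGp p q : csupp U (fun y => G p q y * phi y) by exact: csuppM.
have cc d p q : Cc U (part d (fun y => G p q y * phi y)).
  by split; [exact: (@Ck_pd _ _ 0)|exact: csupp_pd].
have ddC0 p q e f : Ck 0 U (part e (part f (entry g p q))) := Ck_pd e (Ck_pd f (gC2 p q)).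
pose X d e f p q := - integral_rV (fun x => part e (part f (entry g p q)) x *
  part d (fun y => G d e y * phi y) x).
pose Y d e f p q := - integral_rV (fun x => part e (part f (entry g p q)) x *
  part d (fun y => G p q y * phi y) x).
(* [lead] combines entries of the inverse with the constant coefficients [k1] and [k2], so the
   pairing splits accordingly. *)
have E d e f p q : - integral_rV (fun x => part e (part f (entry g p q)) x *
        part d (fun y => lead Q a b c d e f p q (jet1 g y) * phi y) x) =
    - (2 * (n%:R - 2))^-1 * ((f == a)%:R * (p == b)%:R * (q == c)%:R -
      (f == b)%:R * (p == a)%:R * (q == c)%:R) * X d e f p q +
     (d == a)%:R * (e == b)%:R * (f == c)%:R * Y d e f p q.
  set k1 := - _^-1 * _; set k2 := _%:R * _%:R * _%:R.
  have c1 := CcM oU (ddC0 p q e f) (cc d d e).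
  have c2 := CcM oU (ddC0 p q e f) (cc d p q).
  rewrite !mulrN -opprD -(Cc_intZ oU k1 c1) -(Cc_intZ oU k2 c2).
  rewrite -(Cc_intD oU (CcZ oU k1 c1) (CcZ oU k2 c2)).
  have slead : csupp U (fun y => lead Q a b c d e f p q (jet1 g y) * phi y) by exact: csuppM.
  congr (- _); apply: (Cc_int_eq (U := U)) => [x Ux||].
  - have -> : part d (fun y => lead Q a b c d e f p q (jet1 g y) * phi y) x =
        k1 * part d (fun y => G d e y * phi y) x + k2 * part d (fun y => G p q y * phi y) x.
      rewrite -(pd_scale d k1 (GpC1 d e) Ux) -(pd_scale d k2 (GpC1 p q) Ux).
      rewrite -(pd_add d (CkZ k1 oU (GpC1 d e)) (CkZ k2 oU (GpC1 p q)) Ux).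
      apply: (pd_eq d oU Ux) => y Uy.
      by rewrite leadE /lead_cotton -/k1 -/k2 mulrDl -!mulrA.
    by rewrite mulrDr; congr (_ + _); rewrite mulrCA.
  - exact/csuppM/csupp_pd.
  - by have [] := CcD oU (CcZ oU k1 c1) (CcZ oU k2 c2).
under [X in _ = X + _]eq_bigr => d _ do under eq_bigr => e _ do under eq_bigr => f _ do
  under eq_bigr => p _ do under eq_bigr => q _ do rewrite E.
rewrite {E} (sum_lead a b c X Y).
have -> : integral_rV (fun x => lower Q a b c (jet2 g x) * phi x) =
    dfun (cotton_rest dN a b c g) phi + dfun (logdet_rest dM a b c g) phi.
  have cF F : jet2_poly F -> Cc U (fun x => F g x * phi x).
    move=> hF; apply: (CcM oU (jet2_C0 hF nd)); split; last exact: sphi.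
    exact: CkW (leq0n 1) phiC1.
  have r1 := cF _ (jet2_cotton_rest a b c dN_jet2).
  have r2 := cF _ (jet2D (jet2_trace_rest R a b c) (dM_jet2 a b c)).
  rewrite /dfun -(Cc_intD oU r1 r2); congr integral_rV; rewrite funeqE => x.
  by rewrite lowerE mulrDl.
have := logdet_distribution oU gdet1 gsym gC2 dM_jet2 dME a b c tphi.
rewrite -/(Y _ _ _ _ _) => H.
rewrite addrACA [X in _ = _ + X]H addr0 (dthird_orderP oU gdet1 gC2 tphi a b c).
congr (_ * _ + _); rewrite /third_pairing -sumrB -sumrN; apply: eq_bigr => d _.
by rewrite -sumrB -sumrN; apply: eq_bigr => e _; rewrite /X opprB opprK addrC.
Qed.

End Agreement.

(** * The principal symbol *)

Section Symbol.
Variables (U : set 'rV[R]_n) (h : 'rV[R]_n -> 'M[R]_n).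
Hypothesis oU : open U.
Hypothesis hC3 : forall a b, Ck 3 U (entry h a b).
Variables (x xi : 'rV[R]_n) (k : 'M[R]_n).
Hypothesis Ux : U x.

Definition linear_form (y : 'rV[R]_n) : R := ((y - x) *m xi^T) 0 0.

(** A perturbation whose 2-jet vanishes at [x], while its third derivatives there are
    [6 xi_d xi_e xi_f k_{pq}]. *)
Definition cubic (y : 'rV[R]_n) : 'M[R]_n := (linear_form y) ^+ 3 *: k.

Lemma has_pd_linear_form i y : has_pd i linear_form y (xi 0 i).
Proof.
have -> : linear_form = fun y => \sum_j (y 0 j - x 0 j) * xi 0 j.
  by rewrite funeqE => z; rewrite /linear_form mxE; apply: eq_bigr => j _; rewrite !mxE.
have H j : has_pd i (fun y => (y 0 j - x 0 j) * xi 0 j) y ((i == j)%:R * xi 0 j).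
  apply: (has_pd_eq (has_pdM (has_pdB (has_pd_coord i j y) (has_pd_cst i (x 0 j) y))
    (has_pd_cst i (xi 0 j) y))).
  by rewrite subr0 mulr0 addr0.
have := @has_pd_sum R n 'I_n (index_enum 'I_n) xpredT i _ y _ (fun j _ => H j).
by move=> /has_pd_eq; apply; exact: sum_deltaC.
Qed.

Lemma linear_form0 : linear_form x = 0.
Proof. by rewrite /linear_form subrr mul0mx mxE. Qed.

Variable t : R.
Local Notation ht := (fun y => h y + t *: cubic y).

Lemma entry_perturb p q y :
  entry ht p q y = entry h p q y + t * k p q * (linear_form y * (linear_form y * linear_form y)).
Proof. by rewrite !entryE !mxE; ring. Qed.

Lemma part_perturb f p q y : U y -> part f (entry ht p q) y =
  part f (entry h p q) y + t * k p q * (3 * (linear_form y * linear_form y) * xi 0 f).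
Proof.
move=> Uy; rewrite (pd_eq f oU Uy (fun y _ => entry_perturb p q y)).
have hl := has_pd_linear_form f y.
rewrite (pdE (has_pdD (Ck_has_pd f (CkW (leq_addl 2 1) (hC3 p q)) Uy)
  (has_pdZ (t * k p q) (has_pdM hl (has_pdM hl hl))))).
ring.
Qed.

Lemma part2_perturb e f p q y : U y -> part e (part f (entry ht p q)) y =
  part e (part f (entry h p q)) y + t * k p q * (6 * linear_form y * xi 0 e * xi 0 f).
Proof.
move=> Uy; rewrite (pd_eq e oU Uy (part_perturb f p q)).
have hl := has_pd_linear_form e y.
have h2 : Ck 1 U (part f (entry h p q)) := CkW (leqnSn 1) (Ck_pd f (hC3 p q)).
have h3 := has_pdM (has_pdZ 3 (has_pdM hl hl)) (has_pd_cst e (xi 0 f) y).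
rewrite (pdE (has_pdD (Ck_has_pd e h2 Uy) (has_pdZ (t * k p q) h3))).
ring.
Qed.

Lemma part3_perturb d e f p q : part d (part e (part f (entry ht p q))) x =
  part d (part e (part f (entry h p q))) x + t * (6 * xi 0 d * xi 0 e * xi 0 f * k p q).
Proof.
rewrite (pd_eq d oU Ux (part2_perturb e f p q)).
have hl := has_pd_linear_form d x.
have h2 : Ck 1 U (part e (part f (entry h p q))) := Ck_pd e (Ck_pd f (hC3 p q)).
have h3 := has_pdM (has_pdM (has_pdZ 6 hl) (has_pd_cst d (xi 0 e) x)) (has_pd_cst d (xi 0 f) x).
rewrite (pdE (has_pdD (Ck_has_pd d h2 Ux) (has_pdZ (t * k p q) h3))).
ring.
Qed.

Lemma jet1_perturb : jet1 ht x = jet1 h x.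
Proof.
apply/rowP => i; rewrite [LHS]mxE [RHS]mxE; case: (enum_val i) => [[a b]|[[c a] b]] /=.
  by have := entry_perturb a b x; rewrite !entryE linear_form0 !mul0r mulr0 addr0.
have := part_perturb c a b Ux.
by rewrite linear_form0 !mulr0 mul0r mulr0 addr0 part.unlock.
Qed.

Lemma jet2_perturb : jet2 ht x = jet2 h x.
Proof.
apply/rowP => i; rewrite [LHS]mxE [RHS]mxE; case: (enum_val i) => [j|[[[d c] a] b]].
  have := congr1 (fun v : 'rV_#|{: jet1_index n}| => v 0 (enum_rank j)) jet1_perturb.
  by rewrite !mxE enum_rankK.
have := part2_perturb d c a b Ux.
by rewrite linear_form0 !mulr0 !mul0r mulr0 addr0 /= part.unlock.
Qed.

(** The coefficients and the lower order part depend only on the 2-jet at [x], which does not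
    change; hence the value of [Q] at [x] is affine in [t]. *)
Lemma qapply_perturb a b c : qapply Q ht a b c x = qapply Q h a b c x +
  t * (6 * \sum_d \sum_e \sum_f \sum_p \sum_q
    lead Q a b c d e f p q (jet1 h x) * (xi 0 d * xi 0 e * xi 0 f * k p q)).
Proof.
rewrite !qapplyE jet1_perturb jet2_perturb [RHS]addrAC; congr (_ + _).
rewrite mulrA !big_distrr -big_split; apply: eq_bigr => d _ /=.
rewrite !big_distrr -big_split; apply: eq_bigr => e _ /=.
rewrite !big_distrr -big_split; apply: eq_bigr => f _ /=.
rewrite !big_distrr -big_split; apply: eq_bigr => p _ /=.
rewrite !big_distrr -big_split; apply: eq_bigr => q _ /=.
by rewrite part3_perturb; ring.
Qed.

End Symbol.

Lemma principal_symbolE U h x xi k a b c : open U -> (forall a b, Ck 3 U (entry h a b)) ->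
  U x -> principal_symbol Q h x xi k a b c =
  - (2 * (n%:R - 2))^-1 * ((\sum_d \sum_e ginvl h d e x * (xi 0 d * xi 0 e)) *
      (xi 0 a * k b c - xi 0 b * k a c)) +
  xi 0 a * xi 0 b * xi 0 c * \sum_p \sum_q ginvl h p q x * k p q.
Proof.
move=> oU hC3 Ux; rewrite /principal_symbol /linearization.
pose B := 6 * \sum_d \sum_e \sum_f \sum_p \sum_q
    lead Q a b c d e f p q (jet1 h x) * (xi 0 d * xi 0 e * xi 0 f * k p q).
have -> : (fun t => qapply Q (fun y => h y + t *: (((y - x) *m xi^T) 0 0 ^+ 3 *: k)) a b c x) =
    (fun t => qapply Q h a b c x + t * B).
  by rewrite funeqE => t; exact: (qapply_perturb oU hC3 xi k Ux t a b c).
have -> : derive1 (fun t => qapply Q h a b c x + t * B) 0 = B.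
  rewrite derive1E.
  have H : is_derive (0 : R) (1 : R) (cst (qapply Q h a b c x) + (fun t : R => t * B)) (0 + B).
    apply: is_deriveD.
    have := @is_deriveM R R id (cst B) 0 1 1 0 (is_derive_id _ _) (is_derive_cst _ _ _).
    by rewrite /GRing.scale/= mul0r add0r mulr1.
  by have [_] := H; rewrite add0r.
(* The [6] from the third derivative of the cube cancels the [3!] of the symbol. *)
rewrite /B mulrA (_ : (3`!)%:R^-1 * 6 = 1) ?mul1r; last by rewrite /= mulVf// pnatr_eq0.
have E d e f p q : lead Q a b c d e f p q (jet1 h x) * (xi 0 d * xi 0 e * xi 0 f * k p q) =
    - (2 * (n%:R - 2))^-1 * ((f == a)%:R * (p == b)%:R * (q == c)%:R -
      (f == b)%:R * (p == a)%:R * (q == c)%:R) *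
        (ginvl h d e x * (xi 0 d * xi 0 e * xi 0 f * k p q)) +
     (d == a)%:R * (e == b)%:R * (f == c)%:R *
        (ginvl h p q x * (xi 0 d * xi 0 e * xi 0 f * k p q)).
  by rewrite leadE /lead_cotton mulrDl !mulrA.
under eq_bigr => d _ do under eq_bigr => e _ do under eq_bigr => f _ do
  under eq_bigr => p _ do under eq_bigr => q _ do rewrite E.
rewrite (sum_lead a b c (fun d e f p q => ginvl h d e x * (xi 0 d * xi 0 e * xi 0 f * k p q))
  (fun d e f p q => ginvl h p q x * (xi 0 d * xi 0 e * xi 0 f * k p q))).
congr (_ * _ + _).
  rewrite big_distrl; apply: eq_bigr => d _ /=; rewrite big_distrl; apply: eq_bigr => e _ /=.
  ring.
rewrite big_distrr; apply: eq_bigr => p _ /=; rewrite big_distrr; apply: eq_bigr => q _ /=.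
ring.
Qed.

(** With [y = xi H^-1] the sum is [y H y^T]. *)
Lemma ginv_posdef (H : 'M[R]_n) (xi : 'rV[R]_n) : H^T = H -> posdef H -> xi != 0 ->
  0 < \sum_d \sum_e invmx H d e * (xi 0 d * xi 0 e).
Proof.
move=> sH pH xi0; have uH : H \in unitmx by rewrite unitmxE unitfE posdef_det.
pose y := xi *m invmx H.
have y0 : y != 0.
  by apply: contraNneq xi0 => y0; rewrite -(mulmxKV uH xi) -/y y0 mul0mx.
have := pH y y0; rewrite /y mulmxKV// trmx_mul trmx_inv sH mulmxA mxE.
congr (0 < _).
under [RHS]eq_bigr do under eq_bigr do rewrite mulrC -mulrA.
rewrite exchange_big; apply: eq_bigr => e _ /=.
rewrite !mxE big_distrl; apply: eq_bigr => d _ /=.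
ring.
Qed.

(** The first part is antisymmetric and the second symmetric in [a], [b], so both vanish. The first
    forces [w] to be a multiple of the tensor square of [xi], the second makes its [G]-trace zero,
    and [s = G (xi, xi)] is nonzero. *)
Lemma symbol_kernel (xi : 'rV[R]_n) (w G : 'M[R]_n) (al s : R) : w^T = w -> xi != 0 ->
  al != 0 -> s != 0 -> s = \sum_d \sum_e G d e * (xi 0 d * xi 0 e) ->
  (forall a b c, al * (s * (xi 0 a * w b c - xi 0 b * w a c)) +
     xi 0 a * xi 0 b * xi 0 c * (\sum_p \sum_q G p q * w p q) = 0) -> w = 0.
Proof.
move=> sw xi0 al0 s0 sE H.
have wsym a b : w a b = w b a by rewrite -{1}sw mxE.
have [i xii] : exists i, xi 0 i != 0.
  apply/existsP; move: xi0; apply: contraR; rewrite negb_exists => /forallP xi0.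
  by apply/eqP/rowP => i; rewrite mxE; apply/eqP; have := xi0 i; rewrite negbK.
have anti a b c : xi 0 a * w b c = xi 0 b * w a c.
  have := H a b c; have := H b a c.
  set T := \sum_p _ => h1 h2.
  have : 2 * (al * s) * (xi 0 a * w b c - xi 0 b * w a c) = 0.
    rewrite -[RHS](subrr (0 : R)) -{1}h2 -h1; ring.
  move=> /eqP; rewrite !mulf_eq0 (negbTE al0) (negbTE s0) pnatr_eq0 /= subr_eq0.
  by move=> /eqP.
have tr0 : \sum_p \sum_q G p q * w p q = 0.
  have := H i i i; rewrite subrr !mulr0 add0r => /eqP; rewrite !mulf_eq0 (negbTE xii) /=.
  by move=> /eqP.
(* Since [xi_i] is nonzero, [w] is [w_{ii} / xi_i^2] times the tensor square of [xi]. *)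
have wE b c : xi 0 i * xi 0 i * w b c = xi 0 b * xi 0 c * w i i.
  by rewrite -mulrA anti mulrCA [w i c]wsym anti mulrA.
have wii : w i i = 0.
  have : s * w i i = 0.
    transitivity (xi 0 i * xi 0 i * \sum_p \sum_q G p q * w p q); last by rewrite tr0 mulr0.
    rewrite sE big_distrl big_distrr; apply: eq_bigr => p _ /=.
    rewrite big_distrl big_distrr; apply: eq_bigr => q _ /=.
    by rewrite [RHS]mulrCA wE; ring.
  by move=> /eqP; rewrite mulf_eq0 (negbTE s0) /= => /eqP.
apply/matrixP => b c; rewrite mxE.
have := wE b c; rewrite wii mulr0 => /eqP; rewrite !mulf_eq0 (negbTE xii) /=.
by move=> /eqP.
Qed.

Lemma lead_coef_neq0 : (3 <= n)%N -> - (2 * (n%:R - 2))^-1 != 0 :> R.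
Proof.
move=> n3; have n2 : n%:R - 2 != 0 :> R by rewrite subr_eq0 (eqr_nat R n 2) gtn_eqF.
by rewrite oppr_eq0 invr_eq0 mulf_neq0// pnatr_eq0.
Qed.

Lemma Cotton_elliptic : (3 <= n)%N -> overdetermined_elliptic Q.
Proof.
move=> n3 U h oU hC3 hpos x xi Ux xi0 k k' sk sk' E.
have [sh ph] := hpos x Ux.
apply/eqP; rewrite -subr_eq0; apply/eqP.
have s0 := ginv_posdef sh ph xi0.
apply: (@symbol_kernel xi (k - k') (invmx (h x)) (- (2 * (n%:R - 2))^-1) _ _ xi0 _ _ erefl).
- by rewrite linearB /= sk sk'.
- exact: lead_coef_neq0.
- by rewrite gt_eqF.
move=> a b c; have := congr1 (fun F => F a b c) E.
rewrite !(principal_symbolE _ _ _ _ _ oU hC3 Ux).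
have tE (w : 'M[R]_n) : \sum_p \sum_q ginvl h p q x * w p q =
    \sum_p \sum_q invmx (h x) p q * w p q.
  by apply: eq_bigr => p _; apply: eq_bigr => q _; rewrite ginvlE.
have sE : \sum_d \sum_e ginvl h d e x * (xi 0 d * xi 0 e) =
    \sum_d \sum_e invmx (h x) d e * (xi 0 d * xi 0 e).
  by apply: eq_bigr => p _; apply: eq_bigr => q _; rewrite ginvlE.
rewrite !tE sE.
have -> : \sum_p \sum_q invmx (h x) p q * (k - k') p q =
    \sum_p \sum_q invmx (h x) p q * k p q - \sum_p \sum_q invmx (h x) p q * k' p q.
  rewrite -sumrB; apply: eq_bigr => p _; rewrite -sumrB; apply: eq_bigr => q _.
  by rewrite !mxE mulrBr.
rewrite !mxE => /eqP; rewrite -subr_eq0 => /eqP {}E; rewrite -[RHS]E; ring.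
Qed.

End CottonOperator.

(** * Conformal harmonic coordinates *)

Section PositiveDeterminant.
Variables (R : realType) (n : nat).
Implicit Types H : 'M[R]_n.

Lemma posdef1 : posdef (1%:M : 'M[R]_n).
Proof.
move=> y y0; rewrite mulmx1 mxE lt0r sumr_ge0 ?andbT => [|i _]; last first.
  by rewrite mxE -expr2 sqr_ge0.
apply: contra y0 => /eqP E; apply/eqP/rowP => i; rewrite [RHS]mxE.
have h0 (j : 'I_n) : true -> 0 <= y 0 j * y^T j 0 by rewrite mxE -expr2 sqr_ge0.
have /eqP := psumr_eq0P h0 E (i := i) isT.
by rewrite mxE mulf_eq0 orbb => /eqP.
Qed.

Lemma posdef_segment H (t : R) : posdef H -> 0 <= t <= 1 ->
  posdef (H + t *: (1%:M - H)).
Proof.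
move=> pH /andP[t0 t1] y y0.
have -> : H + t *: (1%:M - H) = (1 - t) *: H + t *: 1%:M.
  by rewrite scalerBr scalerBl scale1r addrCA addrC.
rewrite mulmxDr mulmxDl mxE -!scalemxAr -!scalemxAl [X in X + _]mxE [X in _ + X]mxE.
have h1 := pH y y0; have h2 := posdef1 y0.
have [->|tn] := eqVneq t 1; first by rewrite subrr mul0r add0r mul1r.
apply: ltr_wpDr; first by rewrite mulr_ge0// ltW.
by rewrite mulr_gt0// subr_gt0 lt_neqAle tn.
Qed.

(* The determinant does not vanish on the segment from [H] to the identity. *)
Lemma det_posdef_gt0 H : posdef H -> 0 < \det H.
Proof.
move=> pH; rewrite ltNge; apply/negP => H0.
pose p := \det (map_mx polyC H + 'X *: map_mx polyC (1%:M - H)).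
have pE t : p.[t] = \det (H + t *: (1%:M - H)).
  rewrite -[p.[t]]/(horner_eval t p) -det_map_mx; congr (\det _).
  by apply/matrixP => i j; rewrite !mxE /= /horner_eval !hornerE.
have [|t t01 /rootP] := @poly_ivt _ p 0 1 ler01.
  rewrite !pE scale0r addr0 scale1r addrC subrK det1 H0 ler01//.
by rewrite pE => /eqP; apply/negP; exact: posdef_det (posdef_segment pH t01).
Qed.

End PositiveDeterminant.

Section Regularity.
Variables (R : realType) (n : nat) (U : set 'rV[R]_n).

Lemma truncn_nat (m : nat) : Num.truncn (m%:R : R) = m.
Proof. by apply: truncn_def; rewrite lexx ltr_nat ltnSn. Qed.

(** For an integral exponent the Hoelder clause is vacuous. *)
Lemma Cr_nat m f : Cr (m%:R : R) U f <-> Ck m U f.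
Proof.
by rewrite /Cr truncn_nat; split=> [[]//|fC]; split=> //; rewrite ltxx.
Qed.

End Regularity.

Section Coordinates.
Variables (R : realType) (n : nat) (M : topologicalType) (A : smooth_manifold R n M).

Lemma coordinates_nat (m k : nat) c : (m <= k)%N ->
  coordinates (k%:R : R) A c -> coordinates (m%:R : R) A c.
Proof.
move=> mk [hc Ac]; split=> // c' Ac' j; have [/Cr_nat h1 /Cr_nat h2] := Ac c' Ac' j.
by split; apply/Cr_nat; apply: CkW mk _.
Qed.

End Coordinates.

(** [f^k] and [x^k f] agree only on the range of the chart; locality allows exchanging them
    there. *)
Lemma conformal_Laplacian_local (R : realType) (n : nat) (U : set 'rV[R]_n) h u w x :
  open U -> (forall y, U y -> u y = w y) -> U x ->
  conformal_Laplacian h u x = conformal_Laplacian h w x.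
Proof.
move=> oU uw Ux; rewrite /conformal_Laplacian !LaplacianE uw//; congr (_ * _ + _).
apply: eq_bigr => a _; apply: (pd_eq _ oU Ux) => y Uy.
by apply: eq_bigr => b _; congr (_ * _); exact: (pd_eq _ oU Uy).
Qed.

(** * The normalized metric as a conformal multiple *)

Section DetNormalized.
Variables (R : realType) (n : nat) (U : set 'rV[R]_n) (h : 'rV[R]_n -> 'M[R]_n).
Hypothesis n_gt0 : (0 < n)%N.
Hypothesis oU : open U.
Hypothesis hC2 : forall a b, Ck 2 U (entry h a b).
Hypothesis hpos : forall x, U x -> posdef (h x).
Local Notation gh := (det_normalized h).

(** The exponent [s] with [h = e^(2s) det_normalized h]; taking determinants gives the factor
    [1 / (2 n)]. *)
Definition log_factor (x : 'rV[R]_n) : R := (2 * n%:R)^-1 * ln (\det (h x)).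

Lemma log_factor_C2 : Ck 2 U log_factor.
Proof.
have hdet : forall x, U x -> 0 < \det (h x) by move=> x /hpos/det_posdef_gt0.
exact (CkZ _ oU (Ck_ln oU hdet (Ck_det oU hC2))).
Qed.

Lemma det_normalizedE x : U x -> gh x = expR (- (2 * log_factor x)) *: h x.
Proof.
move=> /hpos/det_posdef_gt0 d0; rewrite /det_normalized /powR gt_eqF//.
congr (expR _ *: _); rewrite /log_factor invfM !mulrA mulfV ?pnatr_eq0// mul1r mulNr//.
Qed.

Lemma det_normalizedK x : U x -> h x = expR (2 * log_factor x) *: gh x.
Proof. by move=> Ux; rewrite det_normalizedE// scalerA -expRD subrr expR0 scale1r. Qed.

Lemma det_det_normalized x : U x -> \det (gh x) = 1.
Proof.
move=> Ux; have d0 := det_posdef_gt0 (hpos Ux); have n0 : n%:R != 0 :> R by rewrite pnatr_eq0 -lt0n.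
rewrite det_normalizedE// detZ -expRM_natl.
have -> : n%:R * - (2 * log_factor x) = - ln (\det (h x)).
  by rewrite /log_factor invfM; field.
by rewrite expRN lnK// mulVf// gt_eqF.
Qed.

Lemma entry_det_normalized_C2 a b : Ck 2 U (entry gh a b).
Proof.
refine (Ck_eq oU (fun x Ux => _) (CkM oU (Ck_exp oU (CkN oU (CkZ 2 oU log_factor_C2))) (hC2 a b))).
by rewrite /entry det_normalizedE// mxE.
Qed.

End DetNormalized.

Section ConformalHarmonic.
Variables (R : realType) (n : nat) (M : topologicalType) (A : smooth_manifold R n M).
Variables (r : R) (g : metric A r) (Z : chart R n M).
Hypothesis n_ge3 : (3 <= n)%N.
Hypothesis r_gt2 : 2 < r.
Hypothesis Zharm : conformal_harmonic g Z.
Local Notation U := (rng Z).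
Local Notation h := (gcomp g Z).
Local Notation gh := (det_normalized h).

Lemma rng_open : open U.
Proof. by case: Zharm => -[[]]. Qed.

Lemma gcomp_C2 a b : Ck 2 U (entry h a b).
Proof.
(* [metric_Cr] is used at [s = 2], where [s + 1] is the class 3 of the coordinates. *)
have [hZ _] := Zharm; apply/Cr_nat; apply: metric_Cr; first by rewrite (ltW r_gt2) ler1n.
by rewrite natr1.
Qed.

Lemma gcomp_sym_posdef x : U x -> (h x)^T = h x /\ posdef (h x).
Proof.
have [hZ _] := Zharm; apply: metric_posdef.
exact: (@coordinates_nat _ _ _ _ 2 3).
Qed.

Let n_gt0 : (0 < n)%N := ltn_trans (ltn0Sn 1) n_ge3.
Let hpos x (Ux : U x) : posdef (h x) := (gcomp_sym_posdef Ux).2.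
Let oU := rng_open.

Lemma gh_C2 a b : Ck 2 U (entry gh a b).
Proof. exact: entry_det_normalized_C2 oU gcomp_C2 hpos a b. Qed.

Lemma gh_det x : U x -> \det (gh x) = 1.
Proof. exact: det_det_normalized. Qed.

Lemma gh_sym x : U x -> (gh x)^T = gh x.
Proof. by move=> Ux; rewrite linearZ /= (gcomp_sym_posdef Ux).1. Qed.

(** In its own coordinates [Z^k] is the function [x^k], so [Z^k = f^k / f] reads [f^k = x^k u] with
    [u = f]. *)
Lemma harmonic_factor : exists u : 'rV[R]_n -> R,
  [/\ Ck 2 U u, forall x, U x -> 0 < u x,
      forall x, U x -> conformal_Laplacian h u x = 0 &
      forall k x, U x -> conformal_Laplacian h (fun y => y 0 k * u y) x = 0].
Proof.
have [[[_ _ ptK _ _] _] [fk [f [[_ fC2] f0 cooE fL]]]] := Zharm.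
exists (f \o pt Z); split=> //.
- by move=> _ [p Zp <-]; rewrite /= ptK// f0.
- by move=> x Ux; exact: (fL x Ux).2.
move=> k x Ux; rewrite -((fL x Ux).1 k).
apply: (conformal_Laplacian_local _ oU _ Ux) => _ [p Zp <-].
by rewrite /= ptK// cooE// divfK// gt_eqF// f0.
Qed.

Lemma gh_potential : exists v : 'rV[R]_n -> R, [/\ Ck 2 U v,
  forall a x, U x -> contr_dg gh a x = part a v x &
  forall x, U x -> (n%:R - 2) / (2 * (n%:R - 1)) * scalar_curvature gh x =
    \sum_a \sum_b ginvl gh a b x * part a (part b v) x -
    2^-1 * \sum_a \sum_b ginvl gh a b x * (contr_dg gh a x * contr_dg gh b x)].
Proof.
have [u [uC2 u_gt0 uL xuL]] := harmonic_factor.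
have sC2 := log_factor_C2 oU gcomp_C2 hpos.
have hE x (Ux : U x) := det_normalizedK hpos Ux.
exists (potential (log_factor h) u); split.
- exact: potential_C2.
- move=> a x Ux.
  exact: (contr_dg_potential oU gh_det gh_sym gh_C2 sC2 hE uC2 u_gt0 uL xuL).
- move=> x Ux.
  exact: (scalar_curvature_potential oU gh_det gh_sym gh_C2 sC2 hE uC2 u_gt0 uL xuL (ltnW n_ge3)).
Qed.

Lemma contr_dg_closed a b x : U x ->
  part a (contr_dg gh b) x = part b (contr_dg gh a) x.
Proof.
have [v [vC2 vE _]] := gh_potential => Ux.
rewrite (pd_eq a oU Ux (vE b)) (pd_eq b oU Ux (vE a)).
exact: schwarz oU vC2 Ux.
Qed.

Lemma scalar_curvature_contr_dg x : U x ->
  (n%:R - 2) / (2 * (n%:R - 1)) * scalar_curvature gh x =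
  \sum_a \sum_b ginvl gh a b x * part a (contr_dg gh b) x -
  2^-1 * \sum_a \sum_b ginvl gh a b x * (contr_dg gh a x * contr_dg gh b x).
Proof.
have [v [_ vE RE]] := gh_potential => Ux; rewrite RE//; congr (_ - _).
apply: eq_bigr => a _; apply: eq_bigr => b _; congr (_ * _).
by rewrite (pd_eq a oU Ux (vE b)).
Qed.

End ConformalHarmonic.

Theorem proposition3p6 (R : realType) (n : nat) (hn : (3 <= n)%N) :
  (exists T : 'I_n -> 'I_n -> 'I_n -> jet_poly R n,
     forall (M : topologicalType) (A : smooth_manifold R n M) (r : R)
       (g : metric A r) (Z : chart R n M),
     2 < r -> conformal_harmonic g Z ->
     let gh := det_normalized (gcomp g Z) in
     forall a b c : 'I_n,
     deq (rng Z) (dCotton gh a b c)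
       (fun phi => - (2 * (n%:R - 2))^-1 * dthird_order gh a b c phi +
                   dfun (jet_poly_at (T a b c) gh) phi) /\
     ((forall p q, Ck 3 (rng Z) (entry gh p q)) ->
      forall x, rng Z x ->
        Cotton gh a b c x =
          - (2 * (n%:R - 2))^-1 * third_order gh a b c x +
          jet_poly_at (T a b c) gh x)) /\
  (exists Q : quasilinear3 R n,
     overdetermined_elliptic Q /\
     forall (M : topologicalType) (A : smooth_manifold R n M) (r : R)
       (g : metric A r) (Z : chart R n M),
     2 < r -> conformal_harmonic g Z ->
     let gh := det_normalized (gcomp g Z) in
     forall a b c : 'I_n,
     deq (rng Z) (dCotton gh a b c) (dqapply Q gh a b c) /\
     ((forall p q, Ck 3 (rng Z) (entry gh p q)) ->
      forall x, rng Z x -> Cotton gh a b c x = qapply Q gh a b c x)).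
Proof.
(* The derivatives of the remainders are fixed here, before the manifold and the metric are
   introduced. *)
have [dN HN] := jet1_family (@jet1_schouten_rest R n).
have [dM HM] := jet1_family (@jet1_hessian_rest R n).
have dN_jet2 a b c := (HN a b c).1.
have dNE a b c := (HN a b c).2.
have dM_jet2 a b c := (HM a b c).1.
have dME a b c := (HM a b c).2.
have cotton_jet2 a b c := jet2_cotton_rest a b c dN_jet2.
split.
  have H (t : 'I_n * 'I_n * 'I_n) := cotton_jet2 t.1.1 t.1.2 t.2.
  have [T HT] := choice H.
  exists (fun a b c => T (a, b, c)) => M A r g Z r2 Zh gh a b c.
  have TE : jet_poly_at (T (a, b, c)) gh = cotton_rest dN a b c gh.
    by rewrite funeqE => x; exact: HT.
  rewrite TE; split=> [phi tphi|gC3 x Ux].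
    exact: (Cotton_distribution hn (rng_open Zh) (gh_det hn Zh) (gh_sym Zh) (gh_C2 r2 Zh)
      (contr_dg_closed hn r2 Zh) (scalar_curvature_contr_dg hn r2 Zh) dN_jet2 dNE tphi a b c).
  exact: (Cotton_pointwise hn (rng_open Zh) (gh_det hn Zh) (gh_sym Zh) (gh_C2 r2 Zh)
    (contr_dg_closed hn r2 Zh) (scalar_curvature_contr_dg hn r2 Zh) dNE a b c gC3 Ux).
(* [logdet_rest] completes the logarithmic summand of [lead_cotton] to an expression that vanishes
   on normalized metrics. *)
have [|Q [leadE lowerE]] := @quasilinear_exists R n
  (fun a b c h x => cotton_rest dN a b c h x + logdet_rest dM a b c h x).
  by move=> a b c; apply: jet2D => //; apply: jet2D => //; exact: jet2_trace_rest.
exists Q; split=> [|M A r g Z r2 Zh gh a b c]; first exact: Cotton_elliptic.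
split=> [|gC3 x Ux].
  exact: (Cotton_dqapply leadE hn (rng_open Zh) (gh_det hn Zh) (gh_sym Zh) (gh_C2 r2 Zh)
    (contr_dg_closed hn r2 Zh) (scalar_curvature_contr_dg hn r2 Zh) dN_jet2 dNE dM_jet2 dME lowerE).
exact: (Cotton_qapply leadE hn (rng_open Zh) (gh_det hn Zh) (gh_sym Zh) (gh_C2 r2 Zh)
  (contr_dg_closed hn r2 Zh) (scalar_curvature_contr_dg hn r2 Zh) dNE dME lowerE a b c gC3 Ux).
Qed.
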